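(* Let $T$ be a simplicial tree (not necessarily locally finite) and let $G \leq \mathrm{Aut}(T)$ be a countable group whose action on $T$ is minimal and of general type, and such that for every vertex $v$ of $T$ the fixator $G_v$ of $v$ in $G$ is amenable. Let $\Gamma$ be a subgroup of $\mathrm{Pw}(G)$ that contains $G$. Then $\Gamma$ has trivial amenable radical, and: (a) If for every half-tree $A$ of $T$ the fixator $\Gamma_A$ is non-trivial, then $\Gamma$ is not $C^\ast$-simple. (b) Assume that the stabilizers of vertices in $G$ are non-trivial. Then $\mathrm{Pw}(G)$ is not $C^\ast$-simple.
   Context: All groups are regarded as discrete groups; in particular amenability and $C^\ast$-simplicity always refer to the discrete topology. A countable group $G$ is $C^\ast$-simple if its reduced $C^\ast$-algebra (the operator norm closure of the group algebra $\mathbf{C}[G]$ acting on $\ell^2(G)$ by the left-regular representation) has no non-trivial two-sided closed ideal. The amenable radical of a group is its largest amenable normal subgroup. $\partial T$ is the set of ends of $T$. A half-tree of $T$ is one of the two components obtained when removing an edge of $T$. For a group $\Gamma$ acting on $T$ and a subtree $A$ of $T$, the fixator $\Gamma_A$ is the set of elements of $\Gamma$ fixing $A$ pointwise. The action of $G$ on $T$ is minimal if there is no proper non-empty $G$-invariant subtree. An element $g \in \mathrm{Aut}(T)$ is hyperbolic if there is a bi-infinite geodesic line on which $g$ acts by a (non-trivial) translation; it then has exactly two fixed points in $\partial T$. The action of $G$ on $T$ is of general type if there exist two hyperbolic elements of $G$ without common fixed points in $\partial T$. Definition of $\mathrm{Pw}(G)$. Let $A$ be a finite subtree of $T$, and let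 $v_1,\ldots,v_n$ be the vertices of $A$ having at least one neighbour that is not in $A$. For $i=1,\ldots,n$, let $T_i$ be the subtree of $T$ made of the vertices whose projection on $A$ is the vertex $v_i$. One writes $T \setminus A = \sqcup_{i=1}^n T_i$ (with the abuse of notation that $v_i$ lies both in $T_i$ and in $A$). For a subgroup $G \leq \mathrm{Aut}(T)$, $\mathrm{Pw}(G)$ is the set of $\gamma \in \mathrm{Aut}(T)$ for which there exists a finite subtree $A$ of $T$ such that, if $T \setminus A = \sqcup_{i=1}^n T_i$, then for every $i$ there exists $g_i \in G$ such that $\gamma$ and $g_i$ coincide on $T_i$. It is a subgroup of $\mathrm{Aut}(T)$ containing $G$. *)

(* Defs.v *)
From HB Require Import structures.
From mathcomp Require Import all_boot all_order all_algebra.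
From mathcomp Require Import complex ring.
From mathcomp Require Import all_classical all_reals all_analysis.

Set Implicit Arguments.
Unset Strict Implicit.
Unset Printing Implicit Defensive.

Import Order.TTheory GRing.Theory Num.Theory.
Import numFieldNormedType.Exports.

Local Open Scope classical_set_scope.
Local Open Scope ring_scope.

(** * Subgroups, amenability *)

Definition subgroup (gT : groupType) (H : groupClosed gT) : Type :=
  {x : gT | x \in H}.

Section Subgroup.
Variables (gT : groupType) (H : groupClosed gT).

Lemma groupClosed_closed : group_closed H.
Proof. by split; [exact: gpred1 | exact: gpredF]. Qed.

HB.instance Definition _ := SubChoice.on (subgroup H).
HB.instance Definition _ :=
  SubChoice_isSubGroup.Build gT (mem H) (subgroup H) groupClosed_closed.
End Subgroup.

(** Existence of a left-invariant mean on the bounded real functions; the values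
    of [m] on unbounded functions are irrelevant. *)
Definition amenable (R : realType) (gT : groupType) : Prop :=
  exists m : (gT -> R) -> R,
    [/\ forall (c : R) (f h : gT -> R), bounded_fun f -> bounded_fun h ->
          m (c *: f + h) = c * m f + m h,
        forall f : gT -> R, bounded_fun f -> (forall x, 0 <= f x) -> 0 <= m f,
        m (cst 1) = 1
      & forall (g : gT) (f : gT -> R), bounded_fun f ->
          m (fun x => f (g^-1 * x)%g) = m f].

Definition normal_subgroup (gT : groupType) (N : groupClosed gT) : Prop :=
  forall x y : gT, y \in N -> (y ^ x)%g \in N.

Definition is_amenable_radical (R : realType) (gT : groupType)
    (N : groupClosed gT) : Prop :=
  [/\ normal_subgroup N, amenable R (subgroup N)
    & forall M : groupClosed gT,
        normal_subgroup M -> amenable R (subgroup M) -> {subset M <= N}].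

Definition trivial_amenable_radical (R : realType) (gT : groupType) : Prop :=
  exists2 N : groupClosed gT, is_amenable_radical R N & N =i pred1 1%g.

(** * The reduced C*-algebra *)

Section L2.
Variables (R : realType) (gT : groupType).

Definition sqmod (f : gT -> R[i]) (x : gT) : \bar R :=
  (Normc.normc (f x) ^+ 2)%:E.

Definition l2_pred : {pred (gT -> R[i])} :=
  [pred f | `[< summable [set: gT] (sqmod f) >]].

Record l2 := L2 { l2_fun :> gT -> R[i]; l2P : l2_fun \in l2_pred }.

HB.instance Definition _ := [isSub for l2_fun].
HB.instance Definition _ := [Choice of l2 by <:].

Lemma sqmod_ge0 f x : (0 <= sqmod f x)%E.
Proof. by rewrite lee_fin sqr_ge0. Qed.

Lemma sqmodE (f : gT -> R[i]) x :
  sqmod f x = (complex.Re (f x) ^+ 2 + complex.Im (f x) ^+ 2)%:E.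
Proof.
by rewrite /sqmod; case: (f x) => a b /=; rewrite sqr_sqrtr// addr_ge0 ?sqr_ge0.
Qed.

Lemma l2_submod_closed : submod_closed l2_pred.
Proof.
split.
  apply/asboolP; rewrite /summable esum1 ?ltry// => x _.
  by rewrite sqmodE /= !expr0n /= addr0 normr0.
move=> a f h /asboolP sf /asboolP sh; apply/asboolP.
have sfh : summable [set: gT] (fun x => (2 * Normc.normc a ^+ 2)%:E * sqmod f x
    + 2%:E * sqmod h x)%E.
  have sZ c u : (0 <= c) -> summable [set: gT] (sqmod u) ->
      summable [set: gT] (fun x => c%:E * sqmod u x)%E.
    move=> c0; rewrite /summable => su.
    have su' : (\esum_(x in [set: gT]) sqmod u x < +oo)%E.
      apply: le_lt_trans su; apply: le_esum => x _; exact: lee_abs.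
    have bnd F : fsets [set: gT] F ->
        (\sum_(x \in F) `|c%:E * sqmod u x| <=
         c%:E * \esum_(x in [set: gT]) sqmod u x)%E.
      move=> [fF _].
      have -> : (\sum_(x \in F) `|c%:E * sqmod u x| =
                 c%:E * \sum_(x \in F) sqmod u x)%E.
        rewrite !fsbig_finite// ge0_sume_distrr; last first.
          by move=> *; exact: sqmod_ge0.
        apply: eq_bigr => x _; apply: gee0_abs.
        by apply: mule_ge0; rewrite ?lee_fin// sqr_ge0.
      rewrite lee_wpmul2l ?lee_fin//; apply: ereal_sup_ubound.
      by exists F.
    apply: (@le_lt_trans _ _ (c%:E * \esum_(x in [set: gT]) sqmod u x)%E).
      by apply: ge_ereal_sup => _ [F FT <-]; exact: bnd.
    rewrite lte_mul_pinfty ?lee_fin//.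
  by apply: summableD; apply: sZ => //; rewrite mulr_ge0 ?sqr_ge0.
apply: le_lt_trans sfh; apply: le_esum => x _.
rewrite !gee0_abs ?sqmod_ge0//; last first.
  apply: adde_ge0; apply: mule_ge0; rewrite ?sqmod_ge0// lee_fin//.
  by rewrite mulr_ge0 ?sqr_ge0.
have E : (a *: f + h) x = a * f x + h x by [].
rewrite !sqmodE lee_fin E /=.
case: a {sf sh E} => a b; case: (f x) => p q; case: (h x) => r s /=.
rewrite sqr_sqrtr ?addr_ge0 ?sqr_ge0//.
have key (u v : R) : (u + v) ^+ 2 <= 2 * u ^+ 2 + 2 * v ^+ 2.
  rewrite -subr_ge0 (_ : _ - _ = (u - v) ^+ 2) ?sqr_ge0//.
  by rewrite !sqrrD sqrrN mulr2n mulrN; ring.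
apply: le_trans (lerD (key _ _) (key _ _)) _.
by rewrite le_eqVlt; apply/orP; left; apply/eqP; ring.
Qed.

HB.instance Definition _ :=
  GRing.isSubmodClosed.Build _ _ l2_pred l2_submod_closed.
HB.instance Definition _ := [SubChoice_isSubLmodule of l2 by <:].

Definition l2norm (xi : l2) : R :=
  Num.sqrt (fine (\esum_(x in [set: gT]) sqmod xi x)).

Lemma lreg_subproof (g : gT) (xi : l2) : (fun x => xi (g^-1 * x)%g) \in l2_pred.
Proof.
apply/asboolP; have /asboolP := l2P xi; rewrite /summable.
rewrite (@reindex_esum _ _ _ [set: gT] [set: gT] (fun x => g^-1 * x)%g)//.
split=> [//|x y _ _ /mulgI//|y _]; exists (g * y)%g => //.
by rewrite mulKg.
Qed.

Definition lreg (g : gT) (xi : l2) : l2 := L2 (lreg_subproof g xi).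

(** [s] encodes the element [\sum_(cg <- s) cg.1 cg.2] of the group algebra. *)
Definition group_algebra_op (s : seq (R[i] * gT)) : l2 -> l2 :=
  fun xi => \sum_(cg <- s) cg.1 *: lreg cg.2 xi.

Definition opnorm_le (a : l2 -> l2) (c : R) : Prop :=
  forall xi, l2norm (a xi) <= c * l2norm xi.

Definition bounded_operator (a : l2 -> l2) : Prop :=
  linear a /\ exists c, opnorm_le a c.

Definition op_closure (S : set (l2 -> l2)) : set (l2 -> l2) :=
  [set a | bounded_operator a /\
     forall e : R, 0 < e -> exists2 b, S b & opnorm_le (a - b) e].

Definition reduced_cstar : set (l2 -> l2) :=
  op_closure (range group_algebra_op).

Definition closed_ideal (I : set (l2 -> l2)) : Prop :=
  [/\ I `<=` reduced_cstar,
      I 0,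
      forall (c : R[i]) a b, I a -> I b -> I (c *: a + b),
      forall a b, reduced_cstar a -> I b -> I (a \o b) /\ I (b \o a)
    & op_closure I `<=` I].

Definition cstar_simple : Prop :=
  forall I, closed_ideal I -> I = [set 0] \/ I = reduced_cstar.

End L2.

(** * Trees *)

(** No local finiteness or countability is assumed. *)
Record tree := Tree {
  vertex :> choiceType;
  adj : rel vertex;
  adj_sym : symmetric adj;
  adj_irr : irreflexive adj;
  tree_inh : inhabited vertex;
  tree_path : forall x y : vertex, exists! p : seq vertex,
    [/\ path adj x p, last x p = y & uniq (x :: p)] }.

Section Tree.
Variable T : tree.
Implicit Types (x y v w : T) (A B : set T).

Definition geodesic x y : seq T := projT1 (cid (tree_path x y)).

Definition dist x y : nat := size (geodesic x y).

(** The empty set is allowed. *)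
Definition subtree A : Prop :=
  forall x y, A x -> A y ->
    exists p, [/\ path (@adj T) x p, last x p = y & forall z, z \in p -> A z].

Definition remove_edge x y : rel T :=
  [rel u v | [&& adj u v, (u, v) != (x, y) & (u, v) != (y, x)]].

(** The component of [x] once the edge [{x, y}] is removed. *)
Definition half_tree A : Prop :=
  exists x y, adj x y /\
    A = [set z | exists2 p, path (remove_edge x y) x p & last x p = z].

Definition is_projection A x v : Prop :=
  A v /\ forall w, A w -> (dist x v <= dist x w)%N.

Definition is_ray (r : nat -> T) : Prop :=
  forall m n, dist (r m) (r (m + n)%N) = n.

Definition is_line (l : int -> T) : Prop :=
  forall (m : int) (n : nat), dist (l m) (l (m + n%:Z)) = n.

Definition end_of (r : nat -> T) : set (nat -> T) :=
  [set s | is_ray s /\ exists m n, forall k, s (m + k)%N = r (n + k)%N].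

Definition ends : set (set (nat -> T)) := [set end_of r | r in is_ray].

End Tree.

(** * Automorphisms *)

Record aut (T : tree) := Aut {
  aut_fun :> T -> T;
  aut_bij : bijective aut_fun;
  aut_adj : forall x y, adj (aut_fun x) (aut_fun y) = adj x y }.

Section AutGroup.
Variable T : tree.
Implicit Types g h : aut T.

HB.instance Definition _ := gen_eqMixin (aut T).
HB.instance Definition _ := gen_choiceMixin (aut T).

Lemma autP g h : g =1 h -> g = h.
Proof.
case: g h => [f fb fa] [k kb ka] /= /funext E; rewrite E in fb fa *.
by rewrite (Prop_irrelevance fb kb) (Prop_irrelevance fa ka).
Qed.

Definition aut_one : aut T := @Aut T id (Bijective (frefl _) (frefl _))
  (fun _ _ => erefl).

Definition aut_mul g h : aut T :=
  @Aut T (g \o h) (bij_comp (aut_bij g) (aut_bij h))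
    (fun x y => etrans (aut_adj g _ _) (aut_adj h x y)).

Lemma aut_inv_subproof g : exists k : aut T, cancel g k /\ cancel k g.
Proof.
have [k gk kg] := aut_bij g.
have ka x y : adj (k x) (k y) = adj x y by rewrite -(aut_adj g) !kg.
by exists (@Aut T k (Bijective kg gk) ka).
Qed.

Definition aut_inv g : aut T := projT1 (cid (aut_inv_subproof g)).

Lemma aut_invK g : cancel g (aut_inv g).
Proof. by rewrite /aut_inv; case: cid => k []. Qed.

Lemma aut_invVK g : cancel (aut_inv g) g.
Proof. by rewrite /aut_inv; case: cid => k []. Qed.

Lemma aut_mulA : associative aut_mul.
Proof. by move=> g h k; apply/autP. Qed.
Lemma aut_mul1g : left_id aut_one aut_mul.
Proof. by move=> g; apply/autP. Qed.
Lemma aut_mulg1 : right_id aut_one aut_mul.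
Proof. by move=> g; apply/autP. Qed.
Lemma aut_mulVg : left_inverse aut_one aut_inv aut_mul.
Proof. by move=> g; apply/autP => x /=; rewrite aut_invK. Qed.
Lemma aut_mulgV : right_inverse aut_one aut_inv aut_mul.
Proof. by move=> g; apply/autP => x /=; rewrite aut_invVK. Qed.

HB.instance Definition _ := isGroup.Build (aut T)
  aut_mulA aut_mul1g aut_mulg1 aut_mulVg aut_mulgV.

Lemma aut1E x : (1%g : aut T) x = x. Proof. by []. Qed.
Lemma autME g h x : (g * h)%g x = g (h x). Proof. by []. Qed.
Lemma autK g : cancel g g^-1%g. Proof. exact: aut_invK. Qed.
Lemma autVK g : cancel g^-1%g g. Proof. exact: aut_invVK. Qed.

Definition hyperbolic g : Prop :=
  exists l : int -> T, is_line l /\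
    exists2 k : int, k != 0 & forall n, g (l n) = l (n + k).

(** Ends are classes of rays; [g] acts on a class by direct image. *)
Definition fixes_end g (xi : set (nat -> T)) : Prop :=
  [set g \o s | s in xi] = xi.

End AutGroup.

Section TreeTheory.
Variable T : tree.
Implicit Types (x y v w : T) (A B : set T).

Lemma geodesicP x y : [/\ path (@adj T) x (geodesic x y),
  last x (geodesic x y) = y & uniq (x :: geodesic x y)].
Proof. by rewrite /geodesic; case: cid => p []. Qed.

Lemma geodesic_unique x y p : path (@adj T) x p -> last x p = y ->
  uniq (x :: p) -> p = geodesic x y.
Proof. by move=> ? ? ?; rewrite /geodesic; case: cid => q [_ /= qp]; apply/esym/qp. Qed.

Lemma subtree_geodesic A x y : subtree A -> A x -> A y ->
  forall z, z \in geodesic x y -> A z.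
Proof.
move=> sA Ax Ay; have [p [xp <- pA]] := sA x y Ax Ay.
case/shortenP: xp => q xq uq qp z.
by rewrite -(geodesic_unique xq erefl uq) => /qp /pA.
Qed.

Lemma dist_projection A x v b : subtree A -> is_projection A x v -> A b ->
  dist x b = (dist x v + dist v b)%N.
Proof.
move=> sA [Av minv] Ab.
have [xp lp up] := geodesicP x v; have [vq lq uq] := geodesicP v b.
have qA := subtree_geodesic sA Av Ab.
rewrite /dist -size_cat; congr size; apply/esym/geodesic_unique.
- by rewrite cat_path xp lp.
- by rewrite last_cat lp.
rewrite -cat_cons cat_uniq up; move: uq => /= /andP[vNq ->]; rewrite andbT /=.
apply/hasPn => z zq; apply/negP => zp; have Az := qA z zq.
suff zv : z = v by move/negP: vNq; apply; rewrite -[X in X \in _]zv.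
move: minv => /(_ z Az); rewrite /dist.
have [p1 [p2 [E lz]]] : exists p1 p2, geodesic x v = p1 ++ p2 /\ last x p1 = z.
  by case/splitPl: zp => p1 p2 lz; exists p1, p2.
rewrite E in xp lp up *.
have <- : p1 = geodesic x z.
  apply: geodesic_unique => //; first by move: xp; rewrite cat_path => /andP[].
  by move: up; rewrite -cat_cons cat_uniq => /andP[].
rewrite size_cat -[leqRHS]addn0 leq_add2l leqn0 => /nilP p20.
by rewrite -lp p20 cats0.
Qed.

Lemma projection_exists A x : A !=set0 -> exists v, is_projection A x v.
Proof.
move=> [a Aa].
have ex : exists n, `[< exists2 v, A v & dist x v = n >].
  by exists (dist x a); apply/asboolP; exists a.
case: (ex_minnP ex) => n /asboolP[v Av <-] nmin; exists v; split=> // w Aw.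
by apply: nmin; apply/asboolP; exists w.
Qed.

Lemma projection_sub A B x v a : subtree B -> A `<=` B ->
  is_projection B x v -> is_projection A v a -> is_projection A x a.
Proof.
move=> sB AB pv [Aa amin]; split=> // w Aw.
rewrite (dist_projection sB pv (AB _ Aw)) (dist_projection sB pv (AB _ Aa)).
by rewrite leq_add2l amin.
Qed.

Lemma projection_boundary A B x v w : A `<=` B -> B v -> ~ B w -> adj v w ->
  is_projection A v x -> exists2 u, adj x u & ~ A u.
Proof.
move=> AB Bv Bw vw [Ax xmin]; have [vp lp up] := geodesicP v x.
case/lastP E: (geodesic v x) vp lp up => [|p y] vp lp up.
  by exists w => [|/AB//]; rewrite -lp.
rewrite last_rcons in lp; rewrite {y}lp in E vp up *.
move: vp; rewrite rcons_path => /andP[vp xa]; exists (last v p).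
  by rewrite adj_sym.
move=> /xmin; rewrite /dist E -(geodesic_unique vp erefl) ?size_rcons ?ltnn//.
by move: up; rewrite -rcons_cons rcons_uniq => /andP[].
Qed.

Lemma subtree_hull A B : finite_set A -> finite_set B -> subtree A ->
  subtree B -> A !=set0 -> B !=set0 ->
  exists C, [/\ finite_set C, subtree C, A `<=` C & B `<=` C].
Proof.
move=> fA fB sA sB [a Aa] [b Bb].
have [ap lp _] := geodesicP a b.
pose C : set T := A `|` B `|` [set` a :: geodesic a b].
have AC : A `<=` C by move=> x; left; left.
have BC : B `<=` C by move=> x; left; right.
have pC z : z \in a :: geodesic a b -> C z by right.
exists C; split=> //.
  by rewrite !finite_setU; split => //; exact: finite_seq.
pose J x y := exists p, [/\ path (@adj T) x p, last x p = y
  & forall z, z \in p -> C z].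
have Jt x y z : J x y -> J y z -> J x z.
  move=> [p [xp lxp Cp]] [q [yq lyq Cq]]; exists (p ++ q); split.
  - by rewrite cat_path xp lxp.
  - by rewrite last_cat lxp.
  - by move=> u; rewrite mem_cat => /orP[/Cp|/Cq].
have Js x y : C x -> J x y -> J y x.
  move=> Cx [p [xp <- Cp]]; exists (rev (belast x p)); split.
  - by rewrite rev_path (eq_path (e' := @adj T))// => u v; exact: adj_sym.
  - by case: p {xp Cp} => //= u p; rewrite rev_cons last_rcons.
  - move=> z; rewrite mem_rev => /mem_belast; rewrite inE => /orP[/eqP->//|].
    exact: Cp.
have Jp z : z \in a :: geodesic a b -> J a z.
  move=> zp; have [p1 [p2 [E lz]]] :
      exists p1 p2, geodesic a b = p1 ++ p2 /\ last a p1 = z.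
    by case/splitPl: zp => p1 p2 lz; exists p1, p2.
  exists p1; split=> //; first by move: ap; rewrite E cat_path => /andP[].
  by move=> u up; apply: pC; rewrite E inE mem_cat up orbT.
have Ja z : C z -> J a z.
  case=> [[Az|Bz]|]; last exact: Jp.
    have [p [? ? pA]] := sA _ _ Aa Az.
    by exists p; split=> // u /pA /AC.
  apply: (Jt a b); first by apply: Jp; rewrite -[X in X \in _]lp mem_last.
  have [p [? ? pB]] := sB _ _ Bb Bz.
  by exists p; split=> // u /pB /BC.
move=> x y Cx Cy; apply: (Jt x a y); last exact: Ja.
by apply: Js; [exact: AC|exact: Ja].
Qed.

Lemma aut_inj (g : aut T) : injective g.
Proof. exact: can_inj (autK g). Qed.

Lemma aut_path (g : aut T) x p :
  path (@adj T) (g x) (map g p) = path (@adj T) x p.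
Proof. by elim: p x => //= y p IH x; rewrite aut_adj IH. Qed.

Lemma aut_dist (g : aut T) x y : dist (g x) (g y) = dist x y.
Proof.
have [xp lp up] := geodesicP x y.
rewrite /dist -(@geodesic_unique (g x) (g y) (map g (geodesic x y))) ?size_map//.
- by rewrite aut_path.
- by rewrite last_map lp.
- by rewrite -map_cons map_inj_uniq//; exact: aut_inj.
Qed.

Lemma aut_projection (g : aut T) A x v :
  is_projection (g @` A) (g x) (g v) <-> is_projection A x v.
Proof.
split=> [[[w Aw /aut_inj wv] vmin]|[Av vmin]]; split.
- by rewrite -wv.
- by move=> u Au; rewrite -(aut_dist g) -(aut_dist g x u); apply: vmin; exists u.
- by exists v.
- by move=> _ [u Au <-]; rewrite !aut_dist; exact: vmin.
Qed.

Lemma aut_subtree (g : aut T) A : subtree A -> subtree (g @` A).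
Proof.
move=> sA _ _ [x Ax <-] [y Ay <-]; have [p [xp lp pA]] := sA x y Ax Ay.
exists (map g p); split; first by rewrite aut_path.
  by rewrite last_map lp.
by move=> _ /mapP[u /pA Au ->]; exists u.
Qed.

End TreeTheory.

Section Actions.
Variables (T : tree) (G : groupClosed (aut T)).

Definition minimal_action : Prop :=
  forall A : set T, subtree A -> A !=set0 ->
    (forall g, g \in G -> g @` A = A) -> A = setT.

Definition general_type : Prop :=
  exists g h : aut T,
    [/\ g \in G, h \in G, hyperbolic g, hyperbolic h
      & ~ exists xi, [/\ ends xi, fixes_end g xi & fixes_end h xi]].

Definition fixator (A : set T) : {pred (aut T)} :=
  [pred g | (g \in G) && `[< forall x, A x -> g x = x >]].

(** [gamma] coincides with an element of [G] on each subtree [T_i] hanging off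
    [A], i.e. on the fibres of the projection to [A] over the vertices of [A]
    that have a neighbour outside [A]. *)
Definition piecewise (gamma : aut T) (A : set T) : Prop :=
  forall v, A v -> (exists2 w, adj v w & ~ A w) ->
    exists2 g, g \in G & forall x, is_projection A x v -> gamma x = g x.

Definition Pw : {pred (aut T)} :=
  [pred gamma : aut T | `[< exists A : set T,
     [/\ finite_set A, A !=set0, subtree A
       & piecewise gamma A] >]].

Section Fixator.
Variable A : set T.

Lemma fixator_mul1 : 1%g \in fixator A.
Proof. by rewrite !inE gpred1; apply/asboolP. Qed.
Lemma fixator_mul : {in fixator A &, forall g h, (g * h)%g \in fixator A}.
Proof.
move=> g h /andP[gG /asboolP gA] /andP[hG /asboolP hA].
by apply/andP; split; [exact: gpredM|apply/asboolP => x Ax; rewrite autME hA ?gA].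
Qed.
Lemma fixator_inv : {in fixator A, forall g, g^-1%g \in fixator A}.
Proof.
move=> g /andP[gG /asboolP gA]; apply/andP; split; first exact: gpredVr.
by apply/asboolP => x Ax; rewrite -{1}(gA x Ax) autK.
Qed.
HB.instance Definition _ := isMulClosed.Build (aut T) (fixator A) fixator_mul.
HB.instance Definition _ := isMul1Closed.Build (aut T) (fixator A) fixator_mul1.
HB.instance Definition _ := isInvClosed.Build (aut T) (fixator A) fixator_inv.
End Fixator.

Lemma piecewise_sub gamma A B : A !=set0 -> subtree B -> A `<=` B ->
  piecewise gamma A -> piecewise gamma B.
Proof.
move=> A0 sB AB pA v Bv [w vw Bw].
have [a pa] := projection_exists v A0.
have [u au Au] := projection_boundary AB Bv Bw vw pa.
have [g gG gE] := pA a pa.1 (ex_intro2 _ _ u au Au).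
by exists g => // x pv; apply/gE/(projection_sub sB AB pv pa).
Qed.

Lemma Pw_mul1 : 1%g \in Pw.
Proof.
have [x0] := tree_inh T; apply/asboolP; exists [set x0]; split.
- exact: finite_set1.
- by exists x0.
- by move=> _ _ -> ->; exists [::].
- by move=> v _ _; exists 1%g => //; exact: gpred1.
Qed.

Lemma Pw_mul : {in Pw &, forall g h, (g * h)%g \in Pw}.
Proof.
move=> g h /asboolP[A [fA A0 sA pA]] /asboolP[B [fB B0 sB pB]].
have [C [fC sC AC BC]] := subtree_hull (finite_image (h^-1)%g fA) fB
  (@aut_subtree _ (h^-1)%g _ sA) sB (image_nonempty _ A0) B0.
have AhC : A `<=` h @` C.
  by move=> x Ax; exists (h^-1%g x); [apply: AC; exists x|rewrite autVK].
have C0 : C !=set0 by have [b /BC] := B0; exists b.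
have pgC := piecewise_sub A0 (@aut_subtree _ h _ sC) AhC pA.
have phC := piecewise_sub B0 sC BC pB.
apply/asboolP; exists C; split=> // v Cv [w vw Cw].
have [k kG kE] := phC v Cv (ex_intro2 _ _ w vw Cw).
have [||l lG lE] := pgC (h v); first by exists v.
  by exists (h w); [rewrite aut_adj|move=> [u Cu /aut_inj uw]; rewrite uw in Cu].
exists (l * k)%g; first exact: gpredM.
move=> x xv; rewrite !autME -kE//; apply: lE.
exact/aut_projection.
Qed.

Lemma Pw_inv : {in Pw, forall g, g^-1%g \in Pw}.
Proof.
move=> g /asboolP[A [fA A0 sA pA]]; apply/asboolP; exists (g @` A); split.
- exact: finite_image.
- exact: image_nonempty.
- exact: aut_subtree.
- move=> _ [v Av <-] [w vw Aw].
  have [|k kG kE] := pA v Av.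
    exists (g^-1%g w); first by rewrite -(aut_adj g) autVK.
    by move=> Agw; apply: Aw; exists (g^-1%g w); rewrite ?autVK.
  exists k^-1%g; first exact: gpredVr.
  move=> x; rewrite -{1}(autVK g x) => /aut_projection xv.
  by rewrite -{2}(autVK g x) (kE _ xv) autK.
Qed.

HB.instance Definition _ := isMulClosed.Build (aut T) Pw Pw_mul.
HB.instance Definition _ := isMul1Closed.Build (aut T) Pw Pw_mul1.
HB.instance Definition _ := isInvClosed.Build (aut T) Pw Pw_inv.

End Actions.

Definition nontrivial (gT : groupType) (S : {pred gT}) : Prop :=
  exists2 g, g \in S & g != 1%g.

(* Main.v *)
Require Import Defs.
From HB Require Import structures.
From mathcomp Require Import all_boot all_order all_algebra.
From mathcomp Require Import complex ring lra zify.
From mathcomp Require Import all_classical all_reals all_analysis.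

(** A hyperbolic element pushes every half-tree that misses its repelling end
    into any given neighbourhood of its attracting end. With minimality and
    general type, it follows that [G] maps any half-tree into any other one.

    If [M] is an amenable non-trivial normal subgroup of [Gam], some element of
    [M] maps some half-tree off itself; by conjugation, every half-tree is mapped
    off itself by some element of [M]. An [M]-invariant mean on an orbit of vertices then gives
    mass [1/2] to every half-tree, which is absurd at a vertex with three
    neighbours.

    The stabilizer of a vertex [v] in [Pw G] is amenable: around [v] an element
    agrees with an element of the amenable group [G_v] outside finitely many
    branches; elements supported on finitely many branches permute these through
    a finite group, and those preserving each branch form a product of groups of
    the same kind, with a smaller witness of piecewiseness.

    If [a] and [b] are non-trivial and fix pointwise two complementary
    half-trees, then every vertex is fixed by [a] or by [b], so that
    [(1 - a) (1 - b)] vanishes in the quasi-regular representation on the orbit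
    of [v]. As the stabilizer [H] of [v] is amenable, this representation is
    weakly contained in the regular one, i.e. it is seen by vectors of the
    regular representation that are almost [H]-invariant; the operators that
    vanish there form a closed ideal containing [(1 - a) (1 - b)] but not [1]. *)

Set Implicit Arguments.
Unset Strict Implicit.
Unset Printing Implicit Defensive.

Import Order.TTheory GRing.Theory Num.Theory.
Import numFieldNormedType.Exports.

Local Open Scope classical_set_scope.

(** * Half-trees *)

Section TreeMetric.
Variable T : tree.
Implicit Types (x y z u v w : T) (A B C : set T).

(** Two obstacles shape the proof. The witnesses of the elements of [Pw G] have no common bound, and
    a vertex may have infinitely many neighbours. The tree is therefore rooted at [v], the radius
    [n] of the witness is fixed, and amenability is proved by induction from depth [n] back to the
    root, directed unions taking care of the finite exceptional sets and of the radius. Subgroups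
    are plain sets, and extensions are handled by averaging over a section: near a vertex an element
    determines an element of [G] only up to an equivalence of germs.

    The reduced algebra is given by operators on the square summable functions on the group, so no
    other Hilbert space is built: the vectors of the quasi-regular representation are replaced by
    combinations of translates of a vector [xi]. Such a [xi] comes from an invariant mean by a
    separation argument in the space of summable functions, followed by a square root. *)

Lemma dist_path x p : path (@adj T) x p -> (dist x (last x p) <= size p)%N.
Proof.
case/shortenP => q xq uq qp; rewrite /dist -(geodesic_unique xq erefl uq).
by apply: uniq_leq_size => //; case/andP: uq.
Qed.

Lemma geodesic_min x p :
  path (@adj T) x p -> size p = dist x (last x p) -> p = geodesic x (last x p).
Proof.
move=> xp sp; apply: geodesic_unique => //; apply: contraT => Np.
move: sp; case: (shortenP xp) => q xq uq qp.
rewrite /dist -(geodesic_unique xq erefl uq) => spq.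
have uq' : uniq q by case/andP: uq.
have [_ e] := uniq_min_size uq' qp (eq_leq spq).
case/negP: Np; apply: (leq_size_uniq uq) => [z|]; last by rewrite /= spq.
by rewrite !inE => /orP[->//|/qp ->]; rewrite orbT.
Qed.

Lemma distxx x : dist x x = 0%N.
Proof. by have := @dist_path x [::] isT; rewrite leqn0 => /eqP. Qed.

Lemma dist_eq0 x y : (dist x y == 0%N) = (x == y).
Proof.
apply/idP/eqP => [/nilP e|->]; last by rewrite distxx.
by have [_ <- _] := geodesicP x y; rewrite e.
Qed.

Lemma dist_triangle y x z : (dist x z <= dist x y + dist y z)%N.
Proof.
have [xp lp _] := geodesicP x y; have [yq lq _] := geodesicP y z.
have := @dist_path x (geodesic x y ++ geodesic y z).
by rewrite cat_path xp lp yq last_cat lp lq size_cat => /(_ isT).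
Qed.

Lemma dist_sym x y : dist x y = dist y x.
Proof.
suff le u v : (dist v u <= dist u v)%N by apply/eqP; rewrite eqn_leq !le.
have [up lp _] := geodesicP u v.
have := @dist_path v (rev (belast u (geodesic u v))).
rewrite size_rev size_belast -[v in path _ v]lp rev_path.
rewrite (eq_path (e' := @adj T)) => [|a b]; last exact: adj_sym.
move=> /(_ up) le; apply: leq_trans le; rewrite leq_eqVlt; apply/orP; left.
apply/eqP; congr dist; case: (geodesic u v) lp => //= a p _.
by rewrite rev_cons last_rcons.
Qed.

Lemma dist_adj x y : adj x y -> dist x y = 1%N.
Proof.
move=> xy; have := @dist_path x [:: y]; rewrite /= xy => /(_ isT) le1.
apply/eqP; rewrite eqn_leq le1 lt0n dist_eq0.
by apply/eqP => e; rewrite e adj_irr in xy.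
Qed.

Lemma dist_geodesic x y z :
  z \in x :: geodesic x y -> dist x y = (dist x z + dist z y)%N.
Proof.
have [xp lp up] := geodesicP x y => zin.
have [p [q [E lz]]] : exists p q, geodesic x y = p ++ q /\ last x p = z.
  by case/splitPl: zin => p q lz; exists p, q.
move: xp lp; rewrite E cat_path last_cat lz => /andP[xp zq] lq.
have := dist_path xp; have := dist_path zq; rewrite lz lq => le1 le2.
have e : dist x y = (size p + size q)%N by rewrite /dist E size_cat.
by apply/eqP; rewrite eqn_leq dist_triangle e leq_add.
Qed.

Lemma step_toward x y : x != y ->
  exists z, adj x z /\ dist x y = (dist z y).+1.
Proof.
move=> xy; have [xp lp up] := geodesicP x y.
case E: (geodesic x y) xp lp up => [|z p] /=; first by move=> _ /eqP/idPn.
move=> /andP[xz zp] lp /andP[_ up]; exists z; split=> //.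
by rewrite /dist -(geodesic_unique zp lp up) E.
Qed.

Lemma step_toward_uniq x y z z' : adj x z -> adj x z' ->
  dist x y = (dist z y).+1 -> dist x y = (dist z' y).+1 -> z = z'.
Proof.
have key w : adj x w -> dist x y = (dist w y).+1 ->
    w :: geodesic w y = geodesic x y.
  move=> xw e; have [wp lp _] := geodesicP w y.
  have {2}-> : y = last x (w :: geodesic w y) by [].
  by apply: geodesic_min; rewrite /= ?xw ?lp.
by move=> xz xz' /(key _ xz) e /(key _ xz'); rewrite -e => -[].
Qed.

(** A tree is bipartite: were [x] and [y] equally far from [z], prefixing [x] to the geodesic from
    [y] to [z] would give a simple path from [x] to [z] that is one step too long. *)
Lemma dist_adj_neq x y z : adj x y ->
  dist z y = (dist z x).+1 \/ dist z x = (dist z y).+1.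
Proof.
move=> xy; have xy1 := dist_adj xy; have yx1 := xy1; rewrite dist_sym in yx1.
have := dist_triangle x z y; have := dist_triangle y z x.
suff : dist z x <> dist z y by lia.
rewrite !(dist_sym z) => e; have [yp lp up] := geodesicP y z.
have xNp : x \notin y :: geodesic y z.
  by apply/negP => /dist_geodesic; lia.
have : y :: geodesic y z = geodesic x z.
  by apply: geodesic_unique; [rewrite /= xy|rewrite /= lp|rewrite cons_uniq xNp].
by move/(congr1 size) => /=; move: e; rewrite /dist; lia.
Qed.

(** For adjacent [x] and [y] this is the half-tree on the side of [x], by [half_treeP]; stated with
    distances, membership is within the reach of [lia]. *)
Definition half x y : set T := [set z | (dist z x < dist z y)%N].

Lemma half_root x y : adj x y -> half x y x.
Proof. by move=> xy; rewrite /half /= distxx dist_adj. Qed.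

Lemma halfC x y z : adj x y -> half y x z <-> ~ half x y z.
Proof. by move=> xy; rewrite /half /=; have := dist_adj_neq z xy; lia. Qed.

Lemma halfNC x y z : adj x y -> ~ half y x z <-> half x y z.
Proof. by move=> xy; rewrite /half /=; have := dist_adj_neq z xy; lia. Qed.

(** If [u] were not [x], its neighbour towards [x] would also be its neighbour towards [y], and so
    would [w]; but [w] is farther from [x] than [u] is. *)
Lemma half_cross x y u w : adj x y -> adj u w -> half x y u -> ~ half x y w ->
  u = x /\ w = y.
Proof.
move=> xy uw; rewrite /half /= => hu hw.
have := dist_adj_neq u xy; have := dist_adj_neq w xy.
have := dist_adj_neq x uw; have := dist_adj_neq y uw.
rewrite !(dist_sym x) !(dist_sym y) => ey ex ew eu.
have ewy : dist w x = (dist w y).+1 by lia.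
have euy : dist u y = (dist u x).+1 by lia.
have e : dist u x = dist w y by lia.
have [ux|ux] := eqVneq u x.
  by split=> //; apply/eqP; rewrite -dist_eq0 -e ux distxx.
have [z [uz ez]] := step_toward ux.
have zz := dist_adj_neq z xy.
have := dist_adj_neq y uz; rewrite !(dist_sym y) => yz.
suff zw : z = w by rewrite zw in ez; lia.
by apply: (step_toward_uniq uz uw (y := y)); lia.
Qed.

Lemma rooted_subtree C x :
  (forall z, C z -> exists p, [/\ path (@adj T) z p, last z p = x &
    forall t, t \in p -> C t]) -> subtree C.
Proof.
move=> H u w Cu Cw.
have [p [up lp pH]] := H u Cu; have [q [wq lq qH]] := H w Cw.
exists (p ++ rev (belast w q)); split.
- rewrite cat_path up lp -lq rev_path (eq_path (e' := @adj T))// => a b; exact: adj_sym.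
- rewrite last_cat lp; case: q lq {wq qH} => [<-//|a q _].
  by rewrite [belast _ _]/= rev_cons last_rcons.
- move=> t; rewrite mem_cat => /orP[/pH//|]; rewrite mem_rev => /mem_belast.
  by rewrite inE => /orP[/eqP->//|/qH].
Qed.

Lemma half_subtree x y : subtree (half x y).
Proof.
apply: (@rooted_subtree _ x) => z hz; have [zp lp _] := geodesicP z x.
exists (geodesic z x); split=> // t tp.
have := @dist_geodesic z x t; rewrite inE tp orbT => /(_ isT).
by have := dist_triangle t z y; move: hz; rewrite /half /=; lia.
Qed.

Lemma path_cross (P : set T) x p : path (@adj T) x p -> P x -> ~ P (last x p) ->
  exists u w, [/\ adj u w, P u, ~ P w, u \in x :: p & w \in x :: p].
Proof.
elim: p x => //= y p IH x /andP[xy yp] Px Nl.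
have [Py|NPy] := pselect (P y).
  have [u [w [uw Pu Pw up wp]]] := IH y yp Py Nl.
  by exists u, w; split=> //; rewrite inE ?up ?wp orbT.
by exists x, y; rewrite !inE !eqxx ?orbT; split.
Qed.

Lemma subtree_cross C x y a b : adj x y -> subtree C -> C a -> C b ->
  half x y a -> half y x b -> C x /\ C y.
Proof.
move=> xy sC Ca Cb ha /(halfC _ xy) hb; have [p [ap lp pC]] := sC a b Ca Cb.
rewrite -lp in hb.
have [u [w [uw hu hw up wp]]] := path_cross ap ha hb.
have Cin t : t \in a :: p -> C t by rewrite inE => /orP[/eqP->//|/pC].
by have [ux wy] := half_cross xy uw hu hw; rewrite -ux -wy; split; exact: Cin.
Qed.

Lemma half_treeP A : half_tree A <-> exists x y, adj x y /\ A = half x y.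
Proof.
have main x y : adj x y ->
    [set z | exists2 p, path (remove_edge x y) x p & last x p = z] = half x y.
  move=> xy.
  have key p u : path (remove_edge x y) u p -> half x y u -> half x y (last u p).
    elim: p u => //= w p IH u /andP[/and3P[uw n1 n2] wp] hu; apply: IH => //.
    have [//|hw] := pselect (half x y w).
    by have [ux wy] := half_cross xy uw hu hw; rewrite ux wy eqxx in n1.
  have Ny : ~ half x y y by apply/(halfC _ xy)/half_root; rewrite adj_sym.
  have key' p u : path (@adj T) u p -> half x y u ->
      (forall t, t \in p -> half x y t) -> path (remove_edge x y) u p.
    elim: p u => //= w p IH u /andP[uw wp] hu pH.
    have hw : half x y w by apply: pH; rewrite inE eqxx.
    rewrite (IH w)// ?andbT => [|t tp]; last by apply: pH; rewrite inE tp orbT.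
    rewrite /remove_edge /= uw /=.
    by apply/andP; split; apply/eqP => -[e1 e2]; [rewrite e2 in hw|rewrite e1 in hu].
  apply/seteqP; split=> z /=; first by move=> [p xp <-]; apply: key => //; exact: half_root.
  move=> hz; have [p [up lp pH]] := half_subtree (half_root xy) hz.
  by exists p => //; apply: key' => //; exact: half_root.
split=> [[x [y [xy ->]]]|[x [y [xy ->]]]]; exists x, y; split=> //; first exact: main.
by rewrite main.
Qed.

Lemma aut_halfE (g : aut T) x y z : half (g x) (g y) (g z) <-> half x y z.
Proof. by rewrite /half /= !aut_dist. Qed.

Lemma half_disjoint v u u' z : adj u v -> adj u' v -> u != u' ->
  half u v z -> half u' v z -> False.
Proof.
rewrite /half /= => uv u'v uu' h h'.
have := dist_adj_neq z uv; have := dist_adj_neq z u'v => e e'.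
move/eqP: uu'; apply; apply: (@step_toward_uniq v z); rewrite 1?adj_sym//.
  by rewrite !(dist_sym _ z); lia.
by rewrite !(dist_sym _ z); lia.
Qed.

End TreeMetric.

(** * Hyperbolic elements *)

Section Lines.
Variable T : tree.
Implicit Types (x y z u v w : T) (A B C : set T) (g h : aut T) (l : int -> T) (m n k : int).

Lemma adj_dist x y : dist x y = 1%N -> adj x y.
Proof.
have [->|xy e] := eqVneq x y; first by rewrite distxx.
have [z [xz]] := step_toward xy; rewrite e => -[/esym/eqP].
by rewrite dist_eq0 => /eqP <-.
Qed.

Lemma geodesic_mem x y z :
  dist x y = (dist x z + dist z y)%N -> z \in x :: geodesic x y.
Proof.
move=> e; have [xz lz _] := geodesicP x z; have [zy ly _] := geodesicP z y.
have lxy : last x (geodesic x z ++ geodesic z y) = y by rewrite last_cat lz ly.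
have /(geodesic_min (x := x)) : path (@adj T) x (geodesic x z ++ geodesic z y).
  by rewrite cat_path xz lz.
rewrite size_cat lxy => <-; last by rewrite e.
by rewrite -cat_cons mem_cat -{1}lz mem_last.
Qed.

Lemma line_dist l m n : is_line l -> dist (l m) (l n) = `|m - n|%N.
Proof.
move=> ll; wlog mn : m n / (m <= n)%R => [H|].
  have [/H//|/ltW/H] := leP m n; rewrite dist_sym => ->.
  by rewrite distnC.
have {1}-> : n = (m + `|m - n|%N%:Z)%R by lia.
exact: ll.
Qed.

Lemma line_inj l : is_line l -> injective l.
Proof. by move=> ll m n e; have := line_dist m n ll; rewrite e distxx; lia. Qed.

Lemma line_adj l n : is_line l -> adj (l n) (l (n + 1)%R).
Proof. by move=> ll; apply: adj_dist; rewrite line_dist//; lia. Qed.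

Definition rev_line l : int -> T := fun n => l (- n)%R.

Lemma line_rev l : is_line l -> is_line (rev_line l).
Proof. by move=> ll m n; rewrite /rev_line line_dist//; lia. Qed.

Lemma line_aut h l : is_line l -> is_line (h \o l).
Proof. by move=> ll m n /=; rewrite aut_dist. Qed.

Lemma line_convex l C a b n : is_line l -> subtree C -> C (l a) -> C (l b) ->
  (a <= n <= b)%R -> C (l n).
Proof.
move=> ll sC Ca Cb nab.
have : l n \in l a :: geodesic (l a) (l b).
  by apply: geodesic_mem; rewrite !line_dist//; lia.
by rewrite inE => /orP[/eqP->//|]; exact: subtree_geodesic.
Qed.

(** The half-tree ahead of the edge from [l n] to [l (n + 1)]. These shrink as [n] grows and serve
    as neighbourhoods of the positive end of [l]. *)
Definition lhalf l (n : int) : set T := half (l (n + 1)%R) (l n).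

Lemma lhalfS l n : is_line l -> lhalf l (n + 1)%R `<=` lhalf l n.
Proof.
move=> ll z hz; apply/halfNC; first by rewrite adj_sym; exact: line_adj.
have a1 := line_adj n ll; have a2 := line_adj (n + 1) ll.
rewrite adj_sym in a1; have a1' := dist_adj_neq z a1; have a2' := dist_adj_neq z a2.
move: hz; rewrite /lhalf /half /= => hz hz'.
(* Both vertices would be the step from [l (n + 1)] towards [z]. *)
have /(line_inj ll) : l n = l (n + 1 + 1)%R; last by lia.
apply: (step_toward_uniq a1 a2 (y := z)); rewrite !(dist_sym _ z); lia.
Qed.

Lemma lhalf_le l m n : is_line l -> (m <= n)%R -> lhalf l n `<=` lhalf l m.
Proof.
move=> ll mn; have -> : n = (m + `|n - m|%N%:Z)%R by lia.
elim: `|n - m|%N => [|j IH]; first by rewrite addr0.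
rewrite -addn1 PoszD addrA; exact: subset_trans (lhalfS ll) IH.
Qed.

(** Were [z] ahead of every edge, each step along [l] from [l 0] would come closer to it, for
    ever. *)
Lemma lhalf_far l z : is_line l ->
  exists N, forall n, (N <= n)%R -> ~ lhalf l n z.
Proof.
move=> ll; apply: contrapT => H.
have inH n : lhalf l n z.
  apply: contrapT => nz; apply: H; exists n => m nm /(lhalf_le ll nm).
  exact: nz.
have key (j : nat) : (dist z (l (Posz j)) + j <= dist z (l 0%R))%N.
  elim: j => [|j IH]; first by rewrite addn0.
  have := inH j; rewrite /lhalf /half /= => hj.
  by rewrite (_ : Posz j.+1 = (Posz j + 1)%R); lia.
by have := key (dist z (l 0%R)).+1; lia.
Qed.

(** The edge from [n] to [n + 1] of the reversed line is the edge from [- n] to [- n - 1] of [l],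
    which accounts for the shift by one. *)
Lemma lhalf_rev l n z : is_line l -> lhalf (rev_line l) n z <-> ~ lhalf l (- n - 1)%R z.
Proof.
move=> ll; rewrite /lhalf /rev_line -halfC; last by rewrite adj_sym; exact: line_adj.
have -> : (- n - 1 + 1 = - n)%R by lia.
by have -> : (- (n + 1) = - n - 1)%R by lia.
Qed.

Lemma lhalf_near l z : is_line l ->
  exists N, forall n, (n <= N)%R -> lhalf l n z.
Proof.
move=> ll; have [N HN] := lhalf_far z (line_rev ll).
exists (- N - 1)%R => n nN; apply: contrapT => nz.
apply: (HN (- n - 1)%R); first by lia.
by apply/lhalf_rev => //; rewrite (_ : (- (- n - 1) - 1 = n)%R)//; lia.
Qed.

(** For a half-tree [A]: the positive end of [l] lies in [A]. The negative end is treated through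
    [rev_line l]. *)
Definition tail_in l A := exists N, forall n, (N <= n)%R -> A (l n).

Lemma line_avoid l x : is_line l -> exists N, forall n, (N <= n)%R -> l n <> x.
Proof.
move=> ll; have [[n0 e]|H] := pselect (exists n, l n = x); last first.
  by exists 0%R => n _ e; apply: H; exists n.
by exists (n0 + 1)%R => n nn; rewrite -e => /(line_inj ll); lia.
Qed.

(** Once past [x] and [y], the line can no longer cross the edge between them. *)
Lemma line_tail l x y : is_line l -> adj x y ->
  tail_in l (half x y) \/ tail_in l (half y x).
Proof.
move=> ll xy; have [N1 H1] := line_avoid x ll; have [N2 H2] := line_avoid y ll.
set N := Num.max N1 N2.
have HN n : (N <= n)%R -> l n <> x /\ l n <> y.
  by rewrite /N ge_max => /andP[n1 n2]; split; [exact: H1|exact: H2].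
have step n : (N <= n)%R -> half x y (l n) <-> half x y (l (n + 1)%R).
  move=> Nn; have [n1 n2] := HN _ Nn; have a := line_adj n ll.
  split=> h; apply: contrapT => h'.
    by have [] := half_cross xy a h h'.
  by rewrite adj_sym in a; have [] := half_cross xy a h h'.
have key (j : nat) : half x y (l N) <-> half x y (l (N + j%:Z)%R).
  elim: j => [|j IH]; first by rewrite addr0.
  by rewrite IH step ?lerDl// -addn1 PoszD addrA.
have key' n : (N <= n)%R -> half x y (l N) <-> half x y (l n).
  by move=> Nn; rewrite (key `|n - N|%N) (_ : (N + `|n - N|%N%:Z)%R = n)//; lia.
have [h|h] := pselect (half x y (l N)); [left|right]; exists N => n Nn.
  exact/key'.
by apply/halfC => //; rewrite -key'.
Qed.

Lemma tail_disjoint l A B : tail_in l A -> tail_in l B -> exists z, A z /\ B z.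
Proof.
move=> [N1 H1] [N2 H2]; exists (l (Num.max N1 N2)).
by split; [apply: H1|apply: H2]; rewrite le_max lexx ?orbT.
Qed.

Lemma tail_half_not l x y : is_line l -> adj x y ->
  tail_in l (half y x) <-> ~ tail_in l (half x y).
Proof.
move=> ll xy; split=> [h h'|h]; last by have [] := line_tail ll xy.
by have [z [/(halfC _ xy) ]] := tail_disjoint h h'.
Qed.

Lemma tail_lhalf l x y N0 : is_line l -> adj x y -> tail_in l (half x y) ->
  exists2 n, (N0 <= n)%R & lhalf l n `<=` half x y.
Proof.
move=> ll xy [N H]; have [M HM] := lhalf_far y ll.
pose n := Num.max N0 (Num.max N M).
have nN : (N <= n)%R by rewrite /n !le_max lexx !orbT.
have nM : (M <= n)%R by rewrite /n !le_max lexx !orbT.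
exists n; first by rewrite /n le_max lexx.
move=> z hz; apply: contrapT => /(halfC _ xy) hz'.
have yx : adj y x by rewrite adj_sym.
have Hy : half (l n) (l (n + 1)%R) y by apply/halfC; [rewrite adj_sym; exact: line_adj|exact: HM].
(* The subtree [half y x] would contain [y] behind this edge and [z] ahead of it, hence also [l n],
   which lies in [half x y]. *)
have [] := subtree_cross (line_adj n ll) (half_subtree (x := y) (y := x)) (half_root yx) hz' Hy hz.
by move=> /(halfC _ xy) h _; apply: h; exact: H.
Qed.

(** The sign of [k] orients the axis: the positive end of [l] is attracting, and that of
    [rev_line l] repelling. *)
Definition axis g l (k : int) : Prop :=
  [/\ is_line l, (0 < k)%R & forall n, g (l n) = l (n + k)%R].

Lemma axis_line g l k : axis g l k -> is_line l.
Proof. by case. Qed.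

Lemma hyperbolicP g : hyperbolic g <-> exists l k, axis g l k.
Proof.
split=> [[l [ll [k k0 gl]]]|[l [k [ll k0 gl]]]]; last first.
  by exists l; split=> //; exists k => //; rewrite gt_eqF.
have [kgt|kle] := ltP 0%R k; first by exists l, k.
exists (rev_line l), (- k)%R; split; first exact: line_rev.
  by rewrite oppr_gt0 lt_neqAle k0.
by move=> n /=; rewrite /rev_line gl opprD opprK.
Qed.

Lemma axis_inv g l k : axis g l k -> axis g^-1%g (rev_line l) k.
Proof.
move=> [ll k0 gl]; split=> //; first exact: line_rev.
by move=> n /=; rewrite /rev_line -{1}[(- n)%R](subrK k) -gl autK opprD.
Qed.

Lemma axis_conj g h l k : axis g l k -> axis (h * g * h^-1)%g (h \o l) k.
Proof.
move=> [ll k0 gl]; split=> //; first exact: line_aut.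
by move=> n; rewrite /comp !autME autK gl.
Qed.

Lemma axis_pow g l k (j : nat) n : axis g l k -> (g ^+ j)%g (l n) = l (n + k * j%:Z)%R.
Proof.
move=> [ll k0 gl]; elim: j => [|j IH]; first by rewrite mulr0 addr0.
by rewrite expgS autME IH gl; congr l; rewrite -addn1 PoszD; ring.
Qed.

Lemma axis_contract g l k x y n0 : axis g l k -> adj x y ->
  ~ tail_in (rev_line l) (half x y) ->
  exists j : nat, forall z, half x y z -> lhalf l n0 ((g ^+ j)%g z).
Proof.
move=> ax xy; have [ll k0 gl] := ax.
move/(tail_half_not (line_rev ll) xy) => [N H].
have [M HM] := lhalf_near x ll.
(* So far back that [l m] is outside [half x y] while [x] is ahead of the edge at [m]; the whole of
   [half x y] is then ahead of that edge. *)
pose m := Num.min (- N - 1)%R M.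
have mN : (m <= - N - 1)%R by rewrite /m ge_min lexx.
have mM : (m <= M)%R by rewrite /m ge_min lexx orbT.
have Hm : half x y `<=` lhalf l m.
  move=> z hz; apply: contrapT => nz.
  have a := line_adj m ll.
  have {}nz : half (l m) (l (m + 1)%R) z by apply/halfC => //; rewrite adj_sym.
  have [] := subtree_cross a (half_subtree (x := x) (y := y)) hz (half_root xy) nz (HM m mM).
  move=> + _; have := H (- m)%R; rewrite /rev_line opprK => /(_ ltac:(lia)).
  by move=> /(halfC _ xy).
(* Each application of [g] advances the edge by [k], which is at least one, so this many
   applications bring index [m] to [n0] or beyond. *)
exists `|n0 - m|%N => z /Hm hz.
have : lhalf l (m + k * `|n0 - m|%N%:Z)%R ((g ^+ `|n0 - m|)%g z).
  rewrite /lhalf addrAC -!(axis_pow _ _ ax); exact/aut_halfE.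
by apply: lhalf_le => //; nia.
Qed.

End Lines.

(** * Lines sharing an end *)

Section Ends.
Variable T : tree.
Implicit Types (x y z u v w : T) (g h : aut T) (l : int -> T) (m n k : int).

Lemma rev_lineK l : rev_line (rev_line l) = l.
Proof. by apply/funext => n; rewrite /rev_line opprK. Qed.

Lemma tail_cross l u v n : is_line l -> adj u v -> ~ half u v (l n) ->
  tail_in l (half u v) ->
  exists m, l m = v /\ l (m + 1)%R = u.
Proof.
move=> ll uv nn [N HN].
have [j Hj] : exists j : nat, half u v (l (n + Posz j)%R).
  by exists `|Num.max 0%R (N - n)%R|%N; apply: HN; lia.
elim: j Hj => [|j IH]; first by rewrite addr0.
rewrite (_ : n + Posz j.+1 = n + Posz j + 1)%R; last by lia.
have [/IH//|nj hj] := pselect (half u v (l (n + Posz j)%R)).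
exists (n + Posz j)%R.
have a := line_adj (n + Posz j)%R ll; rewrite adj_sym in a.
by have [-> ->] := half_cross uv a hj nj.
Qed.

(** The line [l] finally runs along [L] backwards: the positive end of [l] is the negative end of
    [L]. *)
Definition cofinal l (L : int -> T) :=
  exists a b : int, forall j : nat, l (a + Posz j)%R = L (b - Posz j)%R.

(** The tail of [l] is behind every edge of [L], so [l] crosses each edge far enough back. As [l]
    visits a vertex only once, each crossing immediately follows the previous one. *)
Lemma tail_cofinal l L : is_line l -> is_line L ->
  (forall n, tail_in l (half (L n) (L (n + 1)%R))) -> cofinal l L.
Proof.
move=> ll lL H; have [b Hb] := lhalf_near (l 0%R) lL.
have LA n := line_adj n lL.
have nb : ~ half (L b) (L (b + 1)%R) (l 0%R).
  by move=> /halfC; apply; [rewrite adj_sym|exact: Hb].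
have [i [_ i2]] := tail_cross ll (LA b) nb (H b).
exists (i + 1)%R, b; elim=> [|j IH]; first by rewrite addr0 subr0.
have Hn := H (b - Posz j - 1)%R; have An := LA (b - Posz j - 1)%R.
rewrite subrK in Hn An.
have n1 : ~ half (L (b - Posz j - 1)%R) (L (b - Posz j)%R) (l (i + 1 + Posz j)%R).
  by rewrite IH => /halfC; apply; rewrite 1?adj_sym//; apply: half_root; rewrite adj_sym.
have [m [m1 m2]] := tail_cross ll An n1 Hn.
have em : m = (i + 1 + Posz j)%R by apply: (line_inj ll); rewrite m1 IH.
rewrite (_ : (b - Posz j.+1 = b - Posz j - 1)%R); last by lia.
by rewrite -m2 em; congr l; lia.
Qed.

Definition neg_end L : set (nat -> T) := end_of (fun i : nat => L (- Posz i)%R).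

Lemma neg_end_in L : is_line L -> ends (neg_end L).
Proof.
move=> lL; exists (fun i : nat => L (- Posz i)%R) => // m n.
by rewrite line_dist//; lia.
Qed.

Lemma cofinal_fixes g l L k : is_line l -> (forall n, g (l n) = l (n + k)%R) ->
  cofinal l L -> fixes_end g (neg_end L).
Proof.
move=> ll gl co.
have key h k' (s : nat -> T) : (forall n, h (l n) = l (n + k')%R) ->
    neg_end L s -> neg_end L (h \o s).
  move=> hl [rs [m [n sL]]]; split; first by move=> p q /=; rewrite aut_dist.
  have [a [b co']] := co.
  have co2 (i : int) : (- b <= i)%R -> L (- i)%R = l (a + b + i)%R.
    move=> bi; have := co' `|(b + i)%R|%N.
    rewrite (_ : (Posz `|(b + i)%R|%N = b + i)%R); last by lia.
    by rewrite addrA => ->; congr L; lia.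
  (* Dropping the first [c] terms keeps the indices before and after the shift by [k'] in the range
     where [l] and [L] agree, and makes the shifted index a natural number. *)
  pose c := (`|b| + `|k'|)%N; exists (m + c)%N, `|(Posz n + k' + Posz c)%R|%N => i.
  rewrite /= -addnA sL co2; last by rewrite /c; lia.
  rewrite hl (_ : (- Posz (`|(Posz n + k' + Posz c)%R|%N + i)%N = - (Posz n + k' + Posz c + Posz i))%R).
    by rewrite co2; [congr l; lia|rewrite /c; lia].
  by rewrite /c; lia.
apply/seteqP; split=> s.
  by move=> [t tL <-]; exact: key gl tL.
have gVl n : (g^-1)%g (l n) = l (n - k)%R by rewrite -{1}[n](subrK k) -gl autK.
by move=> sL; exists ((g^-1)%g \o s); [exact: key gVl sL|apply/funext => i /=; rewrite autVK].
Qed.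

End Ends.

(** * Dynamics of a minimal action of general type *)

Section Dynamics.
Variables (T : tree) (G : groupClosed (aut T)).
Hypotheses (minG : minimal_action G) (gtG : general_type G).
Implicit Types (x y z u v w : T) (g h : aut T) (l : int -> T) (m n k : int).

Lemma axis_exists : exists g l k, g \in G /\ axis g l k.
Proof.
have [g [_ [gG _ /hyperbolicP[l [k ax]] _ _]]] := gtG.
by exists g, l, k.
Qed.

(** The intersection [C] of all half-trees that contain every translate of [l] is an invariant
    subtree, so it is [T] by minimality. If [half x y] missed all translates, [C] would lie in
    [half y x] and miss [x]. *)
Lemma orbit_meets l x y : adj x y ->
  exists h n, h \in G /\ half x y (h (l n)).
Proof.
move=> xy.
pose C : set T := [set z | forall u v, adj u v ->
  (forall h n, h \in G -> half u v (h (l n))) -> half u v z].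
have sC : subtree C.
  move=> a b Ca Cb; have [ap lp _] := geodesicP a b.
  exists (geodesic a b); split=> // z zp u v uv H.
  by apply: (subtree_geodesic (half_subtree (x := u) (y := v))) zp; [apply: Ca|apply: Cb].
have inv g : g \in G -> g @` C `<=` C.
  move=> gG _ [z Cz <-] u v uv H; rewrite -(autVK g u) -(autVK g v).
  apply/aut_halfE; apply: Cz => [|h n hG]; first by rewrite aut_adj.
  by apply/(aut_halfE g); rewrite !autVK -autME; apply: H; rewrite gpredM.
have CT : C = setT.
  apply: minG => // [|g gG].
    by exists (l 0%R) => u v uv H; apply: (H 1%g); rewrite gpred1.
  apply/seteqP; split; first exact: inv.
  move=> z Cz; exists (g^-1%g z); last by rewrite autVK.
  by apply: (inv g^-1%g); [rewrite gpredV|exists z].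
apply: contrapT => H; have : C x by rewrite CT.
move=> /(_ y x); rewrite adj_sym xy => /(_ isT) => C1.
suff : half y x x by move=> /(halfC _ xy); apply; exact: half_root.
apply: C1 => h n hG; apply/(halfC _ xy) => hh.
by apply: H; exists h, n.
Qed.

Lemma attracting_axis x y : adj x y ->
  exists g l k, [/\ g \in G, axis g l k & tail_in l (half x y)].
Proof.
move=> xy; have [g [l [k [gG ax]]]] := axis_exists.
have [h [n [hG hn]]] := orbit_meets l xy.
have ax' := axis_conj h ax; have ll := axis_line ax'.
have ghG : (h * g * h^-1)%g \in G by rewrite !gpredM ?gpredV.
have [t|[N1 t1]] := line_tail ll xy; first by exists (h * g * h^-1)%g, (h \o l), k.
have [t|[N2 t2]] := line_tail (line_rev ll) xy.
  exists (h * g * h^-1)^-1%g, (rev_line (h \o l)), k; split=> //.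
    by rewrite gpredV.
  exact: axis_inv.
have yx : adj y x by rewrite adj_sym.
(* If both ends of the translated axis are in [half y x], convexity puts its point [h (l n)] there
   as well. *)
suff : half y x (h (l n)) by move/(halfC _ xy).
have n1 : (n <= Num.max n N1)%R by rewrite le_max lexx.
have n2 : (- Num.max (- n) N2 <= n)%R by rewrite lerNl le_max lexx.
apply: (@line_convex _ (h \o l) _ (- Num.max (- n) N2)%R (Num.max n N1) n) => //.
- exact: half_subtree.
- by have := t2 (Num.max (- n) N2)%R; rewrite le_max lexx orbT; exact.
- by apply: t1; rewrite le_max lexx orbT.
- by rewrite n1 n2.
Qed.

(** Otherwise, conjugating by powers of a hyperbolic element [g1] whose
    attracting end is outside [half x y] shows that every hyperbolic element
    shares the repelling end of [g1]. *)
Lemma avoiding_axis x y : adj x y ->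
  exists g l k, [/\ g \in G, axis g l k, ~ tail_in l (half x y)
    & ~ tail_in (rev_line l) (half x y)].
Proof.
move=> xy; apply: contrapT => Hno.
have yx : adj y x by rewrite adj_sym.
have [g1 [L [k1 [g1G ax1 tL]]]] := attracting_axis yx.
have lL := axis_line ax1.
(* By [Hno], the conjugate of [g] by any power of [g1] has an end in [half x y]. Negative powers of
   [g1] contract [half x y] towards the negative end of [L], so an end of [g] itself is behind the
   edge at [n]. *)
have main g l k : g \in G -> axis g l k -> forall n,
    tail_in l (half (L n) (L (n + 1)%R)) \/
    tail_in (rev_line l) (half (L n) (L (n + 1)%R)).
  move=> gG ax n; have ax1' := axis_inv ax1.
  have nt : ~ tail_in (rev_line (rev_line L)) (half x y).
    by rewrite rev_lineK; apply/tail_half_not.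
  have [j Hj] := axis_contract (- n - 1)%R ax1' xy nt.
  have step l' : tail_in (((g1 ^+ j)%g : aut T) \o l') (half x y) ->
      tail_in l' (half (L n) (L (n + 1)%R)).
    move=> [N HN]; exists N => i /HN /Hj /(lhalf_rev _ _ lL).
    rewrite (_ : (- (- n - 1) - 1 = n)%R); last by lia.
    rewrite /comp -autME expVgn mulVg aut1E => h; apply/halfC => //.
    by rewrite adj_sym; exact: line_adj.
  have ax2 := axis_conj (g1 ^+ j)%g ax.
  apply: contrapT => /not_orP[N1 N2]; apply: Hno.
  exists (g1 ^+ j * g * (g1 ^+ j)^-1)%g, (((g1 ^+ j)%g : aut T) \o l), k; split=> //.
  - have gj : (g1 ^+ j)%g \in G by rewrite gpredXn.
    by rewrite !gpredM ?gpredV.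
  - by move=> /step.
  - by move=> /(@step (rev_line l)).
have mono l m n : (m <= n)%R -> tail_in l (half (L m) (L (m + 1)%R)) ->
    tail_in l (half (L n) (L (n + 1)%R)).
  move=> mn [N HN]; exists N => i /HN; have a1 := line_adj m lL; have a2 := line_adj n lL.
  rewrite adj_sym in a1; rewrite adj_sym in a2.
  by move=> /(halfC _ a1) h; apply/(halfC _ a2) => /(lhalf_le lL mn).
have fix_ g l k : g \in G -> axis g l k -> fixes_end g (neg_end L).
  move=> gG ax; have ll := axis_line ax; have [_ _ gl] := ax.
  (* Which end of [g] is behind the edge could depend on [n]. By [mono], if the positive end fails
     at [n0] it fails at all smaller indices; the negative end is then behind those edges, hence
     behind all. *)
  have [H|/existsNP[n0 H]] :=
      pselect (forall n, tail_in l (half (L n) (L (n + 1)%R))).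
    by apply: (cofinal_fixes ll gl); exact: tail_cofinal.
  have lr := line_rev ll.
  apply: (@cofinal_fixes _ _ (rev_line l) L (- k)%R lr).
    by move=> n; rewrite /rev_line gl opprD opprK.
  apply: tail_cofinal => // n; have [nn0|/ltW n0n] := leP n n0.
    by have [/(mono _ _ _ nn0)|] := main _ _ _ gG ax n.
  by apply: mono n0n _; have [|] := main _ _ _ gG ax n0.
have [g [h [gG hG /hyperbolicP[l [k ax]] /hyperbolicP[l' [k' ax']]]]] := gtG.
by apply; exists (neg_end L); split; [exact: neg_end_in|exact: fix_ gG ax|exact: fix_ hG ax'].
Qed.

(** A high power of an element with both ends outside the half-tree sends it into a neighbourhood of
    the attracting end contained in the complement. *)
Lemma half_displaced x y : adj x y ->
  exists2 r, r \in G & forall z, half x y z -> ~ half x y (r z).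
Proof.
move=> xy; have [g [l [k [gG ax t1 t2]]]] := avoiding_axis xy.
have ll := axis_line ax; have yx : adj y x by rewrite adj_sym.
have [n _ Hn] := tail_lhalf 0%R ll yx (proj2 (tail_half_not ll xy) t1).
have [j Hj] := axis_contract n ax xy t2.
exists (g ^+ j)%g; first by rewrite gpredXn.
by move=> z /Hj /Hn /(halfC _ xy).
Qed.

Lemma half_into_half x y u v : adj x y -> adj u v ->
  exists2 g, g \in G & forall z, half x y z -> half u v (g z).
Proof.
move=> xy uv; have [g [l [k [gG ax t]]]] := attracting_axis uv.
have [r rG Hr] := half_displaced xy; have ll := axis_line ax.
have [n _ Hn] := tail_lhalf 0%R ll uv t.
have [t1|t1] := pselect (tail_in (rev_line l) (half x y)); last first.
  have [j Hj] := axis_contract n ax xy t1.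
  by exists (g ^+ j)%g; [rewrite gpredXn|move=> z /Hj /Hn].
(* When the repelling end lies in [half x y], it avoids the displaced half-tree, which can be
   contracted instead. *)
have rxy : adj (r x) (r y) by rewrite aut_adj.
have t2 : ~ tail_in (rev_line l) (half (r x) (r y)).
  move=> t2; have [z [h1 h2]] := tail_disjoint t1 t2.
  rewrite -(autVK r z) aut_halfE in h2.
  by have := Hr _ h2; rewrite autVK.
have [j Hj] := axis_contract n ax rxy t2.
exists (g ^+ j * r)%g; first by rewrite gpredM ?gpredXn.
by move=> z hz; apply/Hn; rewrite autME; apply/Hj/aut_halfE.
Qed.

Definition branching v := exists a b c,
  [/\ adj a v, adj b v & adj c v] /\ [/\ a != b, a != c & b != c].

Lemma branching_exists : exists v, branching v.
Proof.
apply: contrapT => Hno; have [g0 [l0 [k0 [_ ax0]]]] := axis_exists.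
have xy := line_adj 0%R (axis_line ax0); set x := l0 _ in xy; set y := l0 _ in xy.
have [g [l [k [gG ax t1 t2]]]] := avoiding_axis xy.
have ll := axis_line ax.
(* Without branching no path can leave [l], so [x] is on [l]. As both ends of [l] are in [half y x],
   convexity would put [x] there too. *)
have surj p n : path (@adj T) (l n) p -> exists m, last (l n) p = l m.
  elim: p n => [n|w p IH n] /=; first by exists n.
  move=> /andP[nw wp]; suff [m e] : exists m, w = l m by rewrite e in wp *; exact: IH.
  apply: contrapT => Hw; apply: Hno; exists (l n), w, (l (n + 1)%R), (l (n - 1)%R).
  have a1 := line_adj n ll; have := line_adj (n - 1)%R ll; rewrite subrK => a2.
  split; split=> //; rewrite 1?adj_sym//.
  - by apply/eqP => e; apply: Hw; eexists; exact: e.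
  - by apply/eqP => e; apply: Hw; eexists; exact: e.
  - by apply/eqP => /(line_inj ll); lia.
have [xp lp _] := geodesicP (l 0%R) x; have [m] := surj _ _ xp; rewrite lp => em.
have [N1 H1] := proj2 (tail_half_not ll xy) t1.
have [N2 H2] := proj2 (tail_half_not (line_rev ll) xy) t2.
suff : half y x (l m) by move=> /(halfC _ xy); apply; rewrite -em; exact: half_root.
have n1 : (m <= Num.max m N1)%R by rewrite le_max lexx.
have n2 : (- Num.max (- m) N2 <= m)%R by rewrite lerNl le_max lexx.
apply: (@line_convex _ l _ (- Num.max (- m) N2)%R (Num.max m N1) m) => //.
- exact: half_subtree.
- by have := H2 (Num.max (- m) N2)%R; rewrite le_max lexx orbT; exact.
- by apply: H1; rewrite le_max lexx orbT.
- by rewrite n1 n2.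
Qed.

End Dynamics.

Local Open Scope ring_scope.


(** * Automorphisms supported on two branches *)

Section Swap.
Variable T : tree.
Implicit Types (x y z c : T) (g : aut T).

Lemma half_between x y z w : adj x y -> half x y z -> half y x w ->
  dist z w = (dist z x + (dist y w).+1)%N.
Proof.
move=> xy hz /(halfC _ xy) hw; have [zp lp _] := geodesicP z w.
rewrite -{1}lp in hw; have [u [t [ut hu ht up tp]]] := path_cross zp hz hw.
have [ux ty] := half_cross xy ut hu ht; rewrite ty in tp.
have := dist_adj_neq z xy; rewrite (dist_geodesic tp).
by move: hz; rewrite /half /=; lia.
Qed.

(** For [g] fixing [x], this exchanges the branches at [x] towards [c] and [g c]. When [g c = c] the
    first test prevails, and the result is [g] cut down to a single branch. *)
Definition swap_fun g x c z : T :=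
  if `[< half c x z >] then g z
  else if `[< half (g c) x z >] then g^-1%g z else z.

Section SwapTheory.
Variables (g : aut T) (x c : T).
Hypotheses (gx : g x = x) (cx : adj c x).

Lemma swap_in z : half c x z -> swap_fun g x c z = g z.
Proof. by move=> h; rewrite /swap_fun asboolT. Qed.

Lemma swap_in' z : half (g c) x z -> swap_fun g x c z = if g c == c then g z else g^-1%g z.
Proof.
move=> h; rewrite /swap_fun; case: eqP => [e|/eqP ne]; first by rewrite -{1}e asboolT.
rewrite asboolF ?asboolT// => h'; rewrite eq_sym in ne.
by apply: (half_disjoint cx _ ne h' h); rewrite -{1}gx aut_adj.
Qed.

Lemma swap_out z : ~ half c x z -> ~ half (g c) x z -> swap_fun g x c z = z.
Proof. by move=> h h'; rewrite /swap_fun !asboolF. Qed.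

Lemma swap_center : swap_fun g x c x = x.
Proof.
have Nx a : adj a x -> ~ half a x x.
  by move=> ax; apply/(halfC _ ax)/half_root; rewrite adj_sym.
by apply: swap_out; apply: Nx => //; rewrite -{1}gx aut_adj.
Qed.

Lemma swap_adj a b : adj a b -> adj (swap_fun g x c a) (swap_fun g x c b).
Proof.
(* The edge is oriented so that, if it leaves one of the two branches, [a] is the endpoint
   inside. *)
wlog: a b / half c x a \/ ~ half c x b /\ (half (g c) x a \/ ~ half (g c) x b) => [W|].
  move=> ab; have ba := ab; rewrite adj_sym in ba.
  have [|N] := pselect (half c x a \/ ~ half c x b /\ (half (g c) x a \/ ~ half (g c) x b)).
    by move=> h; exact: W.
  rewrite adj_sym; apply: W => //; move: N.
  by case: (pselect (half c x a)); case: (pselect (half c x b));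
    case: (pselect (half (g c) x a)); case: (pselect (half (g c) x b)); tauto.
have gcx : adj (g c) x by rewrite -{1}gx aut_adj.
move=> H ab.
have [ha|Na] := pselect (half c x a).
  have [hb|Nb] := pselect (half c x b); first by rewrite !swap_in// aut_adj.
  by have [-> ->] := half_cross cx ab ha Nb; rewrite swap_center swap_in//; exact: half_root.
case: H => [//|[Nb H]].
have [ha|Na'] := pselect (half (g c) x a).
  have gc : g c == c = false by apply/eqP => e; rewrite e in ha.
  have [hb|Nb'] := pselect (half (g c) x b); first by rewrite !swap_in'// gc aut_adj.
  have [-> ->] := half_cross gcx ab ha Nb'; rewrite swap_center swap_in' ?gc ?autK//.
  exact: half_root.
by case: H => // Nb'; rewrite !swap_out.
Qed.
End SwapTheory.

Lemma swapK g x c : g x = x -> adj c x ->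
  cancel (swap_fun g x c) (swap_fun g^-1%g x (g c)).
Proof.
move=> gx cx z.
have gVx : g^-1%g x = x by rewrite -{1}gx autK.
have gcx : adj (g c) x by rewrite -{1}gx aut_adj.
have hg w : half (g c) x (g w) <-> half c x w by rewrite -{1}gx aut_halfE.
have [h|N] := pselect (half c x z).
  by rewrite (swap_in _ h) swap_in ?autK//; exact/hg.
have [h|N'] := pselect (half (g c) x z); last first.
  by rewrite (@swap_out _ _ _ _ N N') swap_out// autK.
have gc : g c == c = false by apply/eqP => e; rewrite e in h.
have h' : half c x (g^-1%g z) by apply/hg; rewrite autVK.
have h'' : half (g^-1%g (g c)) x (g^-1%g z) by rewrite autK.
by rewrite (swap_in' gx cx h) gc (swap_in' gVx gcx h'') autK eq_sym gc invgK autVK.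
Qed.

Lemma swap_bij g x c : g x = x -> adj c x -> bijective (swap_fun g x c).
Proof.
move=> gx cx; exists (swap_fun g^-1%g x (g c)); first exact: swapK.
have gVx : g^-1%g x = x by rewrite -{1}gx autK.
have gcx : adj (g c) x by rewrite -{1}gx aut_adj.
by have := swapK gVx gcx; rewrite autK invgK.
Qed.

Lemma swap_adjE g x c : g x = x -> adj c x ->
  forall a b, adj (swap_fun g x c a) (swap_fun g x c b) = adj a b.
Proof.
move=> gx cx a b; apply/idP/idP; last exact: swap_adj.
have gVx : g^-1%g x = x by rewrite -{1}gx autK.
have gcx : adj (g c) x by rewrite -{1}gx aut_adj.
by move=> /(swap_adj gVx gcx); rewrite !swapK.
Qed.

Definition swap g x c (gx : g x = x) (cx : adj c x) : aut T :=
  Aut (swap_bij gx cx) (swap_adjE gx cx).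

End Swap.

(** * The tree rooted at a vertex *)

Section Rooted.
Variables (T : tree) (v : T).
Implicit Types (x y z c : T) (g : aut T).

Definition desc x : set T := [set z | dist v z = (dist v x + dist x z)%N].

Definition child x c := adj c x /\ dist v c = (dist v x).+1.

Lemma desc_root z : desc v z.
Proof. by rewrite /desc /= distxx. Qed.

Lemma desc_self x : desc x x.
Proof. by rewrite /desc /= distxx addn0. Qed.

Lemma child_adj x c : child x c -> adj c x.
Proof. by case. Qed.

Lemma child_half x c : child x c -> half x c v.
Proof. by move=> [_ e]; rewrite /half /= e. Qed.

Lemma descE x c z : child x c -> desc c z <-> half c x z.
Proof.
move=> ch; have [cx e] := ch; split=> [dz|hz].
  have := dist_triangle x v z; have := dist_adj_neq z cx; move: dz.
  by rewrite /desc /half /= !(dist_sym z) e; lia.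
rewrite /desc /= (dist_sym v z) (half_between cx hz (child_half ch)).
by rewrite (dist_sym z) (dist_sym x v) e addnC.
Qed.

Lemma desc_child x z : desc x z -> z != x -> exists2 c, child x c & desc c z.
Proof.
move=> dz; rewrite eq_sym => /step_toward[c [xc e]].
have := dist_triangle c v z; have := dist_adj_neq v xc.
have ec : desc x z -> desc c z /\ dist v c = (dist v x).+1.
  rewrite /desc /= e; have := dist_triangle c v z; have := dist_adj_neq v xc; lia.
by have [] := ec dz; exists c => //; split=> //; rewrite adj_sym.
Qed.

Lemma child_desc x c : child x c -> desc c `<=` desc x.
Proof.
move=> ch z dz; have hz := proj1 (descE z ch) dz; have [cx e] := ch.
have := dist_adj_neq z cx; move: dz hz.
by rewrite /desc /half /= e !(dist_sym z); lia.
Qed.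

Lemma child_center x c : child x c -> ~ desc c x.
Proof.
move=> ch; have cx := child_adj ch; move/(descE _ ch).
by apply/(halfC _ cx)/half_root; rewrite adj_sym.
Qed.

Lemma child_disjoint x c c' z : child x c -> child x c' -> c != c' ->
  desc c z -> desc c' z -> False.
Proof.
move=> ch ch' ne /(descE _ ch) h /(descE _ ch') h'.
exact: half_disjoint (child_adj ch) (child_adj ch') ne h h'.
Qed.

(** The exceptions are the parent of [x], or nothing at the root. A list lets them join other finite
    sets of exceptional branches. *)
Lemma nonchild x : exists s : seq T, forall c, adj c x -> c \notin s -> child x c.
Proof.
have [->|xv] := eqVneq x v.
  exists [::] => c cv _; split=> //; rewrite distxx dist_adj//.
  by rewrite adj_sym.
have [p [xp e]] := step_toward xv; exists [:: p] => c cx; rewrite inE => cp.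
split=> //; have := dist_adj_neq v cx => -[e'|//]; case/eqP: cp.
apply: (step_toward_uniq (x := x) (y := v)) => //; first by rewrite adj_sym.
by rewrite !(dist_sym _ v).
Qed.

Section FixRoot.
Variable g : aut T.
Hypothesis gv : g v = v.

Lemma root_dist z : dist v (g z) = dist v z.
Proof. by rewrite -{1}gv aut_dist. Qed.

Lemma aut_desc x z : desc (g x) (g z) <-> desc x z.
Proof. by rewrite /desc /= !root_dist aut_dist. Qed.

Lemma aut_child x c : child (g x) (g c) <-> child x c.
Proof. by rewrite /child !root_dist aut_adj. Qed.
End FixRoot.

(** The branch at [c] reaches [A] only through [x]. Hence a piecewise element agrees with one and
    the same element of [G] on all the branches at [x] that leave its witness. *)
Lemma child_projection A x c z : subtree A -> A v -> A x -> child x c -> ~ A c ->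
  desc c z -> is_projection A z x.
Proof.
move=> sA Av Ax ch Nc /(descE _ ch) hz; have cx := child_adj ch; split=> // w Aw.
have xc : adj x c by rewrite adj_sym.
have [hw|/(halfC _ cx) hw] := pselect (half c x w).
  by have [_ /Nc] := subtree_cross xc sA Av Aw (child_half ch) hw.
by rewrite (half_between cx hz hw); have := dist_adj_neq z cx; lia.
Qed.

(** Added to a witness of piecewiseness so that it contains [x], without going deeper than [x]. *)
Definition segment x : set T := [set` v :: geodesic v x].

Lemma segment_subtree x : subtree (segment x).
Proof.
apply: (@rooted_subtree _ _ v) => z; rewrite /segment /= => zin.
have [vp lp _] := geodesicP v x.
have [p [q [E lz]]] : exists p q, geodesic v x = p ++ q /\ last v p = z.
  by case/splitPl: zin => p q lz; exists p, q.
have pin t : t \in v :: p -> t \in v :: geodesic v x.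
  by rewrite E -cat_cons mem_cat => ->.
move: vp; rewrite E cat_path => /andP[vp _].
exists (rev (belast v p)); split.
- by rewrite -lz rev_path (eq_path (e' := @adj T))// => a b; exact: adj_sym.
- by rewrite -lz; case: (p) => [//|a r]; rewrite [belast _ _]/= rev_cons last_rcons.
- by move=> t; rewrite mem_rev => /mem_belast /pin; rewrite E.
Qed.

Lemma segment_end x : segment x x.
Proof. by rewrite /segment /=; have [_ lp _] := geodesicP v x; rewrite -{1}lp mem_last. Qed.

Lemma segment_root x : segment x v.
Proof. by rewrite /segment /= inE eqxx. Qed.

Lemma segment_dist x z : segment x z -> (dist v z <= dist v x)%N.
Proof. by move=> /dist_geodesic ->; rewrite leq_addr. Qed.

Lemma segment_parent x c : child x c -> segment c x.
Proof.
by move=> [cx e]; apply: geodesic_mem; rewrite e (dist_adj (x := x)) ?addn1// adj_sym.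
Qed.

Lemma subtreeU A B : subtree A -> subtree B -> A v -> B v -> subtree (A `|` B).
Proof.
move=> sA sB Av Bv; apply: (@rooted_subtree _ _ v) => z [/sA|/sB].
  by move=> /(_ v Av)[p [zp lp pA]]; exists p; split=> // t /pA; left.
by move=> /(_ v Bv)[p [zp lp pA]]; exists p; split=> // t /pA; right.
Qed.

End Rooted.

(** * Invariant means *)

Section Means.
Variable R : realType.

Definition bdd (X : Type) (f : X -> R) := exists M, forall x, `|f x| <= M.

Lemma bddP (X : Type) (f : X -> R) : bdd f <-> bounded_fun f.
Proof.
split=> [[M fM]|].
  exists M; split; first exact: num_real.
  by move=> N MN x _; apply: le_trans (fM x) (ltW MN).
move=> [M [_ fM]]; exists (M + 1) => x.
by apply: (fM (M + 1)) => //; rewrite ltrDl.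
Qed.

Lemma bdd_lin (X : Type) c (f h : X -> R) :
  bdd f -> bdd h -> bdd (fun x => c * f x + h x).
Proof.
move=> [M fM] [N hN]; exists (`|c| * M + N) => x.
rewrite (le_trans (ler_normD _ _))// lerD// normrM.
by rewrite ler_wpM2l.
Qed.

Lemma bdd_cst (X : Type) c : bdd (fun _ : X => c).
Proof. by exists `|c|. Qed.

Lemma bdd_comp (X Z : Type) (g : X -> Z) (f : Z -> R) : bdd f -> bdd (fun x => f (g x)).
Proof. by move=> [M fM]; exists M. Qed.

(** Positivity is tested on [Y] only, which concentrates the mean on [Y]. Functions stay defined on
    all of [X], so that subgroups of one group can be compared without subtypes. *)
Definition mean_on (X : Type) (Y : set X) (m : (X -> R) -> R) : Prop :=
  [/\ forall c f h, bdd f -> bdd h ->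
        m (fun x => c * f x + h x) = c * m f + m h,
      forall f, bdd f -> (forall x, Y x -> 0 <= f x) -> 0 <= m f
    & m (fun=> 1) = 1].

Section MeanTheory.
Variables (X : Type) (Y : set X) (m : (X -> R) -> R).
Hypothesis mY : mean_on Y m.

Lemma mean_lin c f h : bdd f -> bdd h ->
  m (fun x => c * f x + h x) = c * m f + m h.
Proof. by case: mY => lin _ _; exact: lin. Qed.

Lemma mean_ge0 f : bdd f -> (forall x, Y x -> 0 <= f x) -> 0 <= m f.
Proof. by case: mY => _ pos _; exact: pos. Qed.

Lemma mean_le f h : bdd f -> bdd h -> (forall x, Y x -> f x <= h x) -> m f <= m h.
Proof.
move=> bf bh fh; have := mean_ge0 (bdd_lin (-1) bf bh).
rewrite mean_lin// mulN1r addrC subr_ge0; apply => x /fh.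
by rewrite mulN1r addrC subr_ge0.
Qed.

Lemma mean_eq f h : bdd f -> bdd h -> (forall x, Y x -> f x = h x) -> m f = m h.
Proof.
by move=> bf bh fh; apply/eqP; rewrite eq_le !mean_le// => x /fh ->.
Qed.

Lemma mean_cst c : m (fun=> c) = c.
Proof.
have b1 : bdd (fun _ : X => 1 : R) by exact: bdd_cst.
have m1 : m (fun=> 1) = 1 by case: mY.
have e0 : m (fun=> 0) = 0.
  have := mean_lin (-1) b1 b1; rewrite m1 mulN1r addNr => e; rewrite -[RHS]e.
  by congr m; apply/funext => x /=; rewrite mulN1r addNr.
have := mean_lin c b1 (bdd_cst X 0); rewrite m1 e0 mulr1 addr0 => e.
rewrite -[RHS]e; by congr m; apply/funext => x /=; rewrite mulr1 addr0.
Qed.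

Lemma mean_abs f M : bdd f -> (forall x, Y x -> `|f x| <= M) -> `|m f| <= M.
Proof.
move=> bf fM; rewrite ler_norml -{1}(mean_cst (- M)) -{2}(mean_cst M).
by apply/andP; split; apply: mean_le => //; try exact: bdd_cst;
  move=> x /fM; rewrite ler_norml => /andP[].
Qed.
End MeanTheory.

Section Groups.
Variable gT : groupType.
Implicit Types (K H N Q : set gT).

Definition is_subgroup K : Prop :=
  [/\ K 1%g, forall x y, K x -> K y -> K (x * y)%g & forall x, K x -> K x^-1%g].

Definition amen K : Prop := exists m, mean_on K m /\
  forall g, K g -> forall f, bdd f -> m (fun x => f (g * x)%g) = m f.

Lemma mean_pull (X Z : Type) (Y : set X) (W : set Z) (g : X -> Z) m :
  (forall x, Y x -> W (g x)) -> mean_on Y m -> mean_on W (fun f => m (fun x => f (g x))).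
Proof.
move=> gYW mY; split=> [c f h bf bh|f bf f0|].
- by rewrite (mean_lin mY)//; exact: bdd_comp.
- by apply: (mean_ge0 mY) => [|x /gYW]; [exact: bdd_comp|exact: f0].
- by case: mY.
Qed.

Lemma amen_sub K H : is_subgroup H -> H `<=` K -> amen K -> amen H.
Proof.
move=> [H1 HM HV] HK [m [mK inv]].
(* [r] picks a representative of each coset [H x], so that [p] is a map into [H] commuting with left
   translations by [H]; the mean is pushed forward along it. *)
pose r x := xget 1%g [set y | H (y * x^-1)%g].
have Hr x : H (r x * x^-1)%g.
  by rewrite /r; case: xgetP => [y _ //|/(_ x)]; rewrite /= mulgV.
have rM h x : H h -> r (h * x)%g = r x.
  move=> Hh; rewrite /r; congr xget; apply/seteqP; split=> y /= Hy.
    have := HM _ _ Hy Hh; by rewrite invgM -!mulgA mulVg mulg1.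
  by rewrite invgM mulgA; apply: HM => //; exact: HV.
pose p x := (x * (r x)^-1)%g.
have Hp x : H (p x) by have := HV _ (Hr x); rewrite invgM invgK.
exists (fun f => m (fun x => f (p x))); split; first exact: (mean_pull (Y := K)).
move=> g Hg f bf; rewrite -(inv g (HK _ Hg) _ (bdd_comp p bf)).
by congr m; apply/funext => x; rewrite /p rM// mulgA.
Qed.

(** The common pattern of the extension results: [X] stands for the cosets of [N], with
    representatives [t], and [g] carries the coset of [t x] to that of [t (s x)]. The mean averages
    over [n] in [t x * n], then over [x]. *)
Lemma amen_cocycle (X : Type) (Y : set X) mu K N (t : X -> gT) :
  is_subgroup K -> N `<=` K -> mean_on Y mu -> amen N ->
  (forall x, Y x -> K (t x)) ->
  (forall g, K g -> exists s : X -> X,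
     (forall f, bdd f -> mu (fun x => f (s x)) = mu f) /\
     forall x, Y x -> N ((t (s x))^-1 * (g * t x))%g) ->
  amen K.
Proof.
move=> [K1 KM KV] NK mY [mN [mNN inv]] Kt Ks.
pose M f x := mN (fun n => f (t x * n)%g).
have bM f : bdd f -> bdd (M f).
  move=> [B fB]; exists B => x; apply: (mean_abs mNN) => [|n _]; last exact: fB.
  by apply: bdd_comp; exists B.
exists (fun f => mu (M f)); split.
  split=> [c f h bf bh|f bf f0|].
  - rewrite -(mean_lin mY) //; try exact: bM.
    by congr mu; apply/funext => x; rewrite /M (mean_lin mNN)//; exact: bdd_comp.
  - apply: (mean_ge0 mY) => [|x Yx]; first exact: bM.
    apply: (mean_ge0 mNN) => [|n Nn]; first exact: bdd_comp.
    by apply: f0; apply: KM; [exact: Kt|exact: NK].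
  - rewrite -[RHS](mean_cst mY); congr mu; apply/funext => x.
    by rewrite /M (mean_cst mNN).
move=> g Kg f bf; have [s [sinv sN]] := Ks g Kg.
rewrite -(sinv (M f)); last exact: bM.
apply: (mean_eq mY) => [||x Yx]; [exact/bM/bdd_comp|exact/bdd_comp/bM|].
rewrite /M -[RHS](inv _ (sN x Yx)); last exact: bdd_comp.
by congr mN; apply/funext => n; rewrite !mulgA mulgV mul1g.
Qed.

Lemma amen_trivial : amen [set 1%g].
Proof.
exists (fun f => f 1%g); split; first by split=> // f _; exact.
by move=> _ -> f _; rewrite mulg1.
Qed.

(** [E] means having the same germ. Elements of [K] need not lie in [Q]; the elements of [Q] sharing
    a germ with some element of [K] form a subgroup [Q'], whose mean serves for [K] modulo [N]. *)
Lemma amen_germ K Q N (E : gT -> gT -> Prop) :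
  is_subgroup K -> is_subgroup Q -> amen Q -> amen N -> N `<=` K ->
  (forall k, K k -> E k 1%g -> N k) ->
  (forall a b, E a b -> E b a) -> (forall a b c, E a b -> E b c -> E a c) ->
  (forall k a b, E a b -> E (k * a)%g (k * b)%g) ->
  (forall q a b, Q q -> E a b -> E (a * q)%g (b * q)%g) ->
  (forall k, K k -> exists2 q, Q q & E k q) -> amen K.
Proof.
move=> sK sQ aQ aN NK EN Es Et El Er KQ.
have [K1 KM KV] := sK; have [Q1 QM QV] := sQ.
pose Q' := [set q | Q q /\ exists2 k, K k & E k q].
have sQ' : is_subgroup Q'.
  split.
  - split=> //; exists 1%g => //; have [q Qq Eq] := KQ _ K1.
    exact: Et Eq (Es _ _ Eq).
  - move=> x y [Qx [k Kk kx]] [Qy [k' Kk' ky]]; split; first exact: QM.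
    exists (k * k')%g; first exact: KM.
    exact: Et (El k _ _ ky) (Er y _ _ Qy kx).
  - move=> x [Qx [k Kk kx]]; split; first exact: QV.
    exists k^-1%g; first exact: KV.
    have := Er _ _ _ (QV _ Qx) (El k^-1%g _ _ kx).
    by rewrite mulVg mul1g mulgK => /Es.
have [m [mQ' inv]] := amen_sub sQ' (fun x => @proj1 _ _) aQ.
pose t q := xget 1%g [set k | K k /\ E k q].
have tP q : Q' q -> K (t q) /\ E (t q) q.
  move=> [Qq [k Kk kq]]; rewrite /t; by case: xgetP => [y _ //|/(_ k) []].
apply: (amen_cocycle (t := t) sK NK mQ' aN) => [q /tP[]//|g Kg].
have [q0 Qq0 gq0] := KQ _ Kg; have Q'q0 : Q' q0 by split=> //; exists g.
exists (fun q => q0 * q)%g; split=> [f bf|q Q'q]; first exact: inv.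
have [Kt Et1] := tP q Q'q; have [Q'1 Q'M _] := sQ'.
have [Kt' Et2] := tP _ (Q'M _ _ Q'q0 Q'q).
apply: EN; first by apply: (KM); [exact: KV|exact: KM].
rewrite -(mulVg (t (q0 * q)%g)); apply: (El).
apply: (Et _ _ _ (El g _ _ Et1)); apply: (Et _ _ _ (Er q _ _ (proj1 Q'q) gq0)).
exact: Es.
Qed.

Lemma amen_prod K Q N : is_subgroup K -> Q `<=` K -> N `<=` K ->
  is_subgroup Q -> amen Q -> amen N ->
  (forall k n, K k -> N n -> N (k^-1 * (n * k))%g) ->
  (forall k, K k -> exists2 q, Q q & N (q^-1 * k)%g) -> amen K.
Proof.
move=> sK QK NK [Q1 QM QV] [m [mQ inv]] aN NJ KQ; have [K1 KM KV] := sK.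
apply: (amen_cocycle (t := id) sK NK mQ aN) => [q /QK//|g Kg].
have [q0 Qq0 Nq] := KQ _ Kg; exists (fun q => q0 * q)%g; split=> [f bf|q Qq]; first exact: inv.
by have := NJ _ _ (QK _ Qq) Nq; rewrite invgM !mulgA.
Qed.

Lemma amen_orbit (Z : eqType) (a : gT -> Z -> Z) (z0 : Z) (s : seq Z) K :
  is_subgroup K -> (forall z, a 1%g z = z) ->
  (forall g h z, a (g * h)%g z = a g (a h z)) ->
  (forall k, K k -> a k z0 \in s) ->
  amen [set k | K k /\ a k z0 = z0] -> amen K.
Proof.
move=> sK a1 aM Ks aN; have [K1 KM KV] := sK.
pose P z := `[< exists2 k, K k & a k z0 = z >].
pose o := [seq z <- undup s | P z].
have inO z : (z \in o) = P z.
  rewrite mem_filter; case: (boolP (P z)) => //= /asboolP[k Kk <-].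
  by rewrite mem_undup Ks.
have uo : uniq o by rewrite filter_uniq ?undup_uniq.
have o0 : (0 < size o)%N.
  suff : z0 \in o by case: (o).
  by rewrite inO; apply/asboolP; exists 1%g.
have so : (size o)%:R != 0 :> R by rewrite pnatr_eq0 -lt0n.
pose mu (f : Z -> R) := (size o)%:R^-1 * \sum_(z <- o) f z.
have mY : mean_on [set z | z \in o] mu.
  split=> [c f h _ _|f _ f0|]; rewrite /mu.
  - by rewrite big_split -mulr_sumr /= mulrDr mulrCA.
  - apply: mulr_ge0; first by rewrite invr_ge0.
    by rewrite big_seq; apply: sumr_ge0 => z /f0.
  - by rewrite big_const_seq count_predT iter_addr addr0 mulVf.
pose t z := xget 1%g [set k | K k /\ a k z0 = z].
have tP z : z \in o -> K (t z) /\ a (t z) z0 = z.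
  rewrite inO => /asboolP[k Kk kz]; rewrite /t; by case: xgetP => [y _ //|/(_ k) []].
apply: (amen_cocycle (t := t) sK _ mY aN) => [k []//|z /tP[]//|g Kg].
have oM h z : K h -> z \in o -> a h z \in o.
  move=> Kh; rewrite !inO => /asboolP[k Kk <-]; apply/asboolP.
  by exists (h * k)%g; [exact: KM|rewrite aM].
have ai : injective (a g) by apply: (can_inj (g := a g^-1%g)) => z; rewrite -aM mulVg a1.
exists (a g); split=> [f _|z zo].
  congr (_ * _); rewrite -(big_map (a g) xpredT f); apply: perm_big.
  apply: uniq_perm => //; first by rewrite map_inj_uniq.
  move=> z; apply/mapP/idP => [[w wo ->]|zo]; first exact: oM.
  exists (a g^-1%g z); first by apply: oM => //; exact: KV.
  by rewrite -aM mulgV a1.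
have [Kt et] := tP _ zo; have [Kt' et'] := tP _ (oM _ _ Kg zo).
split; first by apply: (KM); [exact: KV|exact: KM].
by rewrite !aM et -[X in a _ X = _]et' -aM mulVg a1.
Qed.

(** The mean is the limit of the means attached to finite families, along an ultrafilter for which
    any given [g] belongs to almost every family. *)
Lemma amen_local K :
  (forall s : seq gT, (forall x, x \in s -> K x) ->
     exists H, [/\ H `<=` K, amen H & forall x, x \in s -> H x]) -> amen K.
Proof.
move=> loc; pose inK (s : seq gT) := forall x, x \in s -> K x.
have /choice[M MP] : forall s : seq gT, exists m, inK s -> mean_on K m /\
    forall g, g \in s -> forall f, bdd f -> m (fun x => f (g * x)%g) = m f.
  move=> s; have [sK|NsK] := pselect (inK s); last by exists (fun=> 0).
  have [H [HK [m [mH inv]] sH]] := loc s sK; exists m => _; split.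
    by have := @mean_pull _ _ H K id m HK mH.
  by move=> g gs; apply: inv; exact: sH.
pose F : set_system (seq gT) := [set A | exists s0 : seq gT, inK s0 /\
  forall s, inK s -> {subset s0 <= s} -> A s].
have PF : ProperFilter F.
  split.
    by move=> [s0 [K0 /(_ s0 K0)]]; exact.
  split.
  - by exists [::]; split.
  - move=> A B [s1 [K1 A1]] [s2 [K2 B2]]; exists (s1 ++ s2); split.
      by move=> x; rewrite mem_cat => /orP[/K1|/K2].
    move=> s Ks ss; split; [apply: A1|apply: B2] => // x xs; apply: ss;
      by rewrite mem_cat xs ?orbT.
  - move=> A B AB [s0 [K0 A0]]; exists s0; split=> // s Ks /(A0 _ Ks); exact: AB.
have [U [UU FU]] := ultraFilterLemma PF.
have UP : ProperFilter U by case: UU.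
have UK : U inK by apply: FU; exists [::]; split.
have cvgM f : bdd f -> cvg (M ^~ f @ U).
  move=> bf; have [B fB] := bf.
  have MB : U [set s | `|M s f| <= B].
    apply: filterS UK => s Ks; have [mK _] := MP s Ks.
    by apply: (mean_abs mK) => // x _; exact: fB.
  (* The limit is the supremum of the numbers that are almost always lower bounds: an ultrafilter
     decides on which side of each threshold the values lie. *)
  pose S := [set c | U [set s | c <= M s f]].
  have SB : ubound S B.
    move=> c Sc; have [s [/= cs]] := @filter_ex _ U UP _ (filterI Sc MB).
    by rewrite ler_norml => /andP[_]; exact: le_trans.
  have S0 : S (- B).
    by apply: filterS MB => s /=; rewrite ler_norml => /andP[].
  have hS : has_sup S by split; [exists (- B)|exists B].
  apply/cvg_ex; exists (sup S); apply/cvgrPdist_le => e e0.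
  have lo : U [set s | sup S - e <= M s f].
    have [c Sc cS] := sup_adherent e0 hS.
    by apply: filterS Sc => s /=; apply: le_trans; exact: ltW.
  have hi : U [set s | M s f <= sup S + e].
    have [//|] := in_ultra_setVsetC [set s | M s f <= sup S + e] UU.
    move=> UC; have : S (sup S + e).
      by apply: filterS UC => s /= /negP; rewrite -ltNge => /ltW.
    move=> /(ub_le_sup (proj2 hS)); lra.
  near=> s; have lo' : sup S - e <= M s f by near: s.
  have hi' : M s f <= sup S + e by near: s.
  by rewrite ler_distlC; apply/andP; split.
have eqL f h : U [set s | M s f = h s] -> lim (M ^~ f @ U) = lim (h @ U).
  move=> E; congr (lim _); apply/seteqP; split=> A /=;
    by rewrite /fmap /= => HA; apply: filterS2 HA E => s /= + e; rewrite e.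
exists (fun f => lim (M ^~ f @ U)); split.
  split=> [c f h bf bh|f bf f0|].
  - rewrite (eqL _ (fun s => c * M s f + M s h)).
      apply/cvg_lim => //; apply: cvgD; last exact: cvgM.
      by apply: cvgMr; exact: cvgM.
    by apply: filterS UK => s Ks; have [mK _] := MP s Ks; rewrite /= (mean_lin mK).
  - apply: limr_ge; first exact: cvgM.
    by apply: filterS UK => s Ks; have [mK _] := MP s Ks; apply: (mean_ge0 mK).
  - rewrite (eqL _ (fun=> 1)); first by apply/cvg_lim => //; exact: cvg_cst.
    by apply: filterS UK => s Ks; have [mK _] := MP s Ks; rewrite /= (mean_cst mK).
move=> g Kg f bf; apply: eqL.
have Ug : U [set s : seq gT | g \in s].
  apply: FU; exists [:: g]; split=> [x|s Ks ss]; first by rewrite inE => /eqP ->.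
  by apply: ss; rewrite inE.
apply: filterS2 UK Ug => s Ks gs.
by have [_ inv] := MP s Ks; apply: inv.
Unshelve. all: by end_near. Qed.

End Groups.

Lemma amen_amenable (gT : groupType) (H : groupClosed gT) :
  amenable R (subgroup H) -> amen [set` H].
Proof.
move=> [m [lin pos one inv]].
have mm : mean_on [set: subgroup H] m.
  split=> [c f h /bddP bf /bddP bh|f /bddP bf f0|]; [exact: lin| |exact: one].
  by apply: pos => // x; exact: f0.
exists (fun f => m (fun x => f (val x))); split.
  by apply: mean_pull mm => x _; exact: valP.
move=> g Hg f bf; pose g' : subgroup H := Sub g Hg.
rewrite -(inv g'^-1%g (fun x => f (val x))); last by apply/bddP; exact: bdd_comp.
by congr m; apply/funext => x; rewrite invgK.
Qed.

Lemma amen_subgroup (gT : groupType) (H : groupClosed gT) (K : set gT) :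
  (forall x, K x -> x \in H) -> amen K ->
  amen [set x : subgroup H | K (val x)].
Proof.
(* The default value of [p] outside [H] is harmless, the mean being concentrated on [K]. *)
move=> KH [m [mK inv]]; pose p x : subgroup H := insubd 1%g x.
have pK x : K x -> val (p x) = x by move=> /KH Hx; rewrite /p val_insubd Hx.
exists (fun f => m (fun x => f (p x))); split.
  by apply: mean_pull mK => x Kx /=; rewrite pK.
move=> g Kg f bf; rewrite -(inv (val g) Kg (fun x => f (p x))); last exact: bdd_comp.
apply: (mean_eq mK) => [||x Kx]; [exact: bdd_comp|exact: (bdd_comp (fun x => p (val g * x)%g))|].
congr f; apply: val_inj; have Hx := KH _ Kx.
by rewrite /p val_insubd gpredM ?(valP g)// gmulfM /= pK.
Qed.

End Means.

(** * Vertex stabilizers in [Pw G] *)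

Section VertexStabilizer.
Variables (R : realType) (T : tree) (G : groupClosed (aut T)) (v : T).
Hypothesis amenG : forall x : T, amen R [set g : aut T | g \in G /\ g x = x].
Implicit Types (x y z c : T) (g : aut T).

(** Elements fixing [v] preserve the balls around [v], so that bounding the radius of the witness
    leaves a group. *)
Definition PwBall (n : nat) : set (aut T) := [set g : aut T | g v = v /\
  exists A : set T, [/\ finite_set A, A v, subtree A,
    (forall a, A a -> (dist v a <= n)%N) & piecewise G g A]].

Lemma PwBall_subgroup n : is_subgroup (PwBall n).
Proof.
split.
- split=> //; exists [set v]; split=> //.
  + by move=> _ _ -> ->; exists [::].
  + by move=> _ ->; rewrite distxx.
  + by move=> w _ _; exists 1%g => //; exact: gpred1.
- move=> g h [gv [A [fA Av sA An pA]]] [hv [B [fB Bv sB Bn pB]]].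
  split; first by rewrite autME hv gv.
  pose A' := (h^-1)%g @` A; have sA' : subtree A' by exact: aut_subtree.
  have hVv : (h^-1)%g v = v by rewrite -{1}hv autK.
  have A'v : A' v by exists v.
  pose C := A' `|` B; have sC : subtree C by exact: subtreeU A'v Bv.
  have AhC : A `<=` h @` C.
    by move=> x Ax; exists (h^-1%g x); [left; exists x|rewrite autVK].
  have A0 : A !=set0 by exists v.
  have B0 : B !=set0 by exists v.
  have pgC := piecewise_sub A0 (@aut_subtree _ h _ sC) AhC pA.
  have phC := piecewise_sub B0 sC (@subsetUr _ A' B) pB.
  exists C; split=> //.
  + by rewrite finite_setU; split=> //; exact: finite_image.
  + by left.
  + by move=> _ [[a Aa <-]|/Bn//]; rewrite root_dist//; exact: An.
  + move=> w Cw [u wu Nu].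
    have [k kG kE] := phC w Cw (ex_intro2 _ _ u wu Nu).
    have [||l lG lE] := pgC (h w); first by exists w.
      by exists (h u); [rewrite aut_adj|move=> [t Ct /aut_inj tu]; rewrite tu in Ct].
    exists (l * k)%g; first exact: gpredM.
    by move=> x xw; rewrite !autME -kE//; apply: lE; exact/aut_projection.
- move=> g [gv [A [fA Av sA An pA]]].
  have gVv : (g^-1)%g v = v by rewrite -{1}gv autK.
  split=> //; exists (g @` A); split.
  + exact: finite_image.
  + by exists v.
  + exact: aut_subtree.
  + by move=> _ [a Aa <-]; rewrite root_dist//; exact: An.
  + move=> _ [w Aw <-] [u wu Nu].
    have [|k kG kE] := pA w Aw.
      exists (g^-1%g u); first by rewrite -(aut_adj g) autVK.
      by move=> Agu; apply: Nu; exists (g^-1%g u); rewrite ?autVK.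
    exists k^-1%g; first exact: gpredVr.
    move=> x; rewrite -{1}(autVK g x) => /aut_projection xw.
    by rewrite -{2}(autVK g x) (kE _ xw) autK.
Qed.

(** The exceptional branches [F] are those at the children of [x] inside the witness. Their depth is
    at most [n], so there are none when [x] has depth [n]. *)
Lemma PwBall_local n g x : PwBall n g -> g x = x -> (dist v x <= n)%N ->
  exists2 h, h \in G /\ h x = x & exists F : seq T,
    (forall c, c \in F -> child v x c /\ (dist v c <= n)%N) /\
    forall z, desc v x z -> z != x -> (forall c, c \in F -> ~ desc v c z) ->
      g z = h z.
Proof.
move=> [gv [A [fA Av sA An pA]]] gx xn.
pose A' := A `|` segment v x.
have sA' : subtree A' by apply: (subtreeU sA (@segment_subtree _ v _) Av); exact: segment_root.
have pA' : piecewise G g A' by apply: piecewise_sub pA => //; [exists v|left].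
have A'x : A' x by right; exact: segment_end.
have A'v : A' v by left.
have A'n a : A' a -> (dist v a <= n)%N.
  by move=> [/An//|/segment_dist]; move/leq_trans; apply.
have /finite_seqP[s sE] : finite_set A'.
  by rewrite finite_setU; split=> //; exact: finite_seq.
have sA'P a : a \in s <-> A' a by rewrite sE.
pose F := [seq c <- s | `[< child v x c >]].
have FP c : c \in F <-> child v x c /\ A' c.
  by rewrite mem_filter; split=> [/andP[/asboolP ? /sA'P]|[? /sA'P ->]]//;
    rewrite andbT; apply/asboolP.
have F1 c : c \in F -> child v x c /\ (dist v c <= n)%N.
  by move=> /FP[? /A'n].
have [[c ch Nc]|H] := pselect (exists2 c, child v x c & ~ A' c).
  have [|h hG hE] := pA' x A'x.
    by exists c => //; rewrite adj_sym; exact: child_adj ch.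
  exists h; first by split=> //; rewrite -hE ?gx//; split=> // w _; rewrite distxx.
  exists F; split=> // z dz zx NF; have [c' ch' dc'] := desc_child dz zx.
  apply: hE; apply: (child_projection _ _ _ ch') => // Ac'.
  by apply: (NF c') => //; apply/FP.
(* Every child of [x] is exceptional here, so nothing remains to be matched. *)
exists 1%g; first by split=> //; exact: gpred1.
exists F; split=> // z dz zx NF; have [c' ch' dc'] := desc_child dz zx.
case: (NF c') => //; apply/FP; split=> //; apply: contrapT => Nc.
by apply: H; exists c'.
Qed.

Definition DescFix n x : set (aut T) := [set g : aut T | [/\ PwBall n g, g x = x &
  forall z, ~ desc v x z -> g z = z]].

Lemma DescFix_desc n x g z : DescFix n x g -> desc v x (g z) <-> desc v x z.
Proof. by move=> [[gv _] gx _]; rewrite -{1}gx; exact: aut_desc. Qed.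

Lemma DescFix_subgroup n x : is_subgroup (DescFix n x).
Proof.
have [P1 PM PV] := PwBall_subgroup n; split=> //.
  move=> g h [Pg gx gE] [Ph hx hE]; split; first exact: PM.
    by rewrite autME hx gx.
  by move=> z Nz; rewrite autME hE// gE.
move=> g Dg; have [Pg gx gE] := Dg.
have gVx : (g^-1)%g x = x by rewrite -{1}gx autK.
by split=> [||z Nz] //; [exact: PV|rewrite -{1}(gE z Nz) autK].
Qed.

Lemma DescFix_amen_leaf x : amen R (DescFix (dist v x) x).
Proof.
set n := dist v x.
pose Q : set (aut T) :=
  [set g : aut T | (g \in G /\ g x = x) /\ forall z, desc v x (g z) <-> desc v x z].
have sQ : is_subgroup Q.
  split.
  - by split=> //; split=> //; exact: gpred1.
  - move=> g h [[gG gx] gD] [[hG hx] hD]; split=> [|z].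
      by rewrite autME hx gpredM.
    by rewrite autME gD.
  - move=> g [[gG gx] gD]; split=> [|z]; last by rewrite -gD autVK.
    by rewrite gpredV -{1}gx autK.
have aQ : amen R Q by apply: amen_sub (amenG x) => // g [].
have sD := DescFix_subgroup n x; have [D1 DM DV] := sD.
apply: (@amen_germ _ _ _ Q [set 1%g] (fun a b => forall z, desc v x z -> a z = b z)) => //.
- exact: amen_trivial.
- by move=> _ ->.
- move=> g [Pg gx gE] g1; apply/autP => z.
  by have [/g1//|/gE] := pselect (desc v x z).
- by move=> a b ab z /ab.
- by move=> a b c ab bc z dz; rewrite ab// bc.
- by move=> k a b ab z dz; rewrite !autME ab.
- by move=> q a b [_ qD] ab z dz; rewrite !autME ab//; apply/qD.
move=> g Dg; have [Pg gx gE] := Dg.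
have [h [hG hx] [F [F1 F2]]] := PwBall_local Pg gx (leqnn _).
have gh z : desc v x z -> g z = h z.
  have [->|zx dz] := eqVneq z x; first by rewrite hx gx.
  by apply: F2 => // c /F1[[_ ->]]; rewrite ltnn.
exists h => //; split=> // z; split=> [dz|dz]; last first.
  by rewrite -gh//; apply/(DescFix_desc _ Dg).
have Dg' := DV _ Dg.
have dw : desc v x (g^-1%g (h z)) by apply/(DescFix_desc _ Dg').
suff : z = g^-1%g (h z) by move=> ->.
by apply: (@aut_inj _ h); rewrite -(gh _ dw) autVK.
Qed.

Section Step.
Variables (n : nat) (x : T).
Hypotheses (xn : (dist v x < n)%N)
  (IH : forall c, child v x c -> amen R (DescFix n c)).

Definition supp_in (F : seq T) : set (aut T) := [set g : aut T | DescFix n x g /\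
  forall z, (forall c, c \in F -> ~ desc v c z) -> g z = z].

Lemma swap_DescFix g c (gx : g x = x) (ch : child v x c) : PwBall n g ->
  g c = c -> DescFix n c (swap gx (child_adj ch)).
Proof.
move=> [gv [A [fA Av sA An pA]]] gc; have cx := child_adj ch; have [_ ec] := ch.
have out z : ~ half c x z -> swap gx cx z = z.
  by move=> h; apply: (@swap_out _ g) => //; rewrite gc.
have inn z : half c x z -> swap gx cx z = g z by exact: swap_in.
suff Pq : PwBall n (swap gx cx).
  split=> // [|z Nz]; first by rewrite inn ?gc//; exact: half_root.
  by apply: out => hz; apply: Nz; apply/(descE _ ch).
have xc : adj x c by rewrite adj_sym.
split; first by apply: out; apply/(halfC _ cx)/child_half.
(* The enlarged witness contains both ends of the edge between [x] and [c], so no fibre of the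
   projection to it lies on both sides of this edge. *)
pose A' := A `|` segment v c.
have sA' : subtree A' by apply: (subtreeU sA (@segment_subtree _ v _) Av); exact: segment_root.
have pA' : piecewise G g A' by apply: piecewise_sub pA => //; [exists v|left].
have A'c : A' c by right; exact: segment_end.
have A'x : A' x by right; exact: segment_parent.
exists A'; split=> //.
- by rewrite finite_setU; split=> //; exact: finite_seq.
- by left.
- by move=> a [/An//|/segment_dist]; rewrite ec => /leq_trans; apply.
move=> w A'w Ew; have [hw|hw] := pselect (half c x w).
  have [k kG kE] := pA' w A'w Ew; exists k => // z pz; rewrite inn ?kE//.
  apply: contrapT => /(halfC _ cx) hz; have := proj2 pz x A'x.
  by rewrite (half_between xc hz hw); lia.
exists 1%g; first exact: gpred1.
move=> z pz; rewrite out// => hz; have := proj2 pz c A'c.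
by move/(halfC _ cx) in hw; rewrite (half_between cx hz hw); lia.
Qed.

Lemma supp_in_subgroup F : is_subgroup (supp_in F).
Proof.
have [D1 DM DV] := DescFix_subgroup n x; split=> //.
  move=> g h [Dg gE] [Dh hE]; split; first exact: DM.
  by move=> z Nz; rewrite autME hE// gE.
move=> g [Dg gE]; split; first exact: DV.
by move=> z Nz; rewrite -{1}(gE z Nz) autK.
Qed.

Definition supp_fix (F : seq T) : set (aut T) :=
  [set g : aut T | supp_in F g /\ forall c, c \in F -> g c = c].

Lemma supp_fix_subgroup F : is_subgroup (supp_fix F).
Proof.
have [D1 DM DV] := supp_in_subgroup F; split=> //.
  move=> g h [Dg gE] [Dh hE]; split; first exact: DM.
  by move=> z Nz; rewrite autME hE// gE.
move=> g [Dg gE]; split; first exact: DV.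
by move=> z Nz; rewrite -{1}(gE z Nz) autK.
Qed.

(** One branch is split off at a time: [k] is the product of its restriction [q] to the branch at
    [c], which is in [DescFix n c], and of an element of [supp_fix F]. *)
Lemma supp_fix_amen F : (forall c, c \in F -> child v x c) -> amen R (supp_fix F).
Proof.
elim: F => [|c F IHF] chF.
  apply: amen_sub (amen_trivial R _); first exact: supp_fix_subgroup.
  by move=> g [[_ gE] _] /=; apply/autP => z; apply: gE.
have ch : child v x c by apply: chF; rewrite inE eqxx.
have {}chF c' : c' \in F -> child v x c' by move=> Fc'; apply: chF; rewrite inE Fc' orbT.
have Nself c1 c2 : child v x c1 -> child v x c2 -> c1 != c2 -> ~ desc v c1 c2.
  by move=> h1 h2 ne d; exact: child_disjoint h1 h2 ne d (desc_self v c2).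
have sK := supp_fix_subgroup (c :: F); have [K1 KM KV] := sK.
have [D1 DM DV] := DescFix_subgroup n x.
have QK : DescFix n c `<=` supp_fix (c :: F).
  move=> g [Pg gc gE]; split; first split; first split=> //.
  - by apply: gE; exact: child_center.
  - by move=> z Nz; apply: gE => dz; apply: Nz; exact: child_desc dz.
  - by move=> z Nz; apply: gE; apply: Nz; rewrite inE eqxx.
  - move=> c'; rewrite inE; case: eqVneq => [->//|ne /= Fc'].
    by apply: gE; apply: Nself => //; [exact: chF|rewrite eq_sym].
have NK : supp_fix F `<=` supp_fix (c :: F).
  move=> g [[Dg gE] gF]; split; first split=> //.
    by move=> z Nz; apply: gE => c' Fc'; apply: Nz; rewrite inE Fc' orbT.
  move=> c'; rewrite inE => /orP[/eqP ->|/gF//].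
  have [/gF//|Fc] := boolP (c \in F); apply: gE => c2 Fc2; apply: Nself => //.
    exact: chF.
  by apply: contraNneq Fc => <-.
apply: (amen_prod sK QK NK (DescFix_subgroup n c) (IH ch) (IHF chF)) => [k g Kk Ng|k Kk].
  have [[Dk _] kF] := Kk; have [[Dg gE] gF] := Ng; have [[kv _] kx _] := Dk.
  split; first split.
  - by apply: (DM); [exact: DV|exact: DM].
  - move=> z Nz; rewrite !autME gE ?autK// => c' Fc' d; apply: (Nz c') => //.
    by apply/(aut_desc kv); rewrite kF// inE Fc' orbT.
  - move=> c' Fc'; rewrite !autME.
    have kc' : k c' = c' by apply: kF; rewrite inE Fc' orbT.
    by rewrite kc' gF// -{1}kc' autK.
have [[Dk kE] kF] := Kk; have [Pk kx _] := Dk.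
have kc : k c = c by apply: kF; rewrite inE eqxx.
pose q := swap kx (child_adj ch).
have out z : ~ half c x z -> q z = z.
  by move=> h; apply: (@swap_out _ k) => //; rewrite kc.
have inn z : half c x z -> q z = k z by exact: swap_in.
have Dq : DescFix n c q by exact: swap_DescFix.
exists q => //.
have [[[Dq' _] qF] qV] : supp_fix (c :: F) q /\ supp_fix (c :: F) q^-1%g.
  by split; [exact: QK|apply: KV; exact: QK].
have qVE z w : q w = z -> q^-1%g z = w by move=> <-; rewrite autK.
split; first split.
- by apply: (DM) => //; exact: DV.
- move=> z Nz; rewrite autME; apply: qVE.
  have [hz|hz] := pselect (half c x z); first exact: inn.
  rewrite out// kE// => c'; rewrite inE => /orP[/eqP ->|]; last exact: Nz.
  by move/(descE _ ch).
- move=> c' Fc'; have cF : c' \in c :: F by rewrite inE Fc' orbT.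
  by rewrite autME kF//; apply: qVE; exact: qF.
Qed.

Lemma supp_in_amen F : (forall c, c \in F -> child v x c) -> amen R (supp_in F).
Proof.
move=> chF.
(* The vertices of [L] are fixed one after the other, each having a finite orbit inside [F]. *)
have orb (L : seq T) K : is_subgroup K -> K `<=` supp_in F -> {subset L <= F} ->
    amen R [set k | K k /\ forall c, c \in L -> k c = c] -> amen R K.
  elim: L K => [|c L IHL] K sK KF LF.
    by apply: amen_sub => // k Kk; split.
  move=> aN; have [K1 KM KV] := sK.
  apply: (@amen_orbit R (aut T) T (fun (k : aut T) z => k z) c F K sK) => //.
    move=> k Kk; have [[Pk kx _] kE] := KF _ Kk.
    apply: contraT => kc.
    have cF : c \in F by apply: LF; rewrite inE eqxx.
    have chk : child v x (k c).
      by rewrite -{1}kx; apply/aut_child; [case: Pk|exact: chF].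
    (* If [k c] were not in [F], it would be outside the support of [k], hence fixed; then [k c = c]
       by injectivity. *)
    have : k (k c) = k c.
      apply: kE => c' Fc' d; have ne : c' != k c by apply: contraNneq kc => <-.
      exact: child_disjoint (chF _ Fc') chk ne d (desc_self v _).
    by move/aut_inj => e; rewrite e cF in kc.
  apply: IHL.
  - split=> //.
    + by move=> g h [Kg gc] [Kh hc]; split; [exact: KM|rewrite autME hc gc].
    + by move=> g [Kg gc]; split; [exact: KV|rewrite -{1}gc autK].
  - by move=> k [/KF].
  - by move=> c' Lc'; apply: LF; rewrite inE Lc' orbT.
  - apply: amen_sub aN.
      split=> //.
      + move=> g h [[Kg gc] gL] [[Kh hc] hL]; split; first split.
        * exact: KM.
        * by rewrite autME hc gc.
        * by move=> c' Lc'; rewrite autME hL// gL.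
      + move=> g [[Kg gc] gL]; split; first split.
        * exact: KV.
        * by rewrite -{1}gc autK.
        * by move=> c' Lc'; rewrite -{1}(gL c' Lc') autK.
    move=> k [[Kk kc] kL]; split=> // c'; rewrite inE => /orP[/eqP->//|].
    exact: kL.
by apply: (orb F); [exact: supp_in_subgroup| | |exact: supp_fix_amen].
Qed.

Lemma DescFix_amen_step : amen R (DescFix n x).
Proof.
pose Q : set (aut T) := [set g : aut T | g \in G /\ g x = x].
have sQ : is_subgroup Q.
  split.
  - by split=> //; exact: gpred1.
  - by move=> g h [gG gx] [hG hx]; split; [exact: gpredM|rewrite autME hx gx].
  - by move=> g [gG gx]; split; [rewrite gpredV|rewrite -{1}gx autK].
pose N : set (aut T) := [set g : aut T | exists F : seq T,
  (forall c, c \in F -> child v x c) /\ supp_in F g].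
have aN : amen R N.
  apply: amen_local => s sN.
  suff [F [chF sF]] : exists F : seq T, (forall c, c \in F -> child v x c) /\
      forall g, g \in s -> supp_in F g.
    exists (supp_in F); split=> //; last exact: supp_in_amen.
    by move=> g gF; exists F.
  elim: s sN => [|g s IHs] sN; first by exists [::].
  have [|F1 [ch1 s1]] := IHs; first by move=> h hs; apply: sN; rewrite inE hs orbT.
  have [|F2 [ch2 [Dg gE]]] := sN g; first by rewrite inE eqxx.
  exists (F1 ++ F2); split=> [c|h].
    by rewrite mem_cat => /orP[/ch1|/ch2].
  rewrite inE => /orP[/eqP ->|/s1[Dh hE]]; split=> // z Nz; [apply: gE|apply: hE];
    by move=> c Fc; apply: Nz; rewrite mem_cat Fc ?orbT.
(* Agreement on all but finitely many branches at [x]. All neighbours count, not only the children: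
   an element of [Q] may move the parent of [x], and [E] must be invariant under right
   multiplication by [Q]. *)
pose E (a b : aut T) := exists F : seq T, forall c z, adj c x -> c \notin F ->
  half c x z -> a z = b z.
apply: (@amen_germ _ _ _ Q N E) => //.
- exact: DescFix_subgroup.
- exact: amenG.
- by move=> g [F [_ []]].
- move=> g Dg [F gE]; have [Pg gx gD] := Dg.
  exists [seq c <- F | `[< child v x c >]]; split.
    by move=> c; rewrite mem_filter => /andP[/asboolP].
  split=> // z Nz; have [dz|/gD//] := pselect (desc v x z).
  have [->//|zx] := eqVneq z x; have [c ch dc] := desc_child dz zx.
  apply: (gE c); [exact: child_adj ch| |exact/(descE _ ch)].
  by apply/negP => Fc; apply: (Nz c) => //; rewrite mem_filter Fc andbT; apply/asboolP.
- by move=> a b [F ab]; exists F => c z cx cF hz; rewrite (ab c).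
- move=> a b c [F ab] [F' bc]; exists (F ++ F') => d z dx.
  by rewrite mem_cat negb_or => /andP[dF dF'] hz; rewrite (ab d)// (bc d).
- by move=> k a b [F ab]; exists F => c z cx cF hz; rewrite !autME (ab c).
- move=> q a b [_ qx] [F ab]; exists (map q^-1%g F) => c z cx cF hz.
  rewrite !autME; apply: (ab (q c)).
  + by rewrite -{1}qx aut_adj.
  + by apply: contra cF => Fqc; apply/mapP; exists (q c) => //; rewrite autK.
  + by rewrite -{1}qx; apply/aut_halfE.
move=> g Dg; have [Pg gx gD] := Dg.
have [h [hG hx] [F [F1 F2]]] := PwBall_local Pg gx (ltnW xn).
exists h => //; have [s sP] := nonchild v x.
exists (F ++ s) => c z cx; rewrite mem_cat negb_or => /andP[cF cs] hz.
have ch := sP c cx cs; have dc : desc v c z by exact/(descE _ ch).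
apply: F2.
- exact: child_desc dc.
- by apply: contraPneq dc => ->; exact: child_center.
- move=> c' Fc' dc'; have [ch' _] := F1 _ Fc'.
  by apply: (child_disjoint ch ch' _ dc dc'); apply: contraNneq cF => ->.
Qed.
End Step.

Lemma DescFix_amen n x : (dist v x <= n)%N -> amen R (DescFix n x).
Proof.
move=> xn; have [k] : exists k, (dist v x + k)%N = n by exists (n - dist v x)%N; lia.
elim: k x xn => [|k IH] x xn; first by rewrite addn0 => <-; exact: DescFix_amen_leaf.
move=> e; have lt : (dist v x < n)%N by lia.
by apply: DescFix_amen_step => // c [_ ec]; apply: IH; rewrite ec; lia.
Qed.

Lemma vertex_stabilizer_amen (Gam : groupClosed (aut T)) : {subset Gam <= Pw G} ->
  amen R [set g : aut T | g \in Gam /\ g v = v].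
Proof.
move=> GP; apply: (@amen_sub _ _ [set g : aut T | g \in Pw G /\ g v = v]).
- split.
  + by split=> //; exact: gpred1.
  + by move=> g h [gG gx] [hG hx]; split; [exact: gpredM|rewrite autME hx gx].
  + by move=> g [gG gx]; split; [rewrite gpredV|rewrite -{1}gx autK].
- by move=> g [/GP].
have ball g : g \in Pw G -> g v = v -> exists n, PwBall n g.
  move=> /asboolP[A [fA A0 sA pA]] gv.
  have s1 : subtree [set v] by move=> _ _ -> ->; exists [::].
  have [|C [fC sC AC vC]] := subtree_hull fA (finite_set1 v) sA s1 A0; first by exists v.
  have [s sE] := proj1 (finite_seqP C) fC; exists (\max_(a <- s) dist v a)%N; split=> //.
  exists C; split=> //; first exact: vC.
    move=> a; rewrite sE /= => as_.
    exact: leq_bigmax_seq.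
  exact: piecewise_sub pA.
have mono m n : (m <= n)%N -> PwBall m `<=` PwBall n.
  move=> mn g [gv [A [fA Av sA An pA]]]; split=> //; exists A; split=> // a /An.
  by move/leq_trans; apply.
apply: amen_local => s sP.
suff [n Hn] : exists n, forall g, g \in s -> g v = v /\ PwBall n g.
  (* Every vertex descends from the root, so [DescFix n v] is all of [PwBall n]. *)
  exists (DescFix n v); split; last 2 first.
  - by apply: DescFix_amen; rewrite distxx.
  - by move=> g /Hn[gv Pg]; split=> // z []; exact: desc_root.
  move=> g [[gv [A [fA Av sA An pA]]] _ _]; split=> //; apply/asboolP; exists A.
  by split=> //; exists v.
elim: s sP => [|g s IHs] sP; first by exists 0%N.
have [|n1 H1] := IHs; first by move=> h hs; apply: sP; rewrite inE hs orbT.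
have [|gP gv] := sP g; first by rewrite inE eqxx.
have [n2 H2] := ball g gP gv; exists (maxn n1 n2) => h; rewrite inE => /orP[/eqP ->|/H1[hv Hh]].
  by split=> //; apply: mono H2; exact: leq_maxr.
by split=> //; apply: mono Hh; exact: leq_maxl.
Qed.

End VertexStabilizer.

(** * The amenable radical *)

Section Displacement.
Variable T : tree.
Implicit Types (x y z u v a b c : T) (g m : aut T).

Lemma fixed_geodesic g x y z : g x = x -> g y = y -> z \in geodesic x y -> g z = z.
Proof.
move=> gx gy; have [xp lp up] := geodesicP x y.
have : map g (geodesic x y) = geodesic x y.
  apply: geodesic_unique; rewrite -{1}gx ?aut_path//; first by rewrite last_map lp.
  by rewrite -map_cons map_inj_uniq//; exact: aut_inj.
by rewrite -[X in _ = X]map_id => /eq_in_map; exact.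
Qed.

(** Each of [m v] and [m^-1 v] is in at most one of three disjoint half-trees, so some [half d v]
    contains neither. If it met its image, the image, which is not inside it, would contain the edge
    at [d] and hence [v]. *)
Lemma displaced_half m v : branching v -> m v != v ->
  exists2 a, adj a v & forall z, half a v z -> ~ half a v (m z).
Proof.
move=> [a [b [c [[av bv cv] [ab ac bc]]]]] mv.
suff key d : adj d v -> ~ half d v (m v) -> ~ half d v (m^-1%g v) ->
    forall z, half d v z -> ~ half d v (m z).
  have D1 z := half_disjoint av bv ab (z := z).
  have D2 z := half_disjoint av cv ac (z := z).
  have D3 z := half_disjoint bv cv bc (z := z).
  have := D1 (m v); have := D2 (m v); have := D3 (m v).
  have := D1 (m^-1%g v); have := D2 (m^-1%g v); have := D3 (m^-1%g v).
  have [Na|Na] := pselect (~ half a v (m v) /\ ~ half a v (m^-1%g v)).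
    by exists a => //; apply: key; tauto.
  have [Nb|Nb] := pselect (~ half b v (m v) /\ ~ half b v (m^-1%g v)).
    by exists b => //; apply: key; tauto.
  have [Nc|Nc] := pselect (~ half c v (m v) /\ ~ half c v (m^-1%g v)).
    by exists c => //; apply: key; tauto.
  by tauto.
move=> dv N1 N2 z hz hmz.
have mdv : adj (m d) (m v) by rewrite aut_adj.
have vd : adj v d by rewrite adj_sym.
have hmz' : half (m d) (m v) (m z) by exact/aut_halfE.
have Nv : ~ half (m d) (m v) v 
  by move=> h; apply: N2; apply/(aut_halfE m); rewrite autVK.
have [hd|/(halfC _ dv) hd] := pselect (half d v (m d)).
  by have [_ e] := half_cross dv mdv hd N1; rewrite e eqxx in mv.
by have [] := subtree_cross dv (half_subtree (x := m d) (y := m v)) hmz' (half_root mdv) hmz hd.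
Qed.
End Displacement.

Lemma val_conjE (T : tree) (Gam : groupClosed (aut T)) (m g : subgroup Gam) z :
  (val (m ^ g)%g : aut T) z =
  ((val g : aut T)^-1)%g ((val m : aut T) ((val g : aut T) z)).
Proof. by []. Qed.

Section NormalAmenable.
Variables (R : realType) (T : tree) (G Gam : groupClosed (aut T)).
Hypotheses (minG : minimal_action G) (gtG : general_type G)
  (GGam : {subset G <= Gam}).
Variable M : groupClosed (subgroup Gam).
Hypothesis nM : normal_subgroup M.

(** Since [M] is normal, its fixed vertices form a [G]-invariant subtree; it contains a branching
    vertex, so it is everything by minimality. *)
Lemma normal_fixed :
  (forall (m : subgroup Gam) u, m \in M -> branching u -> (val m : aut T) u = u) ->
  forall m, m \in M -> m = 1%g.
Proof.
move=> H; pose X : set T := [set z | forall m, m \in M -> (val m : aut T) z = z].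
have sX : subtree X.
  move=> a b Xa Xb; have [ap lp _] := geodesicP a b.
  exists (geodesic a b); split=> // z zp m mM.
  by apply: fixed_geodesic zp; [exact: Xa|exact: Xb].
have inv g : g \in G -> g @` X `<=` X.
  move=> gG _ [z Xz <-] m mM; pose g' : subgroup Gam := Sub g (GGam gG).
  have := Xz _ (nM g' mM); rewrite val_conjE /=.
  by move=> e; rewrite -{2}e autVK.
have XT : X = setT.
  apply: minG => // [|g gG].
    by have [u bu] := branching_exists minG gtG; exists u => m mM; exact: H.
  apply/seteqP; split; first exact: inv.
  move=> z Xz; exists (g^-1%g z); last by rewrite autVK.
  by apply: (inv g^-1%g); [rewrite gpredV|exists z].
move=> m mM; apply: val_inj; apply/autP => z /=.
have Xz : X z by rewrite XT.
exact: Xz.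
Qed.

Lemma amenable_normal_trivial : amenable R (subgroup M) -> forall m, m \in M -> m = 1%g.
Proof.
move=> /amen_amenable[mu [muM inv]]; apply: normal_fixed => m u mM bu.
apply/eqP/negPn/negP => mu_ne.
have [a au dis] := displaced_half bu mu_ne.
have all_dis x y : adj x y -> exists2 k, k \in M &
    forall z, half x y z -> ~ half x y ((val k : aut T) z).
  move=> xy; have [g gG gH] := half_into_half minG gtG xy au.
  pose g' : subgroup Gam := Sub g (GGam gG); exists (m ^ g')%g; first exact: nM.
  move=> z /gH h; rewrite val_conjE /= => /gH.
  by rewrite autVK; exact: dis.
have [v0] := tree_inh T.
pose ind (B : set T) (k : subgroup Gam) : R := if `[< B ((val k : aut T) v0) >] then 1 else 0.
have bi B : bdd (ind B).
  by exists 1 => k; rewrite /ind; case: ifP; rewrite ?normr1 ?normr0.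
have b1 : bdd (fun _ : subgroup Gam => 1 : R) by exact: bdd_cst.
have muD f h : bdd f -> bdd h -> mu (fun k => f k + h k) = mu f + mu h.
  move=> bf bh; rewrite -[mu f]mul1r -(mean_lin muM)//.
  by congr mu; apply/funext => k; rewrite mul1r.
have bD f h : bdd f -> bdd h -> bdd (fun k : subgroup Gam => f k + h k).
  move=> bf bh; have := bdd_lin 1 bf bh; congr bdd.
  by apply/funext => k; rewrite mul1r.
(* The half-tree and its preimage under [k] are disjoint and have the same mass. The same bound for
   the complement then forces equality. *)
have le12 x y : adj x y -> mu (ind (half x y)) + mu (ind (half x y)) <= 1.
  move=> xy; have [k kM kd] := all_dis x y xy.
  rewrite -{2}(inv k kM (ind (half x y)))// -muD//; last exact: bdd_comp.
  rewrite -[leRHS](mean_cst muM); apply: (mean_le muM) => //.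
    by apply: bD => //; exact: bdd_comp.
  move=> h _; rewrite /ind; case: asboolP => h1; case: asboolP => h2; rewrite ?addr0 ?add0r//.
  by case: (kd _ h1); move: h2; rewrite gmulfM.
have sum1 x y : adj x y -> mu (ind (half x y)) + mu (ind (half y x)) = 1.
  move=> xy; rewrite -muD// -[RHS](mean_cst muM); congr mu; apply/funext => h.
  rewrite /ind; case: asboolP => h1; case: asboolP => h2; rewrite ?addr0 ?add0r//.
    by move/(halfC _ xy) in h2.
  by case: h2; apply/(halfC _ xy).
have half12 x y : adj x y -> mu (ind (half x y)) + mu (ind (half x y)) = 1.
  move=> xy; have yx : adj y x by rewrite adj_sym.
  have := le12 _ _ xy; have := le12 _ _ yx; have := sum1 _ _ xy; lra.
have [p [q [r [[pu qu ru] [pq pr qr]]]]] := bu.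
have : mu (ind (half p u)) + (mu (ind (half q u)) + mu (ind (half r u))) <= 1.
  rewrite -!muD//; last exact: bD.
  rewrite -[leRHS](mean_cst muM); apply: (mean_le muM) => //.
    by apply: (bD) => //; exact: bD.
  move=> h _; rewrite /ind; case: asboolP => h1; case: asboolP => h2;
    case: asboolP => h3; rewrite ?addr0 ?add0r//.
  - by case: (half_disjoint pu qu pq h1 h2).
  - by case: (half_disjoint pu qu pq h1 h2).
  - by case: (half_disjoint pu ru pr h1 h3).
  - by case: (half_disjoint qu ru qr h2 h3).
have := half12 _ _ pu; have := half12 _ _ qu; have := half12 _ _ ru; lra.
Qed.
End NormalAmenable.

Section TrivialRadical.
Variables (R : realType) (gT : groupType).

Definition trivial_pred : {pred gT} := pred1 1%g.

Lemma trivial_mul1 : 1%g \in trivial_pred. Proof. by rewrite inE. Qed.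
Lemma trivial_mul : {in trivial_pred &, forall g h, (g * h)%g \in trivial_pred}.
Proof. by move=> g h; rewrite !inE => /eqP -> /eqP ->; rewrite mulg1. Qed.
Lemma trivial_inv : {in trivial_pred, forall g, g^-1%g \in trivial_pred}.
Proof. by move=> g; rewrite !inE => /eqP ->; rewrite invg1. Qed.
HB.instance Definition _ := isMulClosed.Build gT trivial_pred trivial_mul.
HB.instance Definition _ := isMul1Closed.Build gT trivial_pred trivial_mul1.
HB.instance Definition _ := isInvClosed.Build gT trivial_pred trivial_inv.

Lemma trivial_radical :
  (forall M : groupClosed gT, normal_subgroup M -> amenable R (subgroup M) ->
     forall m, m \in M -> m = 1%g) ->
  trivial_amenable_radical R gT.
Proof.
move=> H; have tE x : (x \in (trivial_pred : groupClosed gT)) = (x == 1%g) by [].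
exists (trivial_pred : groupClosed gT) => //; split.
- by move=> x y; rewrite !tE => /eqP ->; rewrite /conjg mul1g mulVg.
- exists (fun f => f 1%g); split=> [//|f _ f0|//|g f _]; first exact: f0.
  congr f; apply: val_inj.
  by have := valP g; rewrite tE => /eqP g1; rewrite mulg1 /= g1 invg1.
- by move=> M nM aM m mM; rewrite tE (H M nM aM m mM).
Qed.
End TrivialRadical.

(** * Almost invariant vectors *)

Section HahnBanach.
Variables (R : realType) (E : lmodType R).
Implicit Types (p q : E -> R) (x y : E).

Definition sublinear p : Prop :=
  (forall x y, p (x + y) <= p x + p y) /\ (forall a x, 0 < a -> p (a *: x) <= a * p x).

Lemma sublinear0 p : sublinear p -> p 0 = 0.
Proof.
move=> [_ pZ]; have := pZ 2 0 ltac:(lra); have := pZ (2^-1) 0 ltac:(lra).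
by rewrite !scaler0; lra.
Qed.

Lemma sublinearZ p a x : sublinear p -> 0 <= a -> p (a *: x) = a * p x.
Proof.
move=> sp; rewrite le_eqVlt => /orP[/eqP <-|a0].
  by rewrite scale0r sublinear0// mul0r.
have [_ pZ] := sp; apply/eqP; rewrite eq_le pZ//=.
have aV : 0 < a^-1 by rewrite invr_gt0.
have := pZ a^-1 (a *: x) aV; rewrite scalerA mulVf ?gt_eqF// scale1r => h.
by rewrite mulrC -ler_pdivlMr// mulrC.
Qed.

Lemma sublinearN p x : sublinear p -> - p (- x) <= p x.
Proof.
move=> sp; have [pD _] := sp; have := pD x (- x).
by rewrite subrr sublinear0//; lra.
Qed.

Section Inf.
Variables (J : Type) (A : set J) (f : J -> E -> R) (b : E -> R).
Hypotheses (A0 : A !=set0) (fb : forall j x, A j -> b x <= f j x).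
Let q x := inf [set f j x | j in A].

Lemma inf_fam_lb j x : A j -> q x <= f j x.
Proof.
move=> Aj; apply: ge_inf; last by exists j.
by exists (b x) => _ [i Ai <-]; exact: fb.
Qed.

Lemma inf_fam_ge x c : (forall j, A j -> c <= f j x) -> c <= q x.
Proof.
move=> H; apply: lb_le_inf; first by have [j Aj] := A0; exists (f j x), j.
by move=> _ [j Aj <-]; exact: H.
Qed.

Lemma inf_fam_sublinear :
  (forall i j x y, A i -> A j -> exists2 k, A k & f k (x + y) <= f i x + f j y) ->
  (forall i x a, 0 < a -> A i -> exists2 k, A k & f k (a *: x) <= a * f i x) ->
  sublinear q.
Proof.
move=> HD HZ; split=> [x y|a x a0].
  rewrite -lerBlDr; apply: inf_fam_ge => i Ai.
  rewrite lerBlDr -lerBlDl; apply: inf_fam_ge => j Aj.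
  rewrite lerBlDl; have [k Ak le] := HD i j x y Ai Aj.
  exact: le_trans (inf_fam_lb _ Ak) le.
rewrite mulrC -ler_pdivrMr//; apply: inf_fam_ge => i Ai.
rewrite ler_pdivrMr// mulrC; have [k Ak le] := HZ i x a a0 Ai.
exact: le_trans (inf_fam_lb _ Ak) le.
Qed.
End Inf.

(** A pointwise minimal sublinear functional below [p] is linear. *)
Lemma hahn_banach p : sublinear p -> exists f : E -> R,
  [/\ forall x y, f (x + y) = f x + f y, forall a x, f (a *: x) = a * f x
    & forall x, f x <= p x].
Proof.
move=> sp; pose P := {q : E -> R | sublinear q /\ forall x, q x <= p x}.
(* The order is reversed, so that the maximal element given by Zorn's lemma is pointwise minimal. *)
pose r : rel P := fun s t => `[< forall x, sval t x <= sval s x >].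
have valI (s t : P) : sval s = sval t -> s = t.
  case: s t => [s Ps] [t Pt] /= e; rewrite e in Ps *.
  by rewrite (Prop_irrelevance Ps Pt).
have [||||q qmin] := @Zorn P r.
- by move=> s; apply/asboolP.
- move=> s t u /asboolP st /asboolP tu; apply/asboolP => x.
  exact: le_trans (tu x) (st x).
- move=> s t /asboolP st /asboolP ts; apply: valI; apply/funext => x.
  by apply/eqP; rewrite eq_le st ts.
- move=> A tot; have [A0|/set0P/negP/negPn/eqP A0] := pselect (A !=set0); last first.
    by exists (exist _ p (conj sp (fun x => lexx _))) => s; rewrite A0.
  have fb (s : P) x : A s -> - p (- x) <= sval s x.
    move=> _; have [ss sle] := svalP s.
    by apply: le_trans (sublinearN x ss); rewrite lerN2.
  pose q x := inf [set sval s x | s in A].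
  have sq : sublinear q.
    apply: (inf_fam_sublinear A0 fb) => [s t x y As At|s x a a0 As]; last first.
      by exists s => //; have [[_ sZ] _] := svalP s; exact: sZ.
    have [[sD _] _] := svalP s; have [[tD _] _] := svalP t.
    have [/asboolP st|/asboolP ts] := tot s t As At.
      by exists t => //; apply: le_trans (tD x y) _; rewrite lerD.
    by exists s => //; apply: le_trans (sD x y) _; rewrite lerD.
  have qle x : q x <= p x.
    have [s As] := A0; have [_ sle] := svalP s.
    exact: le_trans (inf_fam_lb fb x As) (sle x).
  exists (exist _ q (conj sq qle)) => s As; apply/asboolP => x /=.
  exact: (inf_fam_lb fb x As).
have [sq qle] := svalP q; set f := sval q in sq qle.
have [fD fZ] := sq; exists f.
(* The infimum over [t >= 0] of [f (z + t *: y) - t * f y] is sublinear and below [f], hence equal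
   to [f] by minimality; [t = 1] gives the inequality. *)
have super x y : f x + f y <= f (x + y).
  pose A := [set t : R | 0 <= t].
  have A0 : A !=set0 by exists 0; rewrite /A /=.
  have fb t z : A t -> - f (- z) <= f (z + t *: y) - t * f y.
    move=> At; have := fD (z + t *: y) (- z).
    by rewrite addrAC subrr add0r sublinearZ//; lra.
  pose q' z := inf [set f (z + t *: y) - t * f y | t in A].
  have sq' : sublinear q'.
    apply: (inf_fam_sublinear (f := fun t z => f (z + t *: y) - t * f y) A0 fb).
      move=> s t z w As At; exists (s + t); first exact: addr_ge0.
      have := fD (z + s *: y) (w + t *: y).
      by rewrite addrACA -scalerDl; lra.
    move=> t z a a0 At; exists (a * t); first by rewrite /A /= mulr_ge0// ltW.
    have := fZ a (z + t *: y) a0; rewrite scalerDr scalerA; lra.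
  have q'f z : q' z <= f z.
    have := inf_fam_lb (f := fun t z => f (z + t *: y) - t * f y) fb z (lexx 0 : A 0).
    by rewrite scale0r addr0 mul0r subr0.
  have q'p z : q' z <= p z by exact: le_trans (q'f z) (qle z).
  have e : exist _ q' (conj sq' q'p) = q :> P by apply: qmin; apply/asboolP.
  have {}e : f = q' by rewrite /f -e.
  have := inf_fam_lb (f := fun t z => f (z + t *: y) - t * f y) fb x (ler01 : A 1).
  by rewrite -/(q' x) -e scale1r mul1r; lra.
have fDe x y : f (x + y) = f x + f y by apply/eqP; rewrite eq_le fD super.
have fN x : f (- x) = - f x.
  by have := fDe x (- x); rewrite subrr sublinear0//; lra.
split=> // a x; have [a0|/ltW a0] := leP 0 a; first exact: sublinearZ.
have := @sublinearZ _ (- a) x sq; rewrite oppr_ge0 => /(_ a0).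
by rewrite scaleNr fN; lra.
Qed.

(** Separation of a convex cone from the origin: the pairs of [K] are the
    points of the cone with the bound to be achieved by the functional. *)
Lemma separation (N : E -> R) (K : E -> R -> Prop) :
  sublinear N -> (forall x, N (- x) = N x) -> K 0 0 ->
  (forall x s y t, K x s -> K y t -> K (x + y) (s + t)) ->
  (forall a x s, 0 < a -> K x s -> K (a *: x) (a * s)) ->
  (forall x s, K x s -> s <= N x) ->
  exists f : E -> R,
  [/\ forall x y, f (x + y) = f x + f y, forall a x, f (a *: x) = a * f x,
      forall x, `|f x| <= N x & forall x s, K x s -> s <= f x].
Proof.
move=> sN NN K0 KD KZ KN; have [ND NZ] := sN.
pose A := [set k : E * R | K k.1 k.2].
have A0 : A !=set0 by exists (0, 0).
have fb k x : A k -> - N x <= N (x + k.1) - k.2.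
  move=> /KN Ak; have := ND (x + k.1) (- x); rewrite addrAC subrr add0r NN; lra.
(* A linear [f] below this infimum satisfies [f <= N], by the pair [(0, 0)], and [f (- x) <= - s]
   for [K x s], by the pair [(x, s)]. *)
have sp := @inf_fam_sublinear _ A (fun k x => N (x + k.1) - k.2) (fun x => - N x) A0 fb.
have lb k x := @inf_fam_lb _ A (fun k x => N (x + k.1) - k.2) (fun x => - N x) fb k x.
have [||f [fD fZ fp]] := hahn_banach (sp _ _).
- move=> k l x y Ak Al; exists (k.1 + l.1, k.2 + l.2); first exact: KD.
  by have := ND (x + k.1) (y + l.1); rewrite addrACA /=; lra.
- move=> k x a a0 Ak; exists (a *: k.1, a * k.2); first exact: KZ.
  by have := NZ a (x + k.1) a0; rewrite scalerDr /=; lra.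
have fN x : f (- x) = - f x by rewrite -scaleN1r fZ mulN1r.
have fle x : f x <= N x.
  by have := le_trans (fp x) (lb (0, 0) x K0); rewrite /= addr0 subr0.
exists f; split=> // [x|x s Kx].
  by rewrite ler_norml fle andbT lerNl -fN -NN fle.
have := le_trans (fp (- x)) (lb (x, s) (- x) Kx).
by rewrite /= addNr sublinear0// fN; lra.
Qed.

End HahnBanach.

(** * Summable functions *)

Section L1.
Variables (R : realType) (X : choiceType).

Definition l1_pred : {pred (X -> R)} :=
  [pred f | `[< summable [set: X] (EFin \o f) >]].

Record l1 := L1 { l1_fun :> X -> R; l1P : l1_fun \in l1_pred }.

HB.instance Definition _ := [isSub for l1_fun].
HB.instance Definition _ := [Choice of l1 by <:].

Lemma esum_scale_le (c : R) (a : X -> R) : 0 <= c -> (forall x, 0 <= a x) ->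
  (\esum_(x in [set: X]) (c * a x)%:E <= c%:E * \esum_(x in [set: X]) (a x)%:E)%E.
Proof.
move=> c0 a0; apply: ge_ereal_sup => _ [F [fF _] <-].
under eq_fsbigr do rewrite EFinM.
rewrite -ge0_mule_fsumr => [|x]; last by rewrite lee_fin.
by apply: lee_wpmul2l; [rewrite lee_fin|apply: ereal_sup_ubound; exists F].
Qed.

Lemma l1_submod_closed : submod_closed l1_pred.
Proof.
split.
  apply/asboolP; rewrite /summable esum1 ?ltry// => x _.
  by rewrite /= normr0.
move=> a f h /asboolP sf /asboolP sh; apply/asboolP.
apply: (@le_lt_trans _ _ (`|a|%:E * (\esum_(x in [set: X]) `|f x|%:E)
    + \esum_(x in [set: X]) `|h x|%:E)%E); last first.
  apply: lte_add_pinfty; last exact: sh. by apply: lte_mul_pinfty => //; rewrite lee_fin.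
apply: le_trans (leeD2r _ (esum_scale_le (normr_ge0 a) (fun x => normr_ge0 (f x)))).
rewrite -esumD; first last.
- by move=> x _; rewrite lee_fin.
- by move=> x _; rewrite lee_fin mulr_ge0.
by apply: le_esum => x _; rewrite /= -EFinD lee_fin -normrM ler_normD.
Qed.

HB.instance Definition _ :=
  GRing.isSubmodClosed.Build _ _ l1_pred l1_submod_closed.
HB.instance Definition _ := [SubChoice_isSubLmodule of l1 by <:].

Definition norm1 (f : l1) : R := fine (\esum_(x in [set: X]) `|f x|%:E).

Lemma norm1E (f : l1) : (norm1 f)%:E = (\esum_(x in [set: X]) `|f x|%:E)%E.
Proof. by rewrite fineK//; have /asboolP := l1P f; rewrite summableE. Qed.

Lemma norm1_ge0 f : 0 <= norm1 f.
Proof. by rewrite -lee_fin norm1E; apply: esum_ge0 => x _; rewrite lee_fin. Qed.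

Lemma norm1_sublinear : sublinear norm1.
Proof.
split=> [f h|a f a0]; rewrite -lee_fin ?EFinD ?EFinM !norm1E.
  rewrite -esumD; try by move=> x _; rewrite lee_fin.
  by apply: le_esum => x _; rewrite -EFinD lee_fin ler_normD.
apply: le_trans (esum_scale_le (ltW a0) (fun x => normr_ge0 (f x))).
by apply: le_esum => x _; rewrite lee_fin /= normrM gtr0_norm.
Qed.

Lemma norm1N (f : l1) : norm1 (- f) = norm1 f.
Proof. by congr fine; apply: eq_esum => x _; rewrite /= normrN. Qed.

Lemma norm1D (f h : l1) : (forall x, 0 <= f x) -> (forall x, 0 <= h x) ->
  norm1 (f + h) = norm1 f + norm1 h.
Proof.
move=> f0 h0; apply: EFin_inj; rewrite EFinD !norm1E -esumD;
  try by move=> x _; rewrite lee_fin.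
apply: eq_esum => x _ /=; rewrite -EFinD !ger0_norm ?f0 ?h0//.
by rewrite addr_ge0.
Qed.

Lemma esum_delta (x : X) : (\esum_(y in [set: X]) `|(y == x)%:R : R|%:E = 1)%E.
Proof.
transitivity (\esum_(y in [set x]) (1%:E : \bar R))%E; last by rewrite esum_set1.
rewrite [RHS]esum_mkcond; apply: eq_esum => y _.
case: eqVneq => [->|/eqP ne]; first by rewrite mem_set// normr1.
by rewrite memNset// normr0.
Qed.

Lemma delta_subproof (x : X) : (fun y => (y == x)%:R) \in l1_pred.
Proof. by apply/asboolP; rewrite /summable esum_delta ltry. Qed.

Definition delta x : l1 := L1 (delta_subproof x).

Lemma norm1_delta x : norm1 (delta x) = 1.
Proof. by apply: EFin_inj; rewrite norm1E esum_delta. Qed.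

End L1.

(** * The norm of square summable functions *)

Section L2Norm.
Variables (R : realType) (gT : groupType).
Implicit Types (f h xi : l2 R gT) (g : gT).

Lemma esum_sqmod f : ((l2norm f ^+ 2)%:E = \esum_(x in [set: gT]) sqmod f x)%E.
Proof.
have fin : (\esum_(x in [set: gT]) sqmod f x)%E \is a fin_num.
  have /asboolP := l2P f; rewrite summableE; congr (_ \is a fin_num).
  by apply: eq_esum => x _; rewrite gee0_abs// sqmod_ge0.
rewrite /l2norm sqr_sqrtr ?fineK//.
by apply: fine_ge0; apply: esum_ge0 => x _; exact: sqmod_ge0.
Qed.

Lemma l2norm_ge0 f : 0 <= l2norm f.
Proof. exact: sqrtr_ge0. Qed.

Lemma l2norm_le f c : 0 <= c ->
  (\esum_(x in [set: gT]) sqmod f x <= (c ^+ 2)%:E)%E -> l2norm f <= c.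
Proof.
by move=> c0; rewrite -esum_sqmod lee_fin ler_pXn2r// nnegrE l2norm_ge0.
Qed.

Lemma esum_sqmodZ (c : R) f : 0 <= c ->
  (\esum_(x in [set: gT]) (c%:E * sqmod f x) <= (c * l2norm f ^+ 2)%:E)%E.
Proof.
move=> c0; rewrite EFinM esum_sqmod; apply: esum_scale_le => // x.
by rewrite sqr_ge0.
Qed.

Lemma sqmodZ (a : R[i]) f x : sqmod (a *: f) x = ((Normc.normc a ^+ 2)%:E * sqmod f x)%E.
Proof. by rewrite /sqmod -EFinM -exprMn -Normc.normcM. Qed.

Lemma sqmodD_le (t : R) f h x : 0 < t ->
  (sqmod (f + h : l2 R gT)%R x <= (1 + t)%:E * sqmod f x + (1 + t^-1)%:E * sqmod h x)%E.
Proof.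
move=> t0; have E : (f + h) x = f x + h x by [].
rewrite !sqmodE E lee_fin; case: (f x) (h x) => a b [c d] /=.
have key (u v : R) : (u + v) ^+ 2 <= (1 + t) * u ^+ 2 + (1 + t^-1) * v ^+ 2.
  rewrite -subr_ge0 (_ : _ - _ = t^-1 * (t * u - v) ^+ 2).
    by rewrite mulr_ge0 ?sqr_ge0// invr_ge0 ltW.
  by field; rewrite gt_eqF.
by have := lerD (key a c) (key b d); lra.
Qed.

Lemma l2norm_eq0 f : l2norm f = 0 -> forall h, l2norm (f + h) = l2norm h.
Proof.
move=> f0 h; have fx x : f x = 0.
  have : (sqmod f x <= 0)%E.
    have <- : (\esum_(x in [set: gT]) sqmod f x = 0)%E by rewrite -esum_sqmod f0 expr0n.
    rewrite (esumID [set x]); last by move=> *; exact: sqmod_ge0.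
    rewrite setTI esum_set1 ?sqmod_ge0// leeDl// esum_ge0// => *.
    exact: sqmod_ge0.
  rewrite lee_fin => le0; apply: Normc.eq0_normc.
  by apply/eqP; rewrite -sqrf_eq0 eq_le le0 sqr_ge0.
congr (l2norm _); apply: val_inj; apply/funext => x.
by rewrite /= -[RHS]add0r -(fx x).
Qed.

(** The Young inequalities [|u + v|^2 <= (1 + t) |u|^2 + (1 + 1/t) |v|^2] with
    [t = |h| / |f|], summed over the group. *)
Lemma l2norm_triangle f h : l2norm (f + h) <= l2norm f + l2norm h.
Proof.
have [f0|f0] := eqVneq (l2norm f) 0; first by rewrite l2norm_eq0// f0 add0r.
have [h0|h0] := eqVneq (l2norm h) 0; first by rewrite addrC l2norm_eq0// h0 addr0.
have {}f0 : 0 < l2norm f by rewrite lt_neqAle eq_sym f0 l2norm_ge0.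
have {}h0 : 0 < l2norm h by rewrite lt_neqAle eq_sym h0 l2norm_ge0.
set t := l2norm h / l2norm f; have t0 : 0 < t by rewrite divr_gt0.
apply: l2norm_le; first by rewrite addr_ge0// ltW.
have tV0 : 0 < t^-1 by rewrite invr_gt0.
have t1 : 0 <= 1 + t by lra.
have t2 : 0 <= 1 + t^-1 by lra.
apply: (@le_trans _ _ ((1 + t) * l2norm f ^+ 2 + (1 + t^-1) * l2norm h ^+ 2)%:E).
  rewrite EFinD; apply: le_trans (leeD (esum_sqmodZ f t1) (esum_sqmodZ h t2)).
  rewrite -esumD => [|x _|x _]; try by rewrite mule_ge0 ?sqmod_ge0// lee_fin.
  by apply: le_esum => x _; exact: sqmodD_le.
rewrite lee_fin /t le_eqVlt; apply/orP; left; apply/eqP; field.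
by rewrite !gt_eqF.
Qed.

Lemma normc_ge0 (a : R[i]) : 0 <= Normc.normc a.
Proof. by case: a => u w; exact: sqrtr_ge0. Qed.

Lemma l2normZ a f : l2norm (a *: f) <= Normc.normc a * l2norm f.
Proof.
apply: l2norm_le; first by rewrite mulr_ge0 ?l2norm_ge0// normc_ge0.
rewrite exprMn; apply: le_trans (esum_sqmodZ f (sqr_ge0 _)).
by apply: le_esum => x _; rewrite sqmodZ.
Qed.

Lemma l2norm0 : l2norm (0 : l2 R gT) = 0.
Proof.
apply/eqP; rewrite eq_le l2norm_ge0 andbT; apply: l2norm_le => //.
by rewrite esum1 ?expr0n// => x _; rewrite sqmodE /= expr0n addr0.
Qed.

Lemma l2normN f : l2norm (- f) = l2norm f.
Proof.
rewrite /l2norm; congr (Num.sqrt (fine _)); apply: eq_esum => x _.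
by rewrite /sqmod -[Normc.normc (f x)]normcN.
Qed.

Lemma l2norm_distC f h : l2norm (f - h) = l2norm (h - f).
Proof. by rewrite -opprB l2normN. Qed.

Lemma l2norm_lreg g f : l2norm (lreg g f) = l2norm f.
Proof.
rewrite /l2norm; congr (Num.sqrt (fine _)).
rewrite [RHS](@reindex_esum _ _ _ [set: gT] [set: gT] (fun x => g^-1 * x)%g)//.
split=> [//|x y _ _ /mulgI//|y _]; exists (g * y)%g => //.
by rewrite mulKg.
Qed.

Lemma lreg_linear g : linear (lreg g : l2 R gT -> l2 R gT).
Proof. by move=> a f h; apply: val_inj. Qed.

Lemma lregB g f h : lreg g (f - h) = lreg g f - lreg g h.
Proof. by apply: val_inj. Qed.

Lemma lregM g g' f : lreg (g * g')%g f = lreg g (lreg g' f).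
Proof. by apply: val_inj; apply/funext => x /=; rewrite invgM mulgA. Qed.

Lemma lreg1 f : lreg 1%g f = f.
Proof. by apply: val_inj; apply/funext => x /=; rewrite invg1 mul1g. Qed.

End L2Norm.

(** * From invariant means to almost invariant vectors *)

Section Reiter.
Variables (R : realType) (gT : groupType) (H : set gT).
Hypothesis amenH : amen R H.

Lemma translate_subproof (g : gT) (q : l1 R gT) :
  (fun x => q (g^-1 * x)%g) \in @l1_pred R gT.
Proof.
apply/asboolP; have /asboolP := l1P q; rewrite /summable.
rewrite (@reindex_esum _ _ _ [set: gT] [set: gT] (fun x => g^-1 * x)%g)//.
split=> [//|x y _ _ /mulgI//|y _]; exists (g * y)%g => //.
by rewrite mulKg.
Qed.

Definition translate g q : l1 R gT := L1 (translate_subproof g q).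

Lemma translate_delta g x : translate g (delta R x) = delta R (g * x)%g.
Proof.
apply: val_inj; apply/funext => y /=; congr (_%:R).
by rewrite -(inj_eq (mulgI g)) mulVKg.
Qed.

(** If no [q] were almost invariant, a functional separating the differences
    [translate h q - q] from [0] would give a bounded function [F >= e] of mean
    [0]. *)
Lemma reiter k (h : 'I_k -> gT) (e : R) : (forall i, H (h i)) -> 0 < e ->
  exists q : l1 R gT, (forall x, 0 <= q x) /\
    \sum_(i < k) norm1 (translate (h i) q - q) < e * norm1 q.
Proof.
move=> Hh e0; apply: contrapT => Hno.
pose E : lmodType R := 'I_k -> l1 R gT.
pose N (u : E) := \sum_(i < k) norm1 (u i).
pose D (q : l1 R gT) : E := fun i => translate (h i) q - q.
pose K (u : E) s := exists q : l1 R gT, [/\ forall x, 0 <= q x, u = D q & s = e * norm1 q].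
have [n1D n1Z] := norm1_sublinear R gT.
have [||||||f [fD fZ fN fK]] := @separation R E N K.
- split=> [u w|a u a0]; rewrite /N.
    by rewrite -big_split; apply: ler_sum => i _; exact: n1D.
  by rewrite mulr_sumr; apply: ler_sum => i _; exact: n1Z.
- by move=> u; apply: eq_bigr => i _; exact: norm1N.
- exists 0; split=> //; last by rewrite sublinear0 ?mulr0//; exact: norm1_sublinear.
  by apply/funext => i; apply: val_inj; apply/funext => x /=; rewrite subrr.
- move=> _ _ _ _ [q [q0 -> ->]] [q' [q'0 -> ->]]; exists (q + q'); split.
  + move=> x; exact: addr_ge0 (q0 x) (q'0 x).
  + apply/funext => i; apply: val_inj; apply/funext => x /=.
    by rewrite opprD addrACA.
  + by rewrite norm1D// mulrDr.
- move=> a _ _ a0 [q [q0 -> ->]]; exists (a *: q); split.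
  + by move=> x; exact: mulr_ge0 (ltW a0) (q0 x).
  + apply/funext => i; apply: val_inj; apply/funext => x /=.
    by rewrite scalerBr.
  + by rewrite (sublinearZ _ (norm1_sublinear R gT)) ?ltW// mulrCA.
- move=> _ _ [q [q0 -> ->]]; rewrite leNgt; apply/negP => lt.
  by apply: Hno; exists q.
have [m [mH inv]] := amenH.
pose single i (u : l1 R gT) : E := fun j => if j == i then u else 0.
have f0 : f 0 = 0 by rewrite -(scale0r 0) fZ mul0r.
have fB u w : f (u - w) = f u - f w by rewrite -scaleN1r fD fZ mulN1r.
(* Evaluated at the differences of the point mass at [x], the functional gives the sum over [i] of
   [F i (h i * x) - F i x], whose mean vanishes by invariance. *)
pose F i x := f (single i (delta R x)).
have bF i : bdd (F i).
  exists 1 => x; apply: le_trans (fN _) _; rewrite /N (bigD1 i)//= big1 => [|j ji].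
    by rewrite /single eqxx norm1_delta addr0.
  by rewrite /single (negPf ji) sublinear0//; exact: norm1_sublinear.
have fsum (u : 'I_k -> E) : f (\sum_(i < k) u i) = \sum_(i < k) f (u i).
  by apply: (big_morph f) => //.
have bG i : bdd (fun x => F i (h i * x)%g - F i x).
  have := bdd_lin (-1) (bF i) (bdd_comp (fun x => h i * x)%g (bF i)); congr bdd.
  by apply/funext => x; rewrite mulN1r addrC.
have mG i : m (fun x => F i (h i * x)%g - F i x) = 0.
  rewrite -[RHS](subrr (m (F i))) -{1}(inv (h i) (Hh i) (F i) (bF i)).
  rewrite addrC -mulN1r -(mean_lin mH)//; last exact: bdd_comp.
  by congr m; apply/funext => x; rewrite mulN1r addrC.
have [bS mS] : bdd (fun x => \sum_(i < k) (F i (h i * x)%g - F i x)) /\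
    m (fun x => \sum_(i < k) (F i (h i * x)%g - F i x)) = 0.
  elim: (index_enum _) => [|i r [bI mI]].
    rewrite (_ : (fun x => _) = fun=> 0); last by apply/funext => x; rewrite big_nil.
    by split; [exact: bdd_cst|exact: mean_cst mH 0].
  rewrite (_ : (fun x => _) = fun x => 1 * (F i (h i * x)%g - F i x) +
      \sum_(j <- r) (F j (h j * x)%g - F j x)); last first.
    by apply/funext => x; rewrite big_cons mul1r.
  by split; [exact: bdd_lin|rewrite (mean_lin mH)// mG mI mulr0 addr0].
suff : m (fun=> e) <= 0 by rewrite (mean_cst mH) leNgt e0.
rewrite -mS; apply: (mean_le mH) => // [|x _]; first exact: bdd_cst.
have : e <= f (D (delta R x)).
  apply: fK; exists (delta R x); split=> //; last by rewrite norm1_delta mulr1.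
rewrite (_ : D _ = \sum_(i < k) (single i (delta R (h i * x)%g) - single i (delta R x))).
  by rewrite fsum; under eq_bigr do rewrite fB.
apply/funext => j; rewrite fct_sumE (bigD1 j)//= big1 ?addr0 => [|i ij].
  rewrite /D translate_delta.
  rewrite (_ : (_ - _) j = single j (delta R (h j * x)%g) j - single j (delta R x) j)//.
  by rewrite /single eqxx.
rewrite (_ : (_ - _) j = single i (delta R (h i * x)%g) j - single i (delta R x) j)//.
by rewrite /single eq_sym (negPf ij) subrr.
Qed.

Lemma sqrt_subproof (q : l1 R gT) : (forall x, 0 <= q x) ->
  (fun x => (Num.sqrt (q x))%:C%C) \in @l2_pred R gT.
Proof.
move=> q0; apply/asboolP; have /asboolP := l1P q; apply: le_lt_trans.
apply: le_esum => x _; rewrite sqmodE /= expr0n addr0 sqr_sqrtr//.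
Qed.

(** The vector is the square root of the summable function from [reiter]: since the square of
    [sqrt a - sqrt b] is at most [|a - b|], precision [d ^+ 2] there gives [d] here. *)
Lemma almost_invariant (S : seq gT) (d : R) : (forall h, h \in S -> H h) -> 0 < d ->
  exists2 xi : l2 R gT, 0 < l2norm xi &
    forall h, h \in S -> l2norm (lreg h xi - xi) <= d * l2norm xi.
Proof.
move=> HS d0; pose h (i : 'I_(size S)) := tnth (in_tuple S) i.
have [|q [q0 lt]] := @reiter _ h (d ^+ 2) _ (exprn_gt0 2 d0).
  by move=> i; apply: HS; exact: mem_tnth.
pose xi : l2 R gT := L2 (sqrt_subproof q0).
have n1_ge0 (i : 'I_(size S)) : 0 <= norm1 (translate (h i) q - q) by exact: norm1_ge0.
have qpos : 0 < norm1 q.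
  have := le_lt_trans (sumr_ge0 _ (fun i _ => n1_ge0 i)) lt.
  by rewrite pmulr_rgt0// exprn_gt0.
have xiE : l2norm xi ^+ 2 = norm1 q.
  apply: EFin_inj; rewrite esum_sqmod norm1E; apply: eq_esum => x _.
  by rewrite sqmodE /= expr0n addr0 sqr_sqrtr// ger0_norm.
exists xi.
  by rewrite lt_neqAle l2norm_ge0 andbT eq_sym -sqrf_eq0 xiE gt_eqF.
move=> g gS; apply: l2norm_le; first by rewrite mulr_ge0 ?l2norm_ge0// ltW.
rewrite exprMn xiE; apply: (@le_trans _ _ (norm1 (translate g q - q))%:E); last first.
  have [i ->] : exists i, g = h i by have /tnthP[i ->] : g \in in_tuple S by []; exists i.
  rewrite lee_fin; apply: le_trans (ltW lt); rewrite (bigD1 i)//= lerDl.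
  exact: sumr_ge0.
rewrite norm1E; apply: le_esum => x _; rewrite sqmodE lee_fin /=.
rewrite !(subr0, oppr0, addr0) expr0n addr0.
have key (a b : R) : 0 <= a -> 0 <= b -> (Num.sqrt a - Num.sqrt b) ^+ 2 <= `|a - b|.
  move=> a0 b0; wlog ab : a b a0 b0 / b <= a => [W|].
    have [/W|/ltW/W] := leP b a; first exact.
    by rewrite -sqrrN opprB distrC; exact.
  rewrite ger0_norm ?subr_ge0// -{2}(sqr_sqrtr a0) -{2}(sqr_sqrtr b0).
  have : Num.sqrt b <= Num.sqrt a by rewrite ler_sqrt.
  have := sqrtr_ge0 b; nra.
exact: key.
Qed.

End Reiter.

(** * The kernel of a quasi-regular representation *)

Section GroupAlgebra.
Variables (R : realType) (gT : groupType).
Implicit Types (f h xi : l2 R gT) (g : gT) (s t : seq (R[i] * gT)).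
Implicit Types (a b : l2 R gT -> l2 R gT).

Local Notation lam := (@group_algebra_op R gT).

Lemma lam_cons p s xi : lam (p :: s) xi = p.1 *: lreg p.2 xi + lam s xi.
Proof. by rewrite /group_algebra_op big_cons. Qed.

Lemma lam_nil xi : lam [::] xi = 0.
Proof. by rewrite /group_algebra_op big_nil. Qed.

Lemma lam_cat s t xi : lam (s ++ t) xi = lam s xi + lam t xi.
Proof. by rewrite /group_algebra_op big_cat. Qed.

Lemma lam_scale (c : R[i]) s xi : lam [seq (c * p.1, p.2) | p <- s] xi = c *: lam s xi.
Proof.
elim: s => [|p s IH]; first by rewrite /= !lam_nil scaler0.
by rewrite /= !lam_cons IH /= scalerDr scalerA.
Qed.

Lemma lam_linear s : linear (lam s).
Proof.
move=> c f h; elim: s => [|p s IH]; first by rewrite !lam_nil scaler0 addr0.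
rewrite !lam_cons IH lreg_linear !scalerDr !scalerA [p.1 * c]mulrC.
by rewrite addrACA.
Qed.

Lemma lam_translate (c : R[i]) g s xi :
  lam [seq (c * p.1, (g * p.2)%g) | p <- s] xi = c *: lreg g (lam s xi).
Proof.
elim: s => [|p s IH].
  rewrite /= !lam_nil (_ : lreg g 0 = 0) ?scaler0//; exact: val_inj.
rewrite /= !lam_cons IH /= -[p.1 *: _ + _]/(p.1 *: _ + _) lreg_linear scalerDr scalerA.
by rewrite lregM.
Qed.

Lemma lam_mul s t xi :
  lam [seq (p.1 * q.1, (p.2 * q.2)%g) | p <- s, q <- t] xi = lam s (lam t xi).
Proof.
elim: s => [|p s IH]; first by rewrite /= !lam_nil.
by rewrite allpairs_cons lam_cat lam_translate lam_cons IH.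
Qed.

Lemma opnorm_leD a b c d : opnorm_le a c -> opnorm_le b d -> opnorm_le (a + b) (c + d).
Proof.
move=> ac bd xi; rewrite mulrDl.
exact: le_trans (l2norm_triangle _ _) (lerD (ac xi) (bd xi)).
Qed.

Lemma opnorm_leZ k a c : opnorm_le a c -> opnorm_le (k *: a) (Normc.normc k * c).
Proof.
move=> ac xi; apply: le_trans (l2normZ _ _) _.
by rewrite -mulrA ler_wpM2l// normc_ge0.
Qed.

Lemma opnorm_leM a b c d : 0 <= c -> opnorm_le a c -> opnorm_le b d ->
  opnorm_le (a \o b) (c * d).
Proof.
move=> c0 ac bd xi; apply: le_trans (ac _) _.
by rewrite -mulrA ler_wpM2l.
Qed.

Lemma opnorm_le_trans a c d : c <= d -> opnorm_le a c -> opnorm_le a d.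
Proof. by move=> cd ac xi; apply: le_trans (ac xi) _; rewrite ler_wpM2r ?l2norm_ge0. Qed.

Lemma bounded_pos a : bounded_operator a -> exists2 c, 0 < c & opnorm_le a c.
Proof.
move=> [_ [c ac]]; exists (`|c| + 1); first by rewrite ltr_wpDl.
by apply: opnorm_le_trans ac; rewrite (le_trans (ler_norm c))// lerDl.
Qed.

Lemma bounded_lin k a b : bounded_operator a -> bounded_operator b ->
  bounded_operator (k *: a + b).
Proof.
move=> [la [c ac]] [lb [d bd]]; split.
  move=> z f h; have E u : (k *: a + b) u = k *: a u + b u by [].
  rewrite !E la lb scalerDr !scalerA [k * z]mulrC addrACA -!scalerA.
  by rewrite scalerDr.
by exists (Normc.normc k * c + d); exact/opnorm_leD/bd/opnorm_leZ.
Qed.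

Lemma bounded_comp a b : bounded_operator a -> bounded_operator b ->
  bounded_operator (a \o b).
Proof.
move=> Ba Bb; have [c c0 ac] := bounded_pos Ba; have [d d0 bd] := bounded_pos Bb.
split; last by exists (c * d); apply: opnorm_leM => //; exact: ltW.
by move=> z f h; rewrite /= (proj1 Bb) (proj1 Ba).
Qed.

Lemma bounded_lam s : bounded_operator (lam s).
Proof.
split; first exact: lam_linear.
elim: s => [|p s [c IH]].
  by exists 0 => xi; rewrite lam_nil l2norm0 mul0r.
exists (Normc.normc p.1 + c) => xi; rewrite lam_cons mulrDl.
apply: le_trans (l2norm_triangle _ _) (lerD _ (IH xi)).
by apply: le_trans (l2normZ _ _) _; rewrite l2norm_lreg.
Qed.

Local Notation C := (@reduced_cstar R gT).

Lemma cstar_lam s : C (lam s).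
Proof.
split; first exact: bounded_lam.
move=> e e0; exists (lam s); first by exists s.
by move=> xi; rewrite (_ : (lam s - lam s) xi = 0) ?subrr ?l2norm0 ?mulr_ge0 ?l2norm_ge0// ltW.
Qed.

Lemma linear_oppr a u w : linear a -> a (u - w) = a u - a w.
Proof. by move=> la; rewrite addrC -scaleN1r la scaleN1r addrC. Qed.

Lemma cstar_lin k a b : C a -> C b -> C (k *: a + b).
Proof.
move=> [Ba Ca] [Bb Cb]; split; first exact: bounded_lin.
(* Adding one avoids dividing by zero when [k] is zero. *)
move=> e e0; have k0 : 0 < Normc.normc k + 1 by rewrite ltr_wpDl// normc_ge0.
have [|_ [s _ <-] as_] := Ca (e / 2 / (Normc.normc k + 1)); first by rewrite !divr_gt0.
have [|_ [t _ <-] bt] := Cb (e / 2); first by rewrite divr_gt0.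
exists (lam ([seq (k * p.1, p.2) | p <- s] ++ t)); first by eexists.
have -> : k *: a + b - lam ([seq (k * p.1, p.2) | p <- s] ++ t) =
    k *: (a - lam s) + (b - lam t).
  apply/funext => xi.
  transitivity (k *: a xi + b xi - lam ([seq (k * p.1, p.2) | p <- s] ++ t) xi) => //.
  rewrite lam_cat lam_scale.
  transitivity (k *: (a xi - lam s xi) + (b xi - lam t xi)) => //.
  by rewrite scalerBr opprD addrACA.
apply: opnorm_le_trans (opnorm_leD (opnorm_leZ k as_) bt).
rewrite [leRHS](splitr e) lerD2r mulrCA -[leRHS]mulr1 ler_wpM2l ?divr_ge0 ?ltW//.
by rewrite ltr_pdivrMr// mul1r ltrDl.
Qed.

Lemma cstar_comp a b : C a -> C b -> C (a \o b).
Proof.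
move=> [Ba Ca] [Bb Cb]; split; first exact: bounded_comp.
move=> e e0; have [c c0 ac] := bounded_pos Ba.
(* The error is [a (b - t) + (a - s) t], so [t] is chosen first and the precision of [s] depends on
   a bound for [t]. *)
have [|_ [t _ <-] bt] := Cb (e / 2 / c); first by rewrite !divr_gt0.
have [d d0 td] := bounded_pos (bounded_lam t).
have [|_ [s _ <-] as_] := Ca (e / 2 / d); first by rewrite !divr_gt0.
exists (lam [seq (p.1 * q.1, (p.2 * q.2)%g) | p <- s, q <- t]); first by eexists.
have -> : (a \o b) - lam [seq (p.1 * q.1, (p.2 * q.2)%g) | p <- s, q <- t] =
    (a \o (b - lam t)) + ((a - lam s) \o lam t).
  apply/funext => xi.
  transitivity (a (b xi) - lam [seq (p.1 * q.1, (p.2 * q.2)%g) | p <- s, q <- t] xi) => //.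
  rewrite lam_mul.
  transitivity (a (b xi - lam t xi) + (a (lam t xi) - lam s (lam t xi))) => //.
  by rewrite (linear_oppr _ _ (proj1 Ba)) addrA subrK.
have ed0 : 0 <= e / 2 / d by rewrite !divr_ge0// ltW.
have h := opnorm_leD (opnorm_leM (ltW c0) ac bt) (opnorm_leM ed0 as_ td).
apply: (opnorm_le_trans _ h).
by rewrite mulrC divfK ?gt_eqF// divfK ?gt_eqF// -splitr.
Qed.

Section Ideal.
Variable H : set gT.

Definition inv_vec (S : seq gT) (d : R) xi :=
  forall k, k \in S -> l2norm (lreg k xi - xi) <= d * l2norm xi.

(** [b] vanishes in the quasi-regular representation on [gT / H], obtained
    as a limit of the vectors [lam t xi] for almost [H]-invariant [xi]. *)
Definition vanishing b := forall t e, 0 < e -> exists S d,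
  [/\ 0 < d, forall k, k \in S -> H k &
      forall xi, inv_vec S d xi -> l2norm (b (lam t xi)) <= e * l2norm xi].

Lemma inv_vec_cat S1 S2 d1 d2 xi : inv_vec (S1 ++ S2) (Num.min d1 d2) xi ->
  inv_vec S1 d1 xi /\ inv_vec S2 d2 xi.
Proof.
move=> iv; split=> k kS; (apply: le_trans (iv k _) _; first by rewrite mem_cat kS ?orbT);
  by rewrite ler_wpM2r ?l2norm_ge0// ge_min lexx ?orbT.
Qed.

Definition kernel_ideal : set (l2 R gT -> l2 R gT) := [set a | C a /\ vanishing a].

Lemma vanishing_approx a : linear a ->
  (forall e, 0 < e -> exists2 b, vanishing b & opnorm_le (a - b) e) -> vanishing a.
Proof.
move=> la H1 t e e0; have [c c0 tc] := bounded_pos (bounded_lam t).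
have [|b vb ab] := H1 (e / 2 / c); first by rewrite !divr_gt0.
have [|S [d [d0 SH Sd]]] := vb t (e / 2); first by rewrite divr_gt0.
exists S, d; split=> // xi /Sd bxi.
rewrite -[a _](subrK (b (lam t xi))) [e]splitr mulrDl.
apply: le_trans (l2norm_triangle _ _) (lerD _ bxi).
apply: le_trans (ab (lam t xi)) _.
have -> : e / 2 * l2norm xi = e / 2 / c * (c * l2norm xi).
  by rewrite [RHS]mulrA divfK// gt_eqF.
by rewrite ler_wpM2l// !divr_ge0// ltW.
Qed.

Lemma vanishing_lin k a b : vanishing a -> vanishing b -> vanishing (k *: a + b).
Proof.
move=> va vb t e e0; have k0 : 0 < Normc.normc k + 1 by rewrite ltr_wpDl// normc_ge0.
have [|S1 [d1 [d10 S1H a1]]] := va t (e / 2 / (Normc.normc k + 1)).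
  by rewrite !divr_gt0.
have [|S2 [d2 [d20 S2H a2]]] := vb t (e / 2); first by rewrite divr_gt0.
exists (S1 ++ S2), (Num.min d1 d2); split.
- by rewrite lt_min d10.
- by move=> h; rewrite mem_cat => /orP[/S1H|/S2H].
move=> xi /inv_vec_cat[/a1 e1 /a2 e2]; rewrite [e]splitr mulrDl.
apply: le_trans (l2norm_triangle _ _) (lerD _ e2).
apply: le_trans (l2normZ _ _) _.
have -> : e / 2 * l2norm xi = (Normc.normc k + 1) * (e / 2 / (Normc.normc k + 1) * l2norm xi).
  by rewrite mulrA [_ * (e / 2 / _)]mulrC divfK// gt_eqF.
apply: ler_pM => //; rewrite ?normc_ge0 ?l2norm_ge0//.
by rewrite lerDl.
Qed.

Lemma vanishing_compl a b : bounded_operator a -> vanishing b -> vanishing (a \o b).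
Proof.
move=> Ba vb t e e0; have [c c0 ac] := bounded_pos Ba.
have [|S [d [d0 SH Sd]]] := vb t (e / c); first by rewrite divr_gt0.
exists S, d; split=> // xi /Sd bxi; apply: le_trans (ac _) _.
have -> : e * l2norm xi = c * (e / c * l2norm xi).
  by rewrite mulrA [c * _]mulrC divfK// gt_eqF.
by rewrite ler_wpM2l// ltW.
Qed.

(** For [a] in the group algebra, [a] followed into [lam t] is again some [lam], which is why
    [vanishing] ranges over all [t]; approximation gives the general case. *)
Lemma vanishing_compr a b : C a -> bounded_operator b -> vanishing b ->
  vanishing (b \o a).
Proof.
move=> [Ba Ca] Bb vb; apply: vanishing_approx.
  by case: (bounded_comp Bb Ba).
move=> e e0; have [c c0 bc] := bounded_pos Bb.
have [|_ [s _ <-] as_] := Ca (e / c); first by rewrite divr_gt0.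
exists (b \o lam s).
  move=> t e' e'0.
  have [S [d [d0 SH Sd]]] := vb [seq (p.1 * q.1, (p.2 * q.2)%g) | p <- s, q <- t] e' e'0.
  by exists S, d; split=> // xi /Sd; rewrite lam_mul.
have -> : (b \o a) - (b \o lam s) = b \o (a - lam s).
  by apply/funext => xi; exact/esym/linear_oppr/(proj1 Bb).
by apply: opnorm_le_trans (opnorm_leM (ltW c0) bc as_); rewrite mulrC divfK// gt_eqF.
Qed.

Lemma kernel_ideal_closed : closed_ideal kernel_ideal.
Proof.
have lam0 : lam [::] = 0 by apply/funext => xi; rewrite lam_nil.
split.
- by move=> a [].
- split; first by rewrite -lam0; exact: cstar_lam.
  move=> t e e0; exists [::], 1; split=> // xi _.
  by rewrite l2norm0 mulr_ge0 ?l2norm_ge0// ltW.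
- by move=> k a b [Ca va] [Cb vb]; split; [exact: cstar_lin|exact: vanishing_lin].
- move=> a b Ca [Cb vb]; split; split.
  + exact: cstar_comp.
  + by apply: vanishing_compl => //; case: Ca.
  + exact: cstar_comp.
  + by apply: vanishing_compr => //; case: Cb.
move=> a [Ba Ha]; split; last first.
  by apply: vanishing_approx => [|e /Ha[b [_ vb] ab]]; [case: Ba|exists b].
split=> // e e0; have [|b [[_ Cb] _] ab] := Ha (e / 2); first by rewrite divr_gt0.
have [|c cS bc] := Cb (e / 2); first by rewrite divr_gt0.
exists c => //; rewrite [e]splitr (_ : a - c = (a - b) + (b - c)); last by rewrite addrA subrK.
exact: opnorm_leD.
Qed.

Lemma id_not_vanishing : amen R H -> ~ vanishing id.
Proof.
move=> aH /(_ [:: (1, 1%g)] (2^-1)); rewrite invr_gt0 => /(_ ltac:(lra)).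
move=> [S [d [d0 SH Sd]]]; have [xi xi0 /Sd] := almost_invariant aH SH d0.
rewrite lam_cons lam_nil addr0 scale1r lreg1; lra.
Qed.

(** The product [(1 - a) (1 - b)] kills every coset fixed by [b], and every
    coset [x H] such that [a] fixes both [x H] and [b x H]. *)
Definition commuting_product (a b : gT) : seq (R[i] * gT) :=
  [:: (1, 1%g); (-1, a); (-1, b); (1, (a * b)%g)].

Lemma commuting_productE (a b : gT) xi :
  lam (commuting_product a b) xi = xi - lreg a xi - lreg b xi + lreg a (lreg b xi).
Proof.
rewrite /commuting_product !lam_cons lam_nil addr0 /= !scale1r !scaleN1r lreg1 lregM.
by rewrite !addrA.
Qed.

Lemma commuting_product_vanishing (a b : gT) :
  (forall g, H (g^-1 * b * g)%g \/
     H (g^-1 * a * g)%g /\ H ((b * g)^-1 * a * (b * g))%g) ->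
  vanishing (lam (commuting_product a b)).
Proof.
move=> HH; set L := lam _.
have lL : linear L by exact: lam_linear.
have lreg_dist g k xi : l2norm (lreg k (lreg g xi) - lreg g xi) =
    l2norm (lreg (g^-1 * k * g)%g xi - xi).
  by rewrite -[RHS](l2norm_lreg g) lregB -!lregM !mulgA mulgV mul1g.
(* By linearity one translate [lreg g xi] can be treated at a time, and [k] displaces it as much as
   [g^-1 * k * g] displaces [xi]. *)
have one g e : 0 < e -> exists S d, [/\ 0 < d, forall k, k \in S -> H k &
    forall xi, inv_vec S d xi -> l2norm (L (lreg g xi)) <= e * l2norm xi].
  move=> e0; have e20 : 0 < e / 2 by rewrite divr_gt0.
  have [Hb|[Ha Hab]] := HH g.
    exists [:: (g^-1 * b * g)%g], (e / 2); split=> // [k|xi iv].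
      by rewrite inE => /eqP ->.
    have := iv _ (mem_head _ _); rewrite -lreg_dist; set u := lreg g xi => bu.
    rewrite /L commuting_productE.
    (* This grouping involves only the displacement of [u] by [b]; the one in the other case
       involves those of [u] and of [lreg b u] by [a]. *)
    have -> : u - lreg a u - lreg b u + lreg a (lreg b u) =
        (u - lreg b u) + lreg a (lreg b u - u).
      by rewrite lregB -!addrA; congr (u + _); rewrite addrCA [_ + lreg a (lreg b u)]addrC addrA.
    rewrite [e]splitr mulrDl; apply: le_trans (l2norm_triangle _ _) _.
    by rewrite l2norm_lreg lerD// l2norm_distC.
  exists [:: (g^-1 * a * g)%g; ((b * g)^-1 * a * (b * g))%g], (e / 2); split=> // [k|xi iv].
    by rewrite !inE => /orP[/eqP ->|/eqP ->].
  have h1 := iv _ (mem_head _ _).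
  have h2 : l2norm (lreg ((b * g)^-1 * a * (b * g))%g xi - xi) <= e / 2 * l2norm xi.
    by apply: iv; rewrite !inE eqxx orbT.
  rewrite -lreg_dist in h1; rewrite -lreg_dist lregM in h2.
  move: h1 h2; set u := lreg g xi => h1 h2.
  rewrite /L commuting_productE.
  have -> : u - lreg a u - lreg b u + lreg a (lreg b u) =
      (u - lreg a u) + (lreg a (lreg b u) - lreg b u).
    by rewrite -!addrA; congr (_ + (_ + _)); rewrite addrC.
  rewrite [e]splitr mulrDl; apply: le_trans (l2norm_triangle _ _) _.
  by rewrite lerD// l2norm_distC.
elim=> [|p t IH] e e0.
  exists [::], 1; split=> // xi _; rewrite lam_nil.
  have -> : L 0 = 0 by have := linear_oppr 0 0 lL; rewrite !subrr.
  by rewrite l2norm0 mulr_ge0 ?l2norm_ge0// ltW.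
have k0 : 0 < Normc.normc p.1 + 1 by rewrite ltr_wpDl// normc_ge0.
have [|S1 [d1 [d10 S1H a1]]] := one p.2 (e / 2 / (Normc.normc p.1 + 1)).
  by rewrite !divr_gt0.
have [|S2 [d2 [d20 S2H a2]]] := IH (e / 2); first by rewrite divr_gt0.
exists (S1 ++ S2), (Num.min d1 d2); split.
- by rewrite lt_min d10.
- by move=> h; rewrite mem_cat => /orP[/S1H|/S2H].
move=> xi /inv_vec_cat[/a1 e1 /a2 e2]; rewrite [e]splitr mulrDl lam_cons lL.
apply: le_trans (l2norm_triangle _ _) (lerD _ e2).
apply: le_trans (l2normZ _ _) _.
have -> : e / 2 * l2norm xi =
    (Normc.normc p.1 + 1) * (e / 2 / (Normc.normc p.1 + 1) * l2norm xi).
  by rewrite mulrA [_ * (e / 2 / _)]mulrC divfK// gt_eqF.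
apply: ler_pM => //; rewrite ?normc_ge0 ?l2norm_ge0//.
by rewrite lerDl.
Qed.

Lemma point_subproof : (fun x : gT => (x == 1%g)%:R : R[i]) \in @l2_pred R gT.
Proof.
apply/asboolP; apply: le_lt_trans (ltry (1 : R)).
rewrite -(esum_delta R (1%g : gT)); apply: le_esum => x _; rewrite sqmodE.
by case: (x == 1%g); rewrite /= ?expr1n ?expr0n ?addr0 ?normr1 ?normr0 ?abse0 ?abse1.
Qed.

Lemma commuting_product_neq0 (a b : gT) : a != 1%g -> b != 1%g ->
  lam (commuting_product a b) <> 0.
Proof.
move=> a1 b1 L0; pose xi := L2 point_subproof.
have := commuting_productE a b xi; rewrite L0 => /(congr1 (fun f : l2 R gT => f 1%g)).
rewrite (_ : ((0 : l2 R gT -> l2 R gT) xi : l2 R gT) 1%g = 0)//.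
rewrite (_ : (_ : l2 R gT) 1%g = xi 1%g - xi (a^-1 * 1)%g - xi (b^-1 * 1)%g
   + xi (b^-1 * (a^-1 * 1))%g)// /= !mulg1 eqxx !invg_eq1 (negPf a1) (negPf b1) !subr0.
(* The image of the point mass at [1] has value 2 or 1 there, according to whether [b^-1 * a^-1] is
   trivial. *)
case: (_ == _); rewrite ?addr0 /= => /esym/eqP.
  by rewrite -mulr2n pnatr_eq0.
by rewrite oner_eq0.
Qed.

Lemma not_cstar_simple (a b : gT) : amen R H -> a != 1%g -> b != 1%g ->
  (forall g, H (g^-1 * b * g)%g \/
     H (g^-1 * a * g)%g /\ H ((b * g)^-1 * a * (b * g))%g) ->
  ~ cstar_simple R gT.
Proof.
move=> aH a1 b1 HH /(_ _ kernel_ideal_closed)[I0|IC].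
  apply: (commuting_product_neq0 a1 b1).
  suff : kernel_ideal (lam (commuting_product a b)) by rewrite I0.
  by split; [exact: cstar_lam|exact: commuting_product_vanishing].
apply: (id_not_vanishing aH).
suff [] : kernel_ideal id by [].
rewrite IC (_ : id = lam [:: (1, 1%g)]); first exact: cstar_lam.
by apply/funext => xi; rewrite lam_cons lam_nil addr0 scale1r lreg1.
Qed.

End Ideal.
End GroupAlgebra.

(** * Elements fixing half-trees pointwise *)

Section FixHalfTrees.
Variables (T : tree) (G : groupClosed (aut T)).
Hypotheses (minG : minimal_action G) (gtG : general_type G).

Lemma subgroup_Pw : {subset G <= Pw G}.
Proof.
move=> g gG; have [v] := tree_inh T; apply/asboolP; exists [set v]; split.
- exact: finite_set1.
- by exists v.
- by move=> _ _ -> ->; exists [::].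
- by move=> w _ _; exists g.
Qed.

Lemma swap_Pw (g : aut T) v c (gv : g v = v) (cv : adj c v) : g \in G ->
  swap gv cv \in Pw G.
Proof.
move=> gG; have gcv : adj (g c) v by rewrite -{1}gv aut_adj.
apply/asboolP; exists [set v; c; g c]; split.
- by rewrite !finite_setU; repeat split; exact: finite_set1.
- by exists v; left; left.
- apply: (@rooted_subtree _ _ v) => z [[->|->]|->].
  + by exists [::].
  + exists [:: v]; rewrite /= cv; split=> // t; rewrite inE => /eqP ->.
    by left; left.
  + exists [:: v]; rewrite /= gcv; split=> // t; rewrite inE => /eqP ->.
    by left; left.
have Av : [set v; c; g c] v by left; left.
have Ac : [set v; c; g c] c by left; right.
have Agc : [set v; c; g c] (g c) by right.
have toward d z : adj d v -> is_projection [set v; c; g c] z d -> half d v z.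
  by move=> dv [_ /(_ v Av)]; rewrite /half /=; have := dist_adj_neq z dv; lia.
move=> w [[->|->]|->] _.
- exists 1%g; first exact: gpred1.
  move=> z [_ pz]; apply: swap_out; rewrite /half /=; apply/negP; rewrite -leqNgt; exact: pz.
- by exists g => // z /(toward c z cv) hz; exact: swap_in.
have [e|ne] := eqVneq (g c) c.
  by exists g => // z /(toward _ z gcv) hz; rewrite e in hz; exact: swap_in.
exists g^-1%g; first by rewrite gpredV.
by move=> z /(toward _ z gcv) hz; rewrite /= swap_in'// (negPf ne).
Qed.

(** Take a branch on which [g] is non-trivial. The [swap] built there is supported on that branch
    and its image, and the three neighbours of [v] leave another branch untouched. *)
Lemma Pw_fixes_half_tree v (g : aut T) : branching v -> g \in G -> g v = v ->
  g != 1%g ->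
  exists f a, [/\ f \in Pw G, f != 1%g, adj a v & forall z, half a v z -> f z = z].
Proof.
move=> [p [q [r [[pv qv rv] [pq pr qr]]]]] gG gv g1.
have [z gz] : exists z, g z != z.
  apply: contrapT => H; case/eqP: g1; apply/autP => z.
  by apply: contrapT => gz; apply: H; exists z; apply/eqP.
have zv : v != z by apply: contraNneq gz => <-; rewrite gv.
have [c [vc ec]] := step_toward zv.
have cv : adj c v by rewrite adj_sym.
have gcv : adj (g c) v by rewrite -{1}gv aut_adj.
have hz : half c v z by rewrite /half /= !(dist_sym z) ec.
have [a [av ac agc]] : exists a, [/\ adj a v, a != c & a != g c].
  have [pc|pc] := eqVneq p c; have [pg|pg] := eqVneq p (g c);
    have [qc|qc] := eqVneq q c; have [qg|qg] := eqVneq q (g c);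
    have [rc|rc] := eqVneq r c; have [rg|rg] := eqVneq r (g c);
    subst; rewrite ?eqxx// in pq pr qr *; by [exists p|exists q|exists r].
exists (swap gv cv), a; split=> //; first exact: swap_Pw.
  apply: contraNneq gz => e; apply/eqP.
  by rewrite -[RHS](aut1E z) -e /= swap_in.
by move=> w hw; apply: swap_out => h; [exact: half_disjoint av cv ac hw h|
  exact: half_disjoint av gcv agc hw h].
Qed.

Lemma Pw_half_tree_fixator :
  (forall v : T, nontrivial (fixator G [set v])) ->
  forall A : set T, half_tree A -> nontrivial (fixator (Pw G) A).
Proof.
move=> nt A /half_treeP[x [y [xy ->]]].
have [v bv] := branching_exists minG gtG.
have [g /andP[gG /asboolP gv] g1] := nt v.
have [f [a [fP f1 av fE]]] := Pw_fixes_half_tree bv gG (gv v erefl) g1.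
have [h hG hE] := half_into_half minG gtG xy av.
exists (f ^ h)%g.
  apply/andP; split; first by rewrite gpredJ// subgroup_Pw.
  apply/asboolP => z /hE hz.
  have -> : (f ^ h)%g z = h^-1%g (f (h z)) by [].
  by rewrite fE// autK.
apply: contraNneq f1 => e.
by rewrite -(conjgK h f) e conj1g.
Qed.

End FixHalfTrees.

Lemma fixed_half_trees_not_cstar_simple (R : realType) (T : tree)
    (Gam : groupClosed (aut T)) (v x y : T) :
  amen R [set g : aut T | g \in Gam /\ g v = v] -> adj x y ->
  nontrivial (fixator Gam (half x y)) -> nontrivial (fixator Gam (half y x)) ->
  ~ cstar_simple R (subgroup Gam).
Proof.
move=> aS xy [a /andP[aG /asboolP aE] a1] [b /andP[bG /asboolP bE] b1].
have aH := amen_subgroup (H := Gam) (fun g => @proj1 _ _) aS.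
pose a' : subgroup Gam := Sub a aG; pose b' : subgroup Gam := Sub b bG.
apply: (not_cstar_simple (a := a') (b := b') aH).
- by apply: contraNneq a1 => /(congr1 val) e; exact/eqP.
- by apply: contraNneq b1 => /(congr1 val) e; exact/eqP.
have stab (k g : subgroup Gam) : (val k : aut T) ((val g : aut T) v) = (val g : aut T) v ->
    val (g^-1 * k * g)%g \in Gam /\ (val (g^-1 * k * g)%g : aut T) v = v.
  move=> e; split; first exact: valP.
  have -> : (val (g^-1 * k * g)%g : aut T) v =
    (val g : aut T)^-1%g ((val k : aut T) ((val g : aut T) v)) by [].
  by rewrite e autK.
move=> g; set w := (val g : aut T) v.
have [hw|/(halfC _ xy) hw] := pselect (half x y w); last by left; apply: stab; exact: bE.
right; split; first by apply: stab; exact: aE.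
apply: stab; apply: aE.
have -> : (val (b' * g)%g : aut T) v = b w by [].
(* [b] preserves the complement of [half y x]: were [b w] in [half y x], it would be fixed by [b],
   so that [b w = w]. *)
apply: contrapT => /(halfC _ xy) hb.
have bw : b w = w by apply: (@aut_inj _ b); exact: bE.
by move: hb; rewrite bw => /(halfC _ xy).
Qed.

Theorem theoremB (R : realType) (T : tree) (G Gam : groupClosed (aut T)) :
  countable [set` G] ->
  minimal_action G ->
  general_type G ->
  (forall v : T, amenable R (subgroup (fixator G [set v]))) ->
  {subset G <= Gam} ->
  {subset Gam <= Pw G} ->
  [/\ trivial_amenable_radical R (subgroup Gam),
      (forall A : set T, half_tree A -> nontrivial (fixator Gam A)) ->
        ~ cstar_simple R (subgroup Gam)
    & (forall v : T, nontrivial (fixator G [set v])) ->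
        ~ cstar_simple R (subgroup (Pw G))].
Proof.
move=> _ minG gtG amG GGam GamP.
have amG' v : amen R [set g : aut T | g \in G /\ g v = v].
  have := amen_amenable (amG v); congr amen; apply/seteqP; split=> g /=.
    by move=> /andP[gG /asboolP gv]; split=> //; exact: gv.
  by move=> [gG gv]; apply/andP; split=> //; apply/asboolP => _ ->.
(* Both non-simplicity statements are instances, with [D] equal to [Gam] and to [Pw G]; in the
   second the half-tree fixators are non-trivial by [Pw_half_tree_fixator]. *)
have notsimple (D : groupClosed (aut T)) : {subset D <= Pw G} ->
    (forall A : set T, half_tree A -> nontrivial (fixator D A)) ->
    ~ cstar_simple R (subgroup D).
  move=> DP nt; have [v [a [b [c [[av bv cv] _]]]]] := branching_exists minG gtG.
  have va : adj v a by rewrite adj_sym.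
  apply: (fixed_half_trees_not_cstar_simple (vertex_stabilizer_amen v amG' DP) av).
    by apply: nt; apply/half_treeP; exists a, v.
  by apply: nt; apply/half_treeP; exists v, a.
split; last 2 first.
- exact: notsimple.
- move=> nt; apply: notsimple => //; exact: Pw_half_tree_fixator.
by apply: trivial_radical => M nM; exact: (amenable_normal_trivial minG gtG GGam nM).
Qed.
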